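(* Let $X$ be a smooth projective toric variety with total coordinate ring $S$. For each $d\in\operatorname{Nef}X$, let $D$ be the labeled cell complex, $F_\bullet$ the cellular complex of free $S$-modules, and $\operatorname{trunc}_d(S)$ the monomial ideal (possibly larger than the ideal generated by $S_d$) associated to $d$ as defined in the context. Then the complex $F_\bullet$ (1) has a cellular structure supported on the polytope $P_d$ of monomials in $S_d$ (i.e. it is the cellular complex of the labeled cell complex $D$, whose underlying space is $P_d$); (2) is a graded free resolution of $\operatorname{trunc}_d(S)$, i.e. $H_i(F_\bullet)=0$ for $i>0$ and $H_0(F_\bullet)\cong\operatorname{trunc}_d(S)$; (3) has length at most $\dim X$, i.e. $F_i=0$ for $i>\dim X$; (4) agrees with the short virtual resolution of Hanlon, Hicks, and Lazarev: the sheafification $\tilde F_\bullet(d)$ of the twist $F_\bullet(d)$ is isomorphic, as a complex of sheaves on $X$, to the Fourier--Mukai transform of $\mathcal O(d)$ with respect to the Hanlon--Hicks--Lazarev resolution of the diagonal $\tilde G_\bullet$ (see context).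
   Context: Toric setup. $X$ is a smooth projective toric variety over an algebraically closed field $k$, given by a fan of full dimension. $M$ is the character lattice, $N$ the lattice of one-parameter subgroups, $\langle\cdot,\cdot\rangle:M\times N\to\mathbb Z$ the pairing, and $u_1,\dots,u_r\in N$ the primitive ray generators. $S=k[x_1,\dots,x_r]$ is the total coordinate (Cox) ring, graded by $\operatorname{Pic}X$ with $\deg x_i$ the class of the torus-invariant divisor of $u_i$; $x^\alpha=\prod x_i^{\alpha_i}$ for $\alpha\in\mathbb Z^r$ (Laurent monomials allowed), and $\deg x^\alpha\in\operatorname{Pic}X$. Twists: $S(a)_b=S_{a+b}$. The exact sequence $0\to M\to\mathbb Z^r\to\operatorname{Pic}X\to0$ has first map $m\mapsto(\langle m,u_1\rangle,\dots,\langle m,u_r\rangle)$; via it $M$ and $M\otimes\mathbb R$ are identified with their images in $\mathbb Z^r$ and $\mathbb R^r$. Vector inequalities, $\lceil\cdot\rceil$, and $\lfloor\cdot\rfloor$ are componentwise. $\operatorname{Nef}X\subset\operatorname{Pic}X$ is the set of nef classes. The complex $D$. Fix $d\in\operatorname{Nef}X$ and $\alpha\in\mathbb Z^r$ with $\deg x^\alpha=d$. Let $C$ be the cell structure on $\mathbb R^r$ whose codimension 1 skeleton is the union of the hyperplanes $\{\beta_i=n\}$, $1\le i\le r$, $n\in\mathbb Z$. Restricting $C$ to the affine space $\alpha+M\otimes\mathbb R$ gives a polyhedral cell structure whose (relatively) open cells are the nonempty intersections of open cells of $C$ with $\alpha+M\otimes\mathbb R$. $D$ is the subcomplex of those cells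 contained in $\mathbb R^r_{\ge0}$; its support is the polytope $P_d=\{\beta\in\alpha+M\otimes\mathbb R:\beta\ge0\}$, whose integral points are exactly the exponents of the monomials in $S_d$. Label a cell of $D$ by $x^{\lceil\beta\rceil}$ for any $\beta$ in its relative interior (independent of the choice of $\beta$). The ideal. $\operatorname{trunc}_d(S)\subseteq S$ (the ceiling truncation of $S$ at $d$) is the ideal generated by all labels of cells of $D$. The complex $F_\bullet$. An incidence function $\varepsilon$ assigns to a cell $\sigma$ and a codimension 1 face $\tau$ of it a sign $\varepsilon(\sigma,\tau)\in\{\pm1\}$ (and $0$ for other pairs), as for the cellular chain complex of a regular cell complex (oriented boundary signs). Put $F_i=\bigoplus_{\dim\sigma=i}S(-\deg\ell_\sigma)e_\sigma$, the sum over cells $\sigma$ of $D$ of dimension $i$ with label $\ell_\sigma$, and $\partial e_\sigma=\sum_\tau\varepsilon(\sigma,\tau)\frac{\ell_\sigma}{\ell_\tau}e_\tau$, the sum over codimension 1 faces $\tau$ of $\sigma$. The Hanlon--Hicks--Lazarev resolution of the diagonal. Let $R=S\otimes_kS$ be the Cox ring of $X\times X$. Restrict $C$ to $M\otimes\mathbb R\subset\mathbb R^r$; this cell structure is invariant under translation by $M$; let $E$ be the quotient cell structure on the torus $(M\otimes\mathbb R)/M$. Use an incidence function $\varepsilon$ on the restriction of $C$ to $M\otimes\mathbb R$ invariant under simultaneous translation of pairs of cells by $M$; translation by $\alpha$ transports it to $D$, and this is the $\varepsilon$ used in $F_\bullet$. $G_j$ is the direct sum, over cells of $E$ of dimension $j$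 (represented by a cell $\sigma$ of $M\otimes\mathbb R$ with interior point $\gamma$), of $S(\deg x^{\lfloor-\gamma\rfloor})\otimes_kS(\deg x^{\lfloor\gamma\rfloor})$, and the differential on the summand of $\sigma$ is the sum, over codimension 1 faces $\tau$ of $\sigma$ in $M\otimes\mathbb R$ with interior point $\delta$, of the maps to the summand of the image of $\tau$ in $E$ given by multiplication by $\varepsilon(\sigma,\tau)\,x^{\lceil\gamma\rceil-\lceil\delta\rceil}\otimes x^{\lfloor\delta\rfloor-\lfloor\gamma\rfloor}$. Its sheafification $\tilde G_\bullet$ is a resolution of the structure sheaf of the diagonal of $X\times X$ (Hanlon--Hicks--Lazarev). Fourier--Mukai transform. With $p,q:X\times X\to X$ the first and second projections, the Fourier--Mukai transform of $\mathcal O(d)$ with respect to $\tilde G_\bullet$ is $Rp_*(Lq^*\mathcal O(d)\otimes^L\tilde G_\bullet)$. For $d$ nef the spectral sequence computing it reduces to a single row, and the transform means that row: the complex of sheaves $p_*(q^*\mathcal O(d)\otimes\tilde G_\bullet)$, with terms the direct sums over the cells of $E$ of $\mathcal O(\deg x^{\lfloor-\gamma\rfloor})\otimes_k\Gamma(X,\mathcal O(d+\deg x^{\lfloor\gamma\rfloor}))$ and differential induced by that of $G_\bullet$. *)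

(* Defs.v *)
From HB Require Import structures.
From mathcomp Require Import all_boot all_order all_algebra.
From mathcomp Require Import finmap.
From mathcomp Require Import boolp classical_sets functions cardinality fsbigop.
From mathcomp Require Import reals.
From mathcomp Require Import monalg mpoly.
Set Implicit Arguments.
Unset Strict Implicit.
Unset Printing Implicit Defensive.
Import Order.TTheory GRing.Theory Num.Theory.
Local Open Scope classical_set_scope.
Local Open Scope ring_scope.

(* monalg and mpoly both define this notation; it means mpoly below. *)
Notation "{ 'mpoly' T [ n ] }" := (mpoly.mpoly n T) : type_scope.

(* Free modules are the {malg A[I]} of monalg (finitely supported families     *)
(* indexed by I). This is the A-linear map sending the basis element of index  *)
(* c to e c.                                                                   *)
Definition linext (A : nzRingType) (I J : choiceType) (e : I -> {malg A[J]})
    (g : {malg A[I]}) : {malg A[J]} :=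
  \sum_(c <- monalg.msupp g) monalg.mcoeff c g *: e c.

(* ----------------------------- toric varieties ----------------------------- *)

(* A toric variety with all cones simplicial. Bases of M and N are chosen, so  *)
(* M = N = Z^tdim and the pairing is the dot product; row i of [ray] is u_i.   *)
(* A cone is given by the set of (indices of) its rays.                        *)
Record toric := Toric {
  tdim : nat;
  nray : nat;
  ray : 'M[int]_(nray, tdim);
  cones : {set {set 'I_nray}} }.

(* M -> Z^r, m |-> (<m, u_1>, ..., <m, u_r>). *)
Definition Mincl (X : toric) (m : 'rV[int]_(tdim X)) : 'rV[int]_(nray X) :=
  m *m (ray X)^T.

(* deg x^a = deg x^b in Pic X = Z^r / M. A class in Pic X is always given by a *)
(* representative in Z^r.                                                      *)
Definition same_deg (X : toric) (a b : 'rV[int]_(nray X)) : Prop :=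
  exists m : 'rV[int]_(tdim X), a - b = Mincl m.

Definition rcone (R : realType) (X : toric) (s : {set 'I_(nray X)}) :
    set 'rV[R]_(tdim X) :=
  [set w | exists t : 'I_(nray X) -> R,
    [/\ forall i, 0 <= t i, forall i, i \notin s -> t i = 0
      & w = \sum_i t i *: row i (map_mx intr (ray X))]].

Arguments rcone R {X} s.

(* [sp_proj] says that the fan is the normal fan of a lattice polytope, with   *)
(* vertex m s for each maximal cone s.                                         *)
Record smooth_projective (R : realType) (X : toric) : Prop := SmoothProjective {
  sp_face : forall s t : {set 'I_(nray X)},
    s \in cones X -> t \subset s -> t \in cones X;
  sp_ray : forall i, [set i]%SET \in cones X;
  sp_inter : forall s t, s \in cones X -> t \in cones X ->
    rcone R s `&` rcone R t = rcone R (s :&: t)%SET;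
  sp_complete : \bigcup_(s in [set s | s \in cones X]) rcone R s = setT;
  sp_smooth : forall s, s \in cones X ->
    exists (B : 'M[int]_(tdim X)) (f : 'I_(nray X) -> 'I_(tdim X)),
      [/\ B \in unitmx, {in s &, injective f}
        & forall i, i \in s -> row (f i) B = row i (ray X)];
  sp_proj : exists (a : 'rV[int]_(nray X))
                   (m : {set 'I_(nray X)} -> 'rV[int]_(tdim X)),
    forall s, s \in cones X -> #|s| = tdim X ->
    forall i, - a 0 i <= Mincl (m s) 0 i /\
              (Mincl (m s) 0 i = - a 0 i <-> i \in s) }.

Definition prod_cone (X Y : toric) (s : {set 'I_(nray X)})
    (t : {set 'I_(nray Y)}) : {set 'I_(nray X + nray Y)} :=
  ([set lshift (nray Y) i | i in s] :|: [set rshift (nray X) j | j in t])%SET.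

Definition tprod (X Y : toric) : toric :=
  Toric (block_mx (ray X) 0 0 (ray Y))
        [set prod_cone s t | s in cones X, t in cones Y]%SET.

(* -------------------- Cox ring, localization, sheaves ---------------------- *)

Notation Cox k X := {mpoly k[nray X]}.
Notation CoxFrac k X := {fraction {mpoly k[nray X]}}.

(* x^a; only used for a >= 0, where the absolute value is harmless. *)
Definition xmon (k : fieldType) (n : nat) (a : 'rV[int]_n) : {mpoly k[n]} :=
  'X_[[multinom `|a 0%R i|%N | i < n]].

Definition expo (n : nat) (m : 'X_{1..n}) : 'rV[int]_n := \row_i (m i)%:Z.

(* p \in S_d, where d is the class of a. *)
Definition in_deg (k : fieldType) (X : toric) (a : 'rV[int]_(nray X))
    (p : Cox k X) : Prop :=
  forall m, m \in msupp p -> same_deg (expo m) a.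

(* The exponent of the product of the x_i with i not in s; inverting this      *)
(* monomial gives the chart U_s.                                               *)
Definition xhat (X : toric) (s : {set 'I_(nray X)}) : 'rV[int]_(nray X) :=
  \row_i (i \notin s)%:Z.

(* The part of degree (the class of) a of the localization of S at x^(xhat s), *)
(* inside Frac S. For a = 0 this is the coordinate ring of U_s.                *)
Definition loc (k : fieldType) (X : toric) (s : {set 'I_(nray X)})
    (a : 'rV[int]_(nray X)) : set (CoxFrac k X) :=
  [set f | exists (N : nat) (p : Cox k X), in_deg (a + xhat s *+ N) p /\
    f = tofrac p / tofrac (xmon k (xhat s)) ^+ N].

(* A sheaf of O_X-modules described by its sections over the charts U_s, s in  *)
(* the fan. Each sheaf below has injective restriction maps between charts, so *)
(* [secs s] is a subset of one ambient group and restriction is inclusion.     *)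
(* [act] is only meaningful for the action of O_X(U_s) on [secs s].            *)
Record sheaf (k : fieldType) (X : toric) := Sheaf {
  amb : zmodType;
  act : CoxFrac k X -> amb -> amb;
  secs : {set 'I_(nray X)} -> set amb }.
Arguments act {k X} s f g.
Arguments secs {k X} s t.

(* The sheafification of the graded free module (+)_c S(a c): over U_s, the    *)
(* degree 0 part of its localization at x^(xhat s).                            *)
Definition tilde (k : fieldType) (X : toric) (I : choiceType)
    (a : I -> 'rV[int]_(nray X)) : sheaf k X :=
  @Sheaf k X {malg (CoxFrac k X)[I]} (fun f g => f *: g)
    (fun s => [set g | forall c, loc s (a c) (monalg.mcoeff c g)]).

(* The field homomorphism of fraction fields induced by an injective h. *)
Definition frac_map (A B : idomainType) (h : A -> B) (f : {fraction A}) :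
    {fraction B} :=
  tofrac (h (frac (repr f)).1) / tofrac (h (frac (repr f)).2).

(* x_i |-> x_i (x) 1 *)
Definition inl_poly (k : fieldType) (r r' : nat) (p : {mpoly k[r]}) :
    {mpoly k[r + r']} :=
  p \mPo [tuple 'X_(lshift r' i) | i < r].

(* Direct image along the first projection: sections over U_s x Y are the      *)
(* compatible families of sections over the U_s x U_t.                         *)
Definition push1 (k : fieldType) (X Y : toric) (F : sheaf k (tprod X Y)) :
    sheaf k X :=
  @Sheaf k X (amb F)
    (fun f => act F (frac_map (@inl_poly k (nray X) (nray Y)) f))
    (fun s => [set g | forall t, t \in cones Y -> secs F (prod_cone s t) g]).

Record sheaf_complex (k : fieldType) (X : toric) := SheafComplex {
  term : nat -> sheaf k X;
  bd : forall i, amb (term i.+1) -> amb (term i) }.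
Arguments term {k X} s i.
Arguments bd {k X} s {i} g.

(* Isomorphism of complexes of sheaves of O_X-modules. *)
Definition sheaf_complex_iso (k : fieldType) (X : toric)
    (C C' : sheaf_complex k X) : Prop :=
  exists phi : forall i, {set 'I_(nray X)} -> amb (term C i) -> amb (term C' i),
  [/\ forall i s, s \in cones X ->
        set_bij (secs (term C i) s) (secs (term C' i) s) (phi i s),
      forall i s, s \in cones X -> forall g h,
        secs (term C i) s g -> secs (term C i) s h ->
        phi i s (g + h) = phi i s g + phi i s h,
      forall i s, s \in cones X -> forall f g,
        loc s 0 f -> secs (term C i) s g ->
        phi i s (act (term C i) f g) = act (term C' i) f (phi i s g),
      forall i (s t : {set 'I_(nray X)}), s \in cones X -> t \subset s ->
        forall g,
        secs (term C i) s g -> phi i t g = phi i s g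
    & forall i s, s \in cones X -> forall g,
        secs (term C i.+1) s g -> phi i s (bd C g) = bd C' (phi i.+1 s g)].

(* ------------------------------- nef classes ------------------------------- *)

(* K is a finitely generated extension of k of transcendence degree 1. *)
Definition function_field (k K : fieldType) (iota : {rmorphism k -> K}) : Prop :=
  exists t : K,
    (forall p : {poly k}, p != 0 -> (map_poly iota p).[t] != 0) /\
    exists (m : nat) (b : 'I_m -> K), forall y : K,
      exists (q : {poly k}) (p : 'I_m -> {poly k}), q != 0 /\
        y * (map_poly iota q).[t] = \sum_j (map_poly iota (p j)).[t] * b j.

(* The normalized discrete valuations of K / k, i.e. the closed points of the  *)
(* smooth projective curve with function field K (v 0 = 0 is a convention).    *)
Record place (k K : fieldType) (iota : {rmorphism k -> K}) (v : K -> int) :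
    Prop := Place {
  place0 : v 0 = 0;
  place_cst : forall a, a != 0 -> v (iota a) = 0;
  placeM : forall x y, x != 0 -> y != 0 -> v (x * y) = v x + v y;
  placeD : forall x y, x != 0 -> y != 0 -> x + y != 0 ->
    Num.min (v x) (v y) <= v (x + y);
  place_norm : exists2 x, x != 0 & v x = 1 }.

Definition zpow (K : fieldType) (n : nat) (z : 'I_n -> K) (e : 'rV[int]_n) : K :=
  \prod_i z i ^ e 0 i.

(* The morphism to X with generic point the K-point z (in Cox coordinates)     *)
(* maps the closed point v into U_s.                                           *)
Definition lands_in (K : fieldType) (X : toric) (z : 'I_(nray X) -> K)
    (v : K -> int) (s : {set 'I_(nray X)}) : Prop :=
  [/\ s \in cones X, forall i, z i = 0 -> i \in s
    & forall m : 'rV[int]_(tdim X),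
        (forall i, i \in s -> 0 <= Mincl m 0 i) -> 0 <= v (zpow z (Mincl m))].

(* The class of a has degree >= 0 on every morphism f : Z -> X from a smooth   *)
(* projective curve Z. With K = k(Z), the morphism f amounts to a K-point of X,*)
(* i.e. to Cox coordinates z whose vanishing set is a cone. The rational       *)
(* section f^*(x^b) of f^*O(a) is nonzero, x^(c v) generates O(a) on a chart   *)
(* U_s containing f(v), and the order of the section at v is v(z^(b - c v)).   *)
(* All closed points have degree 1 since k is meant to be algebraically closed.*)
Definition nef (k : fieldType) (X : toric) (a : 'rV[int]_(nray X)) : Prop :=
  forall (K : fieldType) (iota : {rmorphism k -> K}), function_field iota ->
  forall z : 'I_(nray X) -> K, [set i | z i == 0]%SET \in cones X ->
  forall b : 'rV[int]_(nray X),
    same_deg b a -> (forall i, z i = 0 -> b 0 i = 0) ->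
  forall c : (K -> int) -> 'rV[int]_(nray X),
    (forall v, place iota v -> same_deg (c v) a /\
       exists2 s, lands_in z v s & forall i, i \in s -> c v 0 i = 0) ->
  0 <= \sum_(v \in [set v | place iota v]) v (zpow z (b - c v)).

(* ---------------------------------- cells ---------------------------------- *)

(* An open cell of C is determined by the common floor and the common ceiling  *)
(* of its points; a cell is encoded as this pair (floor, ceiling).             *)
Definition cell (r : nat) := ('rV[int]_r * 'rV[int]_r)%type.

Definition shift (r : nat) (e : 'rV[int]_r) (c : cell r) : cell r :=
  (c.1 + e, c.2 + e).

(* alpha + M (x) R *)
Definition affM (R : realType) (X : toric) (alpha : 'rV[int]_(nray X)) :
    set 'rV[R]_(nray X) :=
  [set b | exists m : 'rV[R]_(tdim X),
    b = map_mx intr alpha + m *m (map_mx intr (ray X))^T].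
Arguments affM R {X} alpha.

Section Cells.
Context (R : realType) (X : toric) (alpha : 'rV[int]_(nray X)).

Definition open_cell (c : cell (nray X)) : set 'rV[R]_(nray X) :=
  [set b | affM R alpha b /\ forall i,
    Num.floor (b 0 i) = c.1 0 i /\ Num.ceil (b 0 i) = c.2 0 i].

Definition closed_cell (c : cell (nray X)) : set 'rV[R]_(nray X) :=
  [set b | affM R alpha b /\ forall i,
    (c.1 0 i)%:~R <= b 0 i /\ b 0 i <= (c.2 0 i)%:~R].

End Cells.
Arguments open_cell R {X} alpha c.
Arguments closed_cell R {X} alpha c.

(* The affine hull of A has dimension i: A contains x0 and the affinely        *)
(* independent points x0 + row j V, and lies in x0 + (row space of V).         *)
Definition aff_dim (R : realType) (r : nat) (A : set 'rV[R]_r) (i : nat) : Prop :=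
  exists (x0 : 'rV[R]_r) (V : 'M[R]_(i, r)),
    [/\ row_free V, A x0, forall j, A (x0 + row j V)
      & forall y, A y -> (y - x0 <= V)%MS].

Section Complexes.
Context (R : realType) (X : toric).

(* A cell of dimension i of the restriction of C to alpha + M (x) R. *)
Definition cell_dim (alpha : 'rV[int]_(nray X)) (i : nat) (c : cell (nray X)) :
    Prop := aff_dim (open_cell R alpha c) i.

Definition face (alpha : 'rV[int]_(nray X)) (s t : cell (nray X)) : Prop :=
  open_cell R alpha t !=set0 /\ open_cell R alpha t `<=` closed_cell R alpha s.

(* t is a codimension 1 face of s. *)
Definition facet (alpha : 'rV[int]_(nray X)) (s t : cell (nray X)) : Prop :=
  face alpha s t /\ exists i, cell_dim alpha i.+1 s /\ cell_dim alpha i t.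

(* Incidence functions on a regular cell complex (Massey; Bruns-Herzog 6.2).   *)
(* [inc_edge] is the diamond condition for the empty face.                     *)
Record incidence (alpha : 'rV[int]_(nray X))
    (eps : cell (nray X) -> cell (nray X) -> int) : Prop := Incidence {
  inc_facet : forall s t, facet alpha s t -> eps s t = 1 \/ eps s t = -1;
  inc_out : forall s t, ~ facet alpha s t -> eps s t = 0;
  inc_edge : forall s t1 t2, cell_dim alpha 1 s -> t1 <> t2 ->
    facet alpha s t1 -> facet alpha s t2 -> eps s t1 + eps s t2 = 0;
  inc_diamond : forall s t1 t2 w, t1 <> t2 ->
    facet alpha s t1 -> facet alpha s t2 ->
    facet alpha t1 w -> facet alpha t2 w ->
    eps s t1 * eps t1 w + eps s t2 * eps t2 w = 0 }.

Definition Mpolytope (alpha : 'rV[int]_(nray X)) : set 'rV[R]_(nray X) :=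
  [set b | affM R alpha b /\ forall i, 0 <= b 0 i].

(* The cells of D. The label of such a cell c is x^(c.2). *)
Definition inD (alpha : 'rV[int]_(nray X)) (c : cell (nray X)) : Prop :=
  open_cell R alpha c !=set0 /\
  open_cell R alpha c `<=` [set b | forall i, 0 <= b 0 i].

(* D is a finite polyhedral cell complex with underlying space P, and the      *)
(* label of a face of a cell divides the label of the cell.                    *)
Record labeled_cell_complex_on (alpha : 'rV[int]_(nray X))
    (P : set 'rV[R]_(nray X)) : Prop := LabeledCellComplexOn {
  lcc_finite : finite_set (inD alpha);
  lcc_dim : forall c, inD alpha c -> exists i, cell_dim alpha i c;
  lcc_support : \bigcup_(c in inD alpha) open_cell R alpha c = P;
  lcc_disjoint : trivIset (inD alpha) (open_cell R alpha);
  lcc_face : forall c, inD alpha c ->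
    closed_cell R alpha c =
    \bigcup_(t in [set t | inD alpha t /\ face alpha c t]) open_cell R alpha t;
  lcc_inter : forall c c', inD alpha c -> inD alpha c' ->
    closed_cell R alpha c `&` closed_cell R alpha c' !=set0 ->
    exists t, [/\ inD alpha t, face alpha c t, face alpha c' t &
      closed_cell R alpha c `&` closed_cell R alpha c' = closed_cell R alpha t];
  lcc_label : forall c t, inD alpha c -> face alpha c t ->
    forall i, 0 <= t.2 0 i <= c.2 0 i }.

Definition Dcell (alpha : 'rV[int]_(nray X)) (i : nat) :=
  {c : cell (nray X) | `[< inD alpha c /\ cell_dim alpha i c >]}.

Definition trunc (k : fieldType) (alpha : 'rV[int]_(nray X)) :
    set (Cox k X) :=
  [set f | exists s : seq (Cox k X * cell (nray X)),
    (forall p, p \in s -> inD alpha p.2) /\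
    f = \sum_(p <- s) p.1 * xmon k p.2.2].

(* The restriction of C to alpha + M (x) R is the translate by alpha of the    *)
(* restriction to M (x) R; this transports incidence functions.                *)
Definition transport (alpha : 'rV[int]_(nray X))
    (eps : cell (nray X) -> cell (nray X) -> int) :
    cell (nray X) -> cell (nray X) -> int :=
  fun s t => eps (shift (- alpha) s) (shift (- alpha) t).

(* --------------------------------- F --------------------------------------- *)

Definition Fmod (k : fieldType) (alpha : 'rV[int]_(nray X)) (i : nat) :=
  {malg (Cox k X)[Dcell alpha i]}.

(* The degree of the summand of c: F_i = (+)_c S(Fdeg c). *)
Definition Fdeg (alpha : 'rV[int]_(nray X)) (i : nat) (c : Dcell alpha i) :
  'rV[int]_(nray X) := - (val c).2.

(* The graded piece of F_i in degree (the class of) b. *)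
Definition Fin_deg (k : fieldType) (alpha : 'rV[int]_(nray X)) (i : nat)
    (b : 'rV[int]_(nray X)) (g : Fmod k alpha i) : Prop :=
  forall c, in_deg (b + Fdeg c) (monalg.mcoeff c g).

(* The matrix of the differential, transferred to a ring A along h : S -> A    *)
(* (the identity, or the inclusion into Frac S).                               *)
Definition Fbd (k : fieldType) (A : nzRingType) (h : Cox k X -> A)
    (alpha : 'rV[int]_(nray X))
    (eps : cell (nray X) -> cell (nray X) -> int) (i : nat) :
    {malg A[Dcell alpha i.+1]} -> {malg A[Dcell alpha i]} :=
  linext (fun s : Dcell alpha i.+1 =>
    \sum_(t \in [set t : Dcell alpha i | facet alpha (val s) (val t)])
      monalg.mkmalgU t
        (h (xmon k ((val s).2 - (val t).2) *~ transport alpha eps (val s) (val t)))).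

Definition Fd (k : fieldType) (alpha : 'rV[int]_(nray X))
    (eps : cell (nray X) -> cell (nray X) -> int) (i : nat) :
    Fmod k alpha i.+1 -> Fmod k alpha i := @Fbd k _ id alpha eps i.

(* The sheafification of F(b). *)
Definition Ftilde (k : fieldType) (alpha : 'rV[int]_(nray X))
    (eps : cell (nray X) -> cell (nray X) -> int) (b : 'rV[int]_(nray X)) :
    sheaf_complex k X :=
  @SheafComplex k X
    (fun i => tilde k (fun c : Dcell alpha i => b + Fdeg c))
    (fun i => @Fbd k _ (@tofrac _) alpha eps i).

(* --------------------------------- G --------------------------------------- *)

Definition Mcell (j : nat) := {c : cell (nray X) | `[< cell_dim 0 j c >]}.

Definition Mequiv (j : nat) : rel (Mcell j) :=
  fun c c' => `[< exists m, val c' = shift (Mincl m) (val c) >].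

Lemma Mequiv_refl j : reflexive (@Mequiv j).
Proof.
move=> c; apply/asboolP; exists 0.
by rewrite /shift /Mincl mul0mx !addr0; case: (val c).
Qed.

Lemma Mequiv_sym j (c c' : Mcell j) : Mequiv c c' = Mequiv c' c.
Proof.
suff H (d d' : Mcell j) : Mequiv d d' -> Mequiv d' d by apply/idP/idP; apply: H.
move=> /asboolP[m e]; apply/asboolP; exists (- m).
by rewrite e /shift /Mincl /= mulNmx !addrK; case: (val d).
Qed.

Lemma Mequiv_trans j : transitive (@Mequiv j).
Proof.
move=> c2 c1 c3 /asboolP[m e] /asboolP[m' e']; apply/asboolP.
by exists (m + m'); rewrite e' e /shift /Mincl /= mulmxDl !addrA.
Qed.

Canonical Mequiv_equiv j :=
  EquivRel (@Mequiv j) (@Mequiv_refl j) (@Mequiv_sym j) (@Mequiv_trans j).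

(* The cells of dimension j of E, i.e. M-orbits of cells of M (x) R. *)
Definition Ecell (j : nat) := {eq_quot (@Mequiv j)}%qT.
HB.instance Definition _ j : EqQuotient _ (@Mequiv j) (Ecell j) :=
  EqQuotient.on (Ecell j).
HB.instance Definition _ j := Choice.on (Ecell j).

Definition Erep (j : nat) (s : Ecell j) : cell (nray X) := val (repr s).

(* The bidegree of the summand of s: for gamma in the cell (f, c) one has      *)
(* floor(- gamma) = - c and floor(gamma) = f.                                  *)
Definition Gdeg (j : nat) (s : Ecell j) : 'rV[int]_(nray (tprod X X)) :=
  row_mx (- (Erep s).2) (Erep s).1.

Definition Gbd (k : fieldType) (A : nzRingType) (h : Cox k (tprod X X) -> A)
    (eps : cell (nray X) -> cell (nray X) -> int) (j : nat) :
    {malg A[Ecell j.+1]} -> {malg A[Ecell j]} :=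
  linext (fun s : Ecell j.+1 =>
    \sum_(t \in [set t : Mcell j | facet 0 (Erep s) (val t)])
      monalg.mkmalgU (\pi_(Ecell j)%qT t)
        (h (xmon k (row_mx ((Erep s).2 - (val t).2) ((val t).1 - (Erep s).1))
            *~ eps (Erep s) (val t)))).

(* The tensor product of the sheafification of G with O(b), b a class on X x X.*)
Definition Gtilde (k : fieldType) (eps : cell (nray X) -> cell (nray X) -> int)
    (b : 'rV[int]_(nray (tprod X X))) : sheaf_complex k (tprod X X) :=
  @SheafComplex k (tprod X X)
    (fun j => tilde k (fun s : Ecell j => b + Gdeg s))
    (fun j => @Gbd k _ (@tofrac _) eps j).

(* p_* (q^* O(d) (x) G~), d the class of alpha; q^* O(d) = O(0, d). *)
Definition fourier_mukai (k : fieldType)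
    (eps : cell (nray X) -> cell (nray X) -> int) (alpha : 'rV[int]_(nray X)) :
    sheaf_complex k X :=
  let GO := Gtilde k eps (row_mx 0 alpha) in
  @SheafComplex k X (fun j => push1 (term GO j)) (fun j => @bd _ _ GO j).

End Complexes.
Arguments Mpolytope R {X} alpha.
Arguments trunc R {X} k alpha _.
Arguments labeled_cell_complex_on R {X} alpha P.

(* Main.v *)
(* In a fixed Z^r-degree b, the complex F augmented by the ideal is the augmented  *)
(* cellular chain complex of the polytope P_d cut by x <= b, subdivided by the     *)
(* integral hyperplanes, so everything rests on the acyclicity of such complexes   *)
(* for an arbitrary incidence function. By Mayer-Vietoris one cuts along the       *)
(* hyperplanes until a single closed cell s is left. Homogenize s to a cone and,   *)
(* for a direction p in its span, keep the faces of s from which p points into     *)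
(* the interior: for p interior these are all the faces, and while p moves         *)
(* generically away from s they change, each time p crosses the hyperplane of a    *)
(* facet f, by the faces of f from which p points into f. By induction on the      *)
(* dimension these subquotients of the complex are exact, as long as p does not    *)
(* lie in -s; the last one before that has only the two cells s and f.             *)
(*                                                                                 *)
(* For the comparison with the Fourier-Mukai transform, a section over U_s x X of  *)
(* the summand of a cell e of E is a finite sum of f_b(x) y^b with b >= 0 in the   *)
(* class d + floor(e). Such an exponent b is the same as a translate of e lying in *)
(* D, namely the one with floor b, and f_b is a section over U_s of its summand in *)
(* F(d).                                                                           *)

Require Import Defs.
From HB Require Import structures.
From mathcomp Require Import all_boot all_order all_algebra.
From mathcomp Require Import finmap.
From mathcomp Require Import boolp classical_sets functions cardinality fsbigop.
From mathcomp Require Import reals.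
From mathcomp Require Import monalg mpoly.
From mathcomp Require Import ring lra zify.
Set Implicit Arguments.
Unset Strict Implicit.
Unset Printing Implicit Defensive.
Import Order.TTheory GRing.Theory Num.Theory.
Local Open Scope classical_set_scope.
Local Open Scope ring_scope.

(** * Ungraded chain complexes on a finite list of cells *)

(** Resolution. In a fixed exponent m, [chain_Fd] and [mcoeff_augmentation] identify F and its
    augmentation with the augmented chain complex over k of the cells whose label divides x^m, which
    are the cells of the box from 0 to m. Such a complex is exact as soon as the box has a cell
    ([exact_box]), and [lift_cycle] assembles the finitely many degreewise fillings into one element
    of the free module. The image of the augmentation is the whole truncation because every cell has
    a vertex ([vertex_below]), whose label divides that of the cell. An incidence function is only
    known through its sign relations, so [exact_box] is proved combinatorially. The cone over a
    closed cell has the empty face as its apex, which makes the augmentation one more boundary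
    coefficient. [diamond] gives that the boundary squares to zero, [exact_pointing] that a closed
    cell is exact, and [mayer_vietoris] glues closed cells along hyperplanes. Comparison. The cells
    of D lying over one cell of E are distinguished by their floors, and these floors are exactly
    the exponents of the monomials spanning the global sections of the second factor ([cls_inj],
    [cls_exists]). Hence [phi], which records the floor as a power of y, is bijective on sections
    ([phi_eq0], [phi_surj]); it commutes with the differentials because a translation changes no
    difference of floors or of ceilings ([phi_coeff]). *)

Lemma sum_pair (A : nmodType) (T : eqType) (E : seq T) (F : T -> A) s f :
  uniq E -> s \in E -> f \in E -> s != f ->
  {in E, forall t, t != s -> t != f -> F t = 0} -> \sum_(t <- E) F t = F s + F f.
Proof.
move=> uE sE fE nsf F0; have one v : v \in E -> \sum_(u <- E | u == v) F u = F v.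
  by move=> vE; rewrite -big_filter filter_pred1_uniq // big_seq1.
rewrite (bigID (pred1 s)) /= one // (bigID (pred1 f)) /=; congr (_ + _).
rewrite [X in _ + X]big_seq_cond [X in _ + X]big1 ?addr0; last first.
  by move=> t /andP[tE /andP[ts tf]]; exact: F0.
rewrite -[RHS]one //; apply: eq_bigl => u.
by case: (eqVneq u f) => [->|]; [rewrite eq_sym nsf|rewrite andbF].
Qed.

Section Exactness.
Variables (A : fieldType) (T : eqType) (E : seq T) (e : T -> T -> A).
Implicit Types (U P Q : pred T).

(* A chain is a function on cells and [e s t] is the coefficient of t in the   *)
(* boundary of s. Dimensions play no role, so no grading is recorded; the      *)
(* complex of U is the subquotient spanned by the cells of U.                  *)
Definition exact U := forall c : T -> A,
  (forall t, t \in E -> U t -> \sum_(s <- E | U s) c s * e s t = 0) ->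
  exists b : T -> A, forall t, t \in E -> U t ->
    \sum_(s <- E | U s) b s * e s t = c t.

Definition sq0 U := forall s w, s \in E -> w \in E -> U s -> U w ->
  \sum_(t <- E | U t) e s t * e t w = 0.

Lemma eq_exact U P : {in E, U =1 P} -> exact U -> exact P.
Proof.
move=> eqUP exU c hc.
have eqs (f : T -> A) : \sum_(s <- E | U s) f s = \sum_(s <- E | P s) f s.
  by rewrite big_seq_cond [RHS]big_seq_cond; apply: eq_bigl => s;
     case: (boolP (s \in E)) => //= /eqUP.
have [|b hb] := exU c.
  by move=> t tE Ut; rewrite eqs hc // -eqUP.
by exists b => t tE Pt; rewrite -eqs hb // eqUP.
Qed.

(** [exact] is tied to the list [E] of the section, so exactness over a second list enumerating the
    same selected cells appears unfolded. *)
Lemma exact_change (E' : seq T) U P : uniq E -> uniq E' ->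
  (forall t, (t \in E) && U t = (t \in E') && P t) -> exact U ->
  forall c : T -> A,
  (forall t, t \in E' -> P t -> \sum_(s <- E' | P s) c s * e s t = 0) ->
  exists b : T -> A, forall t, t \in E' -> P t ->
    \sum_(s <- E' | P s) b s * e s t = c t.
Proof.
move=> uE uE' EE' exU c hc.
have eqs (f : T -> A) : \sum_(s <- E' | P s) f s = \sum_(s <- E | U s) f s.
  rewrite -big_filter -[RHS]big_filter; apply: perm_big.
  by apply: uniq_perm; rewrite ?filter_uniq // => t; rewrite !mem_filter andbC -EE' andbC.
have [|b hb] := exU c.
  move=> t tE Ut; rewrite -eqs.
  by have := EE' t; rewrite tE Ut => /esym /andP[? ?]; apply: hc.
exists b => t tE' Pt; rewrite eqs.
by have := EE' t; rewrite tE' Pt => /andP[? ?]; apply: hb.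
Qed.

Lemma sq0_bd U (c : T -> A) w : sq0 U -> w \in E -> U w ->
  \sum_(t <- E | U t) (\sum_(s <- E | U s) c s * e s t) * e t w = 0.
Proof.
move=> s0 wE Uw; under eq_bigr do rewrite mulr_suml.
rewrite exchange_big /= big_seq_cond big1 // => s /andP[sE Us].
under eq_bigr do rewrite -mulrA.
by rewrite -mulr_sumr s0 // mulr0.
Qed.

Lemma sum_partition U P Q : {in E, forall t, U t = P t || Q t} ->
  {in E, forall t, ~~ (P t && Q t)} -> forall f : T -> A,
  \sum_(s <- E | U s) f s = \sum_(s <- E | P s) f s + \sum_(s <- E | Q s) f s.
Proof.
move=> UPQ dPQ f.
rewrite big_seq_cond (bigID P) /=; congr (_ + _); rewrite [RHS]big_seq_cond.
  apply: eq_bigl => s; case: (boolP (s \in E)) => //= /UPQ ->.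
  by case: (P s); case: (Q s).
apply: eq_bigl => s; case: (boolP (s \in E)) => //= sE; rewrite (UPQ _ sE).
by have := dPQ _ sE; case: (P s); case: (Q s).
Qed.

(** [P] is a subcomplex with quotient [Q]. A cycle is filled in the quotient first, by [b];
    subtracting the boundary of [b] extended by zero leaves a cycle of [P]. *)
Lemma exact_extension U P Q : sq0 U ->
  {in E, forall t, U t = P t || Q t} -> {in E, forall t, ~~ (P t && Q t)} ->
  {in E &, forall s t, P s -> Q t -> e s t = 0} ->
  exact P -> exact Q -> exact U.
Proof.
move=> s0 UPQ dPQ ePQ exP exQ c hc.
have split := sum_partition UPQ dPQ.
have UP t : t \in E -> P t -> U t by move=> tE Pt; rewrite UPQ // Pt.
have UQ t : t \in E -> Q t -> U t by move=> tE Qt; rewrite UPQ // Qt orbT.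
have P0 (f : T -> A) t : t \in E -> Q t -> \sum_(s <- E | P s) f s * e s t = 0.
  move=> tE Qt; rewrite big_seq_cond big1 // => s /andP[sE Ps].
  by rewrite ePQ // mulr0.
have [b hb] : exists b : T -> A, forall t, t \in E -> Q t ->
    \sum_(s <- E | Q s) b s * e s t = c t.
  by apply: exQ => t tE Qt; have := hc _ tE (UQ _ tE Qt); rewrite split P0 // add0r.
pose b0 s := if Q s then b s else 0.
pose d t := \sum_(s <- E | U s) b0 s * e s t.
have b0E t : \sum_(s <- E | U s) b0 s * e s t = \sum_(s <- E | Q s) b s * e s t.
  rewrite split big_seq_cond big1 ?add0r; last first.
    move=> s /andP[sE Ps]; rewrite /b0; have := dPQ _ sE.
    by rewrite Ps /= => /negbTE ->; rewrite mul0r.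
  by apply: eq_bigr => s Qs; rewrite /b0 Qs.
have [a ha] : exists a : T -> A, forall t, t \in E -> P t ->
    \sum_(s <- E | P s) a s * e s t = c t - d t.
  apply: exP => t tE Pt.
  have := hc _ tE (UP _ tE Pt); have := sq0_bd b0 s0 tE (UP _ tE Pt).
  rewrite !split => h1 h2; under eq_bigr do rewrite mulrBl.
  rewrite sumrB; apply/eqP; rewrite subr_eq0; apply/eqP.
  have h3 : \sum_(s <- E | Q s) (\sum_(s0 <- E | U s0) b0 s0 * e s0 s) * e s t
     = \sum_(s <- E | Q s) c s * e s t.
    rewrite big_seq_cond [RHS]big_seq_cond; apply: eq_bigr => s /andP[sE Qs].
    by rewrite b0E hb.
  rewrite h3 in h1; apply: (addIr (\sum_(s <- E | Q s) c s * e s t)).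
  by rewrite h1 h2.
exists (fun s => if P s then a s else b s) => t tE Ut.
rewrite split.
have -> : \sum_(s <- E | Q s) (if P s then a s else b s) * e s t = d t.
  rewrite /d b0E big_seq_cond [RHS]big_seq_cond; apply: eq_bigr => s /andP[sE Qs].
  by have := dPQ _ sE; rewrite Qs andbT => /negbTE ->.
under eq_bigr => s Ps do rewrite Ps.
move: Ut; rewrite UPQ // => /orP[Pt|Qt]; first by rewrite ha // subrK.
by rewrite P0 // add0r /d b0E hb.
Qed.

(** A cycle of the quotient, extended by zero, has its boundary in [P]. Filling that boundary there
    by [a] and subtracting [a] gives a cycle of [U]. *)
Lemma exact_quotient U P Q : sq0 U ->
  {in E, forall t, U t = P t || Q t} -> {in E, forall t, ~~ (P t && Q t)} ->
  {in E &, forall s t, P s -> Q t -> e s t = 0} ->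
  exact P -> exact U -> exact Q.
Proof.
move=> s0 UPQ dPQ ePQ exP exU c hc.
have split := sum_partition UPQ dPQ.
have UP t : t \in E -> P t -> U t by move=> tE Pt; rewrite UPQ // Pt.
have UQ t : t \in E -> Q t -> U t by move=> tE Qt; rewrite UPQ // Qt orbT.
have P0 (f : T -> A) t : t \in E -> Q t -> \sum_(s <- E | P s) f s * e s t = 0.
  move=> tE Qt; rewrite big_seq_cond big1 // => s /andP[sE Ps].
  by rewrite ePQ // mulr0.
pose c0 s := if Q s then c s else 0.
pose d t := \sum_(s <- E | U s) c0 s * e s t.
have c0E t : \sum_(s <- E | U s) c0 s * e s t = \sum_(s <- E | Q s) c s * e s t.
  rewrite split big_seq_cond big1 ?add0r; last first.
    move=> s /andP[sE Ps]; rewrite /c0; have := dPQ _ sE.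
    by rewrite Ps /= => /negbTE ->; rewrite mul0r.
  by apply: eq_bigr => s Qs; rewrite /c0 Qs.
have [a ha] : exists a : T -> A, forall t, t \in E -> P t ->
    \sum_(s <- E | P s) a s * e s t = d t.
  apply: exP => t tE Pt.
  have := sq0_bd c0 s0 tE (UP _ tE Pt); rewrite split.
  rewrite [X in _ + X]big_seq_cond [X in _ + X]big1 ?addr0 // => s /andP[sE Qs].
  by rewrite c0E hc // mul0r.
have [b hb] : exists b : T -> A, forall t, t \in E -> U t ->
    \sum_(s <- E | U s) b s * e s t = if Q t then c t else - a t.
  apply: exU => t tE Ut; rewrite split.
  have -> : \sum_(s <- E | Q s) (if Q s then c s else - a s) * e s t = d t.
    by rewrite /d c0E; apply: eq_bigr => s ->.
  have -> : \sum_(s <- E | P s) (if Q s then c s else - a s) * e s t =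
     - \sum_(s <- E | P s) a s * e s t.
    rewrite -sumrN big_seq_cond [RHS]big_seq_cond.
    apply: eq_bigr => s /andP[sE Ps].
    by have := dPQ _ sE; rewrite Ps /= => /negbTE ->; rewrite mulNr.
  move: Ut; rewrite UPQ // => /orP[Pt|Qt]; first by rewrite ha // addNr.
  by rewrite P0 // oppr0 add0r /d c0E hc.
exists b => t tE Qt; have := hb _ tE (UQ _ tE Qt).
by rewrite Qt split P0 // add0r.
Qed.

(** If no two-step path with nonzero coefficients leaves [P] and comes back, the sum over [U] only
    sees terms of [P]. This covers subquotients as well as subcomplexes. *)
Lemma sq0_sub U P : sq0 U -> {in E, forall t, P t -> U t} ->
  {in E & &, forall s t w, P s -> P w -> U t -> ~~ P t -> e s t * e t w = 0} ->
  sq0 P.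
Proof.
move=> s0 PU cP s w sE wE Ps Pw; rewrite -[RHS](s0 s w) ?PU //.
rewrite [RHS](bigID P) /= [X in _ = _ + X]big_seq_cond [X in _ = _ + X]big1 ?addr0.
  by rewrite big_seq_cond [RHS]big_seq_cond; apply: eq_bigl => t;
     case: (boolP (t \in E)) => //= tE; case: (boolP (P t)) => [/PU -> //|]; rewrite ?andbF.
by move=> t /andP[tE /andP[Ut nPt]]; apply: cP.
Qed.

Definition closed_in P := {in E &, forall s t, P s -> ~~ P t -> e s t = 0}.

Lemma sq0_closed P : sq0 xpredT -> closed_in P -> sq0 P.
Proof.
move=> s0 cP; apply: (sq0_sub s0) => // s t w sE tE wE Ps Pw _ nPt.
by rewrite cP // mul0r.
Qed.

(** The cells of [Q] outside [P] carry both the quotient of the union by [P] and the quotient of [Q]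
    by the intersection. *)
Lemma mayer_vietoris P Q : sq0 xpredT -> closed_in P -> closed_in Q ->
  exact P -> exact Q -> exact (predI P Q) -> exact (predU P Q).
Proof.
move=> s0 cP cQ exP exQ exI.
have cU : closed_in (predU P Q).
  move=> s t sE tE /= /orP[Ps|Qs]; rewrite negb_or => /andP[nP nQ].
    exact: cP.
  exact: cQ.
apply: (@exact_extension _ P (fun t => Q t && ~~ P t)) => //.
- exact: sq0_closed.
- by move=> t _ /=; case: (P t); case: (Q t).
- by move=> t _; case: (P t); case: (Q t).
- by move=> s t sE tE Ps /andP[_ nP]; exact: cP.
apply: (@exact_quotient Q (predI P Q)) => //.
- exact: sq0_closed.
- by move=> t _ /=; case: (P t); case: (Q t).
- by move=> t _ /=; case: (P t); case: (Q t).
- by move=> s t sE tE /= /andP[Ps _] /andP[_ nP]; exact: cP.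
Qed.

End Exactness.

(** * Faces of a polyhedral cone *)

Section Cone.
Variables (R : realFieldType) (V : lmodType R) (J : finType).
Variable h : J -> {scalar V}.
Implicit Types (Z : {set J}) (x y p : V).

(* The faces of the cone {x | h j x >= 0 for all j} are encoded by the sets Z  *)
(* of forms vanishing on their relative interiors.                             *)
Definition realizes x Z := forall j, if j \in Z then h j x = 0 else 0 < h j x.

Definition realizable Z := exists x, realizes x Z.

Definition inspan Z x := forall j, j \in Z -> h j x = 0.

(* Z' is the zero set of a facet of the face with zero set Z. *)
Definition covers Z Z' := Z \subset Z' /\
  exists2 j, (j \in Z') && (j \notin Z) &
    forall x, inspan Z x -> h j x = 0 -> inspan Z' x.

Lemma realizes_inspan x Z : realizes x Z -> inspan Z x.
Proof. by move=> xZ j jZ; have := xZ j; rewrite jZ. Qed.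

Lemma realizes_gt0 x Z j : realizes x Z -> j \notin Z -> 0 < h j x.
Proof. by move=> xZ /negbTE jZ; have := xZ j; rewrite jZ. Qed.

Lemma realizes_eq0 x Z j : realizes x Z -> h j x = 0 -> j \in Z.
Proof. by move=> /(_ j); case: (j \in Z) => // h1 h0; rewrite h0 ltxx in h1. Qed.

Lemma realizes_inj x Z Z' : realizes x Z -> realizes x Z' -> Z = Z'.
Proof.
move=> xZ xZ'; apply/setP => j; apply/idP/idP => jZ.
  exact: (realizes_eq0 xZ') (realizes_inspan xZ jZ).
exact: (realizes_eq0 xZ) (realizes_inspan xZ' jZ).
Qed.

Lemma inspanS Z Z' x : Z \subset Z' -> inspan Z' x -> inspan Z x.
Proof. by move=> /fintype.subsetP sZ xZ j /sZ /xZ. Qed.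

Lemma inspan_comb Z x y a : inspan Z x -> inspan Z y -> inspan Z (x + a *: y).
Proof. by move=> xZ yZ j jZ; rewrite linearD linearZ /= xZ // yZ // mulr0 addr0. Qed.

Lemma small_scalar (I : eqType) (r : seq I) (u v : I -> R) :
  exists2 d : R, 0 < d & {in r, forall i, u i != 0 -> d * `|v i| < `|u i|}.
Proof.
elim: r => [|i r [d d0 hd]]; first by exists 1.
have [ui0|ui0] := eqVneq (u i) 0.
  by exists d => // j; rewrite inE => /orP[/eqP ->|/hd //]; rewrite ui0 eqxx.
exists (Num.min d (`|u i| / (1 + `|v i|))).
  by rewrite lt_min d0 divr_gt0 ?normr_gt0 // ltr_pwDl.
move=> j; rewrite inE => /orP[/eqP ->|jr uj0].
  move=> _; have [v0|v0] := eqVneq (v i) 0.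
    by rewrite v0 normr0 mulr0 normr_gt0.
  have vp : 0 < 1 + `|v i| by rewrite ltr_pwDl.
  apply: (@le_lt_trans _ _ (`|u i| / (1 + `|v i|) * `|v i|)).
    by apply: ler_wpM2r => //; rewrite ge_min lexx orbT.
  rewrite mulrAC ltr_pdivrMr // ltr_pM2l ?normr_gt0 //.
  by rewrite ltrDr.
apply: le_lt_trans (hd _ jr uj0).
by apply: ler_wpM2r => //; rewrite ge_min lexx.
Qed.

Lemma realizes_push x Z y : realizes x Z ->
  exists2 d : R, 0 < d & forall j, j \notin Z -> 0 < h j (x + d *: y).
Proof.
move=> xZ; have [d d0 hd] := small_scalar (enum J) (h^~ x) (h^~ y).
exists d => // j jZ; have hx := realizes_gt0 xZ jZ; rewrite linearD linearZ /=.
have := hd j; rewrite mem_enum => /(_ isT); rewrite gt_eqF // => /(_ isT).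
rewrite -{1}(gtr0_norm d0) -normrM (gtr0_norm hx) ltr_norml => /andP[h1 _].
lra.
Qed.

Lemma realizes_perturb x Z y : realizes x Z -> inspan Z y ->
  exists2 d : R, 0 < d & realizes (x + d *: y) Z.
Proof.
move=> xZ yZ; have [d d0 hd] := realizes_push y xZ.
exists d => // j; case: ifPn => jZ; last exact: hd.
by rewrite linearD linearZ /= yZ // (realizes_inspan xZ) // mulr0 addr0.
Qed.

(** A relative interior point avoids each hyperplane that does not contain the whole span. The forms
    are treated one at a time, each move being too small to spoil the earlier ones. *)
Lemma generic_realizer x Z (I : eqType) (r : seq I) (g : I -> V -> R) :
  (forall i y a w, g i (y + a *: w) = g i y + a * g i w) -> realizes x Z ->
  exists2 a, realizes a Z &
    {in r, forall i, g i a = 0 -> forall y, inspan Z y -> g i y = 0}.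
Proof.
move=> glin xZ; elim: r => [|i r [a aZ ha]]; first by exists x.
case: (pselect (forall y, inspan Z y -> g i y = 0)) => [gZ|].
  by exists a => // l; rewrite inE => /orP[/eqP -> _|]; [exact: gZ|exact: ha].
move=> /existsNP[y /not_implyP[yZ gy]].
have [ga|ga] := eqVneq (g i a) 0; last first.
  exists a => // l; rewrite inE => /orP[/eqP -> /eqP|]; last exact: ha.
  by rewrite (negbTE ga).
have [d1 d10 hd1] := realizes_perturb aZ yZ.
have [d2 d20 hd2] := small_scalar r (fun l => g l a) (fun l => d1 * g l y).
(* The bound 1 keeps the new point on the segment from [a] to [a + d1 *: y], inside the relative
   interior; the bound [d2] keeps the nonzero values of the earlier forms nonzero. *)
have [d30 d31 d32] : [/\ 0 < Num.min d2 1, Num.min d2 1 <= 1 & Num.min d2 1 <= d2].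
  by rewrite lt_min d20 ltr01 !ge_min !lexx orbT.
set d := Num.min d2 1 in d30 d31 d32.
exists (a + (d * d1) *: y) => [j|l].
  have := hd1 j; have := aZ j; rewrite !linearD !linearZ /=.
  case: ifP => jZ; first by rewrite yZ // !mulr0 !addr0.
  move=> h1 h2; have [hy|hy] := leP 0 (h j y).
    by rewrite ltr_wpDr // mulr_ge0 // mulr_ge0 // ltW.
  apply: lt_le_trans h2 _; rewrite lerD2l -mulrA ler_niMl //.
  by rewrite pmulr_rle0 // ltW.
rewrite inE => /orP[/eqP -> |lr].
  rewrite glin ga add0r => /eqP.
  by rewrite !mulf_eq0 (gt_eqF d30) (gt_eqF d10) /= => /eqP.
move=> gi0; apply: ha => //; apply/eqP/contraT => gia.
have hlt := hd2 l lr gia.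
move: gi0; rewrite glin => /eqP.
rewrite addr_eq0 => /eqP E; move: hlt; rewrite E normrN -mulrA (normrM d) (gtr0_norm d30).
by rewrite ltNge ler_wpM2r.
Qed.

(* The interval between two faces whose dimensions differ by 2 has exactly two *)
(* elements: modulo the span of the smaller face the larger one is a plane     *)
(* sector, with Z1 as one of its two sides.                                    *)
Lemma diamond Z0 Z1 Z2 : realizable Z0 -> realizable Z1 -> realizable Z2 ->
  covers Z0 Z1 -> covers Z1 Z2 ->
  exists Z1', [/\ realizable Z1', Z1' != Z1, covers Z0 Z1', covers Z1' Z2 &
    forall Z, realizable Z -> Z0 \proper Z -> Z \proper Z2 -> Z = Z1 \/ Z = Z1'].
Proof.
move=> [x0 r0] [x1 r1] [x2 r2] [s01 [j /andP[j1 j0] hj]] [s12 [k /andP[k2 k1] hk]].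
have k0 : k \notin Z0 by apply: contra k1; apply: (fintype.subsetP s01).
have j2 : j \in Z2 := fintype.subsetP s12 _ j1.
have hj0 := realizes_gt0 r0 j0; have hk1 := realizes_gt0 r1 k1.
have hj1 := realizes_inspan r1 j1.
have sp0 := realizes_inspan r0; have sp1 := realizes_inspan r1.
have sp10 := inspanS s01 sp1.
(* x1 has coordinates (0, hk1) and e1 has coordinates (hj0, 0) *)
pose e1 := x0 - (h k x0 / h k x1) *: x1.
have e1sp : inspan Z0 e1 by rewrite /e1 -scaleNr; apply: inspan_comb.
have e1j : h j e1 = h j x0 by rewrite /e1 linearB linearZ /= hj1 mulr0 subr0.
have e1k : h k e1 = 0.
  rewrite /e1 linearB linearZ /= divfK ?subrr //; exact: lt0r_neq0.
clearbody e1.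
(* The span of [Z0] modulo that of [Z2] is a plane: by the two coverings, a vector killed by [h j]
   and [h k] is killed by all of [Z2]. *)
have coord g y : g \in Z2 -> inspan Z0 y ->
    h g y = h g e1 * (h j y / h j x0) + h g x1 * (h k y / h k x1).
  move=> g2 y0.
  pose y' := y + (- (h j y / h j x0)) *: e1 + (- (h k y / h k x1)) *: x1.
  have y'0 : inspan Z0 y' by do 2! apply: inspan_comb => //.
  have y'j : h j y' = 0.
    rewrite /y' !linearD !linearZ /= hj1 e1j mulr0 addr0 mulNr divfK ?subrr //.
    exact: lt0r_neq0.
  have y'k : h k y' = 0.
    rewrite /y' !linearD !linearZ /= e1k mulr0 addr0 mulNr divfK ?subrr //.
    exact: lt0r_neq0.
  have := hk _ (hj _ y'0 y'j) y'k _ g2.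
  rewrite /y' !linearD !linearZ /= => /eqP; rewrite -addrA addr_eq0 => /eqP ->.
  by rewrite opprD !mulNr !opprK ![_ / _ * _]mulrC.
have g1ge g : 0 <= h g x1.
  by have := r1 g; case: ifP => _; [move=> ->|exact: ltW].
pose slopes g := (g \in Z2) && (0 < h g x1).
have k20 : slopes k by rewrite /slopes k2.
(* [v] is the least scalar for which all forms of [Z2] are nonnegative on [e1 + v *: x1]. This
   vector spans the second side of the sector, and [g0] vanishes on it. *)
case: (arg_maxP (fun g => - h g e1 / h g x1) k20) => g0 /andP[g02 g01] g0max.
set v := - h g0 e1 / h g0 x1.
pose y' := e1 + v *: x1.
have y'0 : inspan Z0 y' by apply: inspan_comb.
have e1E g : g \in Z2 -> h g x1 = 0 -> h g e1 = h g x0.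
  move=> g2 g1; rewrite (coord g x0 g2 sp0) g1 mul0r addr0 divff ?mulr1 //.
  exact: lt0r_neq0.
have y'E g : h g y' = h g e1 + v * h g x1 by rewrite /y' linearD linearZ.
clearbody y'.
have y'ge g : g \in Z2 -> 0 <= h g y'.
  move=> g2; have := g1ge g; rewrite le_eqVlt y'E => /orP[/eqP g1|g1].
    rewrite -g1 mulr0 addr0 e1E //.
    by have := r0 g; case: ifP => _ => [->|/ltW].
  have := g0max g; rewrite /slopes g2 g1 => /(_ isT) /=; rewrite -/v ler_pdivrMr // => hm.
  by rewrite addrC -lerBlDr sub0r.
pose Z1' := [set g in Z2 | h g y' == 0]%SET.
have g0Z : g0 \in Z1'.
  rewrite inE g02 y'E /v divfK ?addrN ?eqxx //; exact: lt0r_neq0.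
have g01' : g0 \notin Z1 by apply/negP => /sp1 E; rewrite E ltxx in g01.
exists Z1'; split.
- have [d d0 hd] := realizes_push y' r2.
  exists (x2 + d *: y') => g; rewrite inE.
  case: (boolP (g \in Z2)) => g2 /=; last exact: hd.
  rewrite linearD linearZ /= (realizes_inspan r2) // add0r.
  case: eqP => [->|/eqP h0]; first by rewrite mulr0.
  by rewrite mulr_gt0 // lt_neqAle eq_sym h0 y'ge.
- by apply/eqP => E; rewrite -E g0Z in g01'.
- split.
    apply/fintype.subsetP => g gZ; rewrite inE (fintype.subsetP s12) ?(fintype.subsetP s01) //=.
    by rewrite y'0.
  exists g0; first by rewrite g0Z; apply: contra g01'; exact: (fintype.subsetP s01).
  move=> x x0sp; rewrite coord // => hx g; rewrite inE y'E => /andP[g2 /eqP gy].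
  have hv : h k x / h k x1 = v * (h j x / h j x0).
    apply: (mulfI (lt0r_neq0 g01)); move/eqP: hx; rewrite addrC addr_eq0 => /eqP ->.
    by rewrite [RHS]mulrA [h g0 x1 * v]mulrC /v divfK ?mulNr // lt0r_neq0.
  by rewrite coord // hv [h g x1 * _]mulrA [h g x1 * v]mulrC -mulrDl gy mul0r.
- split; first by apply/fintype.subsetP => g; rewrite inE => /andP[].
  exists j; first by rewrite inE j2 /= y'E e1j sp1 // mulr0 addr0 gt_eqF.
  move=> x xsp hx g g2.
  have x0sp : inspan Z0 x.
    apply: inspanS xsp; apply/fintype.subsetP => i i0; rewrite inE y'0 // eqxx andbT.
    exact: (fintype.subsetP s12) (fintype.subsetP s01 _ i0).
  have := xsp _ g0Z; rewrite coord // hx mul0r mulr0 add0r => /eqP.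
  rewrite mulf_eq0 gt_eqF //= => /eqP hk0.
  by rewrite coord // hx hk0 mul0r !mulr0 addr0.
(* In the basis [y'], [x1] a point inside [Z] has nonnegative coordinates [u] and [w - u * v]. If
   one vanishes, [Z] is one of the two sides; if both are positive, [Z] would be [Z0]. *)
move=> Z [y ry] /fintype.properP[s0Z [g gZ g0']] /fintype.properP[sZ2 [g' g'2 g'Z]].
have yge i : 0 <= h i y by have := ry i; case: ifP => _ => [->|/ltW].
have ysp := inspanS s0Z (realizes_inspan ry).
set u := h j y / h j x0; set w := h k y / h k x1.
have u0 : 0 <= u by rewrite divr_ge0 // ltW.
have w0 : 0 <= w by rewrite divr_ge0 // ltW.
have yE i : i \in Z2 -> h i y = h i e1 * u + h i x1 * w by move=> i2; exact: coord.
clearbody u w.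
have memZ i : (i \in Z) = (i \in Z2) && (h i y == 0).
  apply/idP/andP => [iZ|[_ /eqP]]; last exact: (realizes_eq0 ry).
  by rewrite (realizes_inspan ry) // (fintype.subsetP sZ2).
have [uz|uz] := eqVneq u 0.
  have wz : w != 0.
    by apply: contra g'Z => /eqP wz; rewrite memZ g'2 yE // uz wz !mulr0 addr0 eqxx.
  left; apply/setP => i; rewrite memZ.
  case: (boolP (i \in Z2)) => i2 /=; last first.
    by symmetry; apply/negbTE; apply: contra i2; apply: (fintype.subsetP s12).
  rewrite yE // uz mulr0 add0r mulf_eq0 (negbTE wz) orbF.
  by apply/eqP/idP => [/(realizes_eq0 r1)|/sp1].
have up : 0 < u by rewrite lt_neqAle eq_sym uz.
have yE' i : i \in Z2 -> h i y = u * h i y' + (w - u * v) * h i x1.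
  by move=> i2; rewrite yE // y'E; ring.
have hw : 0 <= w - u * v.
  have := yge g0; rewrite yE' //; move: g0Z; rewrite inE g02 /= => /eqP ->.
  by rewrite mulr0 add0r pmulr_lge0.
have [wE|wE] := eqVneq (w - u * v) 0.
  right; apply/setP => i; rewrite memZ inE; case: (boolP (i \in Z2)) => i2 //=.
  by rewrite yE' // wE mul0r addr0 mulf_eq0 (negbTE uz).
have g2 := fintype.subsetP sZ2 _ gZ.
have := realizes_inspan ry gZ; rewrite yE' // => /eqP.
rewrite (paddr_eq0 (mulr_ge0 u0 (y'ge _ g2)) (mulr_ge0 hw (g1ge _))).
rewrite !mulf_eq0 (negbTE uz) (negbTE wE) /=.
move=> /andP[/eqP h1 /eqP h2]; move: h1; rewrite y'E h2 mulr0 addr0 e1E // => h1.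
by rewrite (realizes_eq0 r0 h1) in g0'.
Qed.

(** * Sweeping a direction away from a face *)

Section Sweep.
Variables (A : fieldType) (T : eqType) (E : seq T) (z : T -> {set J}).
Variable e : T -> T -> A.
Hypothesis E_uniq : uniq E.
Hypothesis z_inj : {in E &, injective z}.
Hypothesis z_real : {in E, forall t, realizable (z t)}.
Hypothesis z_surj : forall Z, realizable Z -> exists2 t, t \in E & z t = Z.
Hypothesis e_sub : {in E &, forall s t, e s t != 0 -> z s \proper z t}.
Hypothesis e_cov : {in E &, forall s t, covers (z s) (z t) -> e s t != 0}.
Hypothesis e_sq0 : sq0 E e xpredT.

(* Those faces of s from which the direction p points into the interior of s.  *)
Definition pointing s p : pred T := fun t =>
  (z s \subset z t) && [forall (j | j \in z t :\: z s), 0 < h j p].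

(** By [e_sub] the only nonzero coefficient is [e s f], so the complex is an isomorphism between two
    lines. *)
Lemma exact_pair s f : s \in E -> f \in E -> e s f != 0 ->
  exact E e (pred2 s f).
Proof.
move=> sE fE sf c hc.
have nsf : s != f.
  by apply: contra_neq sf => <-; apply/eqP/contraT => /(e_sub sE sE); rewrite fintype.properxx.
have fs : e f s = 0.
  apply/eqP/contraT => /(e_sub fE sE); rewrite fintype.properE => /andP[fs /negP[]].
  by have := e_sub sE fE sf; rewrite fintype.properE => /andP[].
have ss : e s s = 0 by apply/eqP/contraT => /(e_sub sE sE); rewrite fintype.properxx.
have ff : e f f = 0 by apply/eqP/contraT => /(e_sub fE fE); rewrite fintype.properxx.
have sumE (b : T -> A) t : \sum_(u <- E | pred2 s f u) b u * e u t =
    b s * e s t + b f * e f t.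
  rewrite big_mkcond (@sum_pair _ _ _ _ s f) //= ?eqxx ?orbT //.
  by move=> u _ /negbTE us /negbTE uf; rewrite us uf.
exists (fun u => if u == s then c f / e s f else 0) => t tE.
rewrite sumE eqxx eq_sym (negbTE nsf) mul0r addr0 => /orP[]/eqP ->.
  rewrite ss mulr0; have := hc f fE; rewrite sumE /= eqxx orbT ff mulr0 addr0.
  by move=> /(_ isT) /eqP; rewrite mulf_eq0 (negbTE sf) orbF => /eqP.
by rewrite divfK.
Qed.

(* Move p away from s until the first facet f of s comes to contain the        *)
(* direction, say at p0; then pointing s p is the disjoint union of            *)
(* pointing s p0 and of the subcomplex pointing f p0.                          *)
Lemma exact_pointing s p : s \in E -> inspan (z s) p -> (exists j, 0 < h j p) ->
  exact E e (pointing s p).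
Proof.
(* The outer induction, on the number of forms not vanishing on [s], serves to pass to the facet
   [f]; the inner one, on the number of forms positive at [p], serves to move [p]. *)
have [n] := ubnP #|~: z s|; elim: n s p => // n IHn s p.
have [m] := ubnP #|[set j | 0 < h j p]%SET|; elim: m p => // m IHm p.
rewrite !ltnS => hm hn sE psp [i0 i0p].
have [a' ra'] := z_real sE.
(* [g (j, k)] vanishes at [a] when [h j] and [h k] reach zero at the same time along [p - t *: a].
   For generic [a], two forms positive at [p] do so only if they are proportional on the span of
   [s], so a single facet is crossed. *)
pose g (jk : J * J) y := h jk.2 p * h jk.1 y - h jk.1 p * h jk.2 y.
have glin i y b w : g i (y + b *: w) = g i y + b * g i w.
  by rewrite /g !linearD !linearZ /=; ring.
have [a ra ga] := generic_realizer (enum {: J * J}) glin ra'.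
have prop j k : h j a * h k p = h k a * h j p ->
    forall y, inspan (z s) y -> h k p * h j y = h j p * h k y.
  move=> jk y ysp; have := ga (j, k); rewrite mem_enum => /(_ isT) /=.
  move=> /(_ _ y ysp) H; apply/eqP; rewrite -subr_eq0; apply/eqP; apply: H.
  by rewrite /g /= mulrC jk mulrC subrr.
have apos j : 0 < h j p -> 0 < h j a.
  by move=> jp; apply: (realizes_gt0 ra); apply: contraTN jp => /psp ->; rewrite ltxx.
(* [tau] is the first time at which a form positive at [p] vanishes along [p - t *: a]. *)
case: (@arg_minP _ _ J i0 (fun j => 0 < h j p) (fun j => h j p / h j a) i0p) => j0 j0p j0min.
set tau := h j0 p / h j0 a in j0min.
have tau0 : 0 < tau by rewrite divr_gt0 // apos.
pose p0 := p + (- tau) *: a.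
have p0E j : h j p0 = h j p - tau * h j a by rewrite /p0 linearD linearZ /= mulNr.
have p0sp : inspan (z s) p0 by apply: inspan_comb => //; exact: realizes_inspan.
clearbody p0.
have p0neg j : j \notin z s -> ~~ (0 < h j p) -> h j p0 < 0.
  move=> js; rewrite -leNgt p0E => hj; have := realizes_gt0 ra js; nra.
have p0pos j : 0 < h j p -> 0 <= h j p0.
  by move=> hj; rewrite p0E subr_ge0 -ler_pdivlMr ?apos //; exact: j0min.
pose J0 := [set j | (j \notin z s) && (h j p0 == 0)]%SET.
have j0s : j0 \notin z s by apply: contraTN j0p => /psp ->; rewrite ltxx.
have j0J : j0 \in J0.
  by rewrite inE j0s /= p0E /tau divfK ?subrr // lt0r_neq0 // apos.
have J0p j : j \in J0 -> 0 < h j p.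
  rewrite inE => /andP[js /eqP hj]; apply/contraT => /(p0neg _ js).
  by rewrite hj ltxx.
have J0prop j k y : j \in J0 -> k \in J0 -> inspan (z s) y -> h j y = 0 -> h k y = 0.
  move=> jJ kJ ysp hj0; have := @prop j k _ y ysp; rewrite hj0 mulr0.
  have jp := J0p _ jJ; move: (jJ) (kJ); rewrite !inE !p0E => /andP[js /eqP j1] /andP[ks /eqP k1].
  have -> : h j a * h k p = h k a * h j p.
    by rewrite (subr0_eq j1) (subr0_eq k1); ring.
  by move=> /(_ erefl) /esym /eqP; rewrite mulf_eq0 gt_eqF //= => /eqP.
pose ZF := z s :|: J0.
have j0F : j0 \in ZF by rewrite inE j0J orbT.
have sF : z s \subset ZF by apply: finset.subsetUl.
pose U1 := pointing s p0.
pose U0 : pred T := fun t => (ZF \subset z t) && [forall (j | j \in z t :\: ZF), 0 < h j p0].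
(* The forms of [J0] being proportional on the span of [s], a face of [s] lies in all their
   hyperplanes or in none. This separates [U0] from [U1]. *)
have ptE t : t \in E -> z s \subset z t -> J0 \subset z t \/ [disjoint J0 & z t]%B.
  move=> tE st; case: (boolP [disjoint J0 & z t]%B) => [|dj]; [by right|left].
  move: dj; rewrite disjoint_sym -finset.setI_eq0 => /finset.set0Pn[j /finset.setIP[jt jJ]].
  have [y ry] := z_real tE; apply/fintype.subsetP => k kJ; apply: (realizes_eq0 ry).
  have ysp := realizes_inspan ry.
  by apply: (J0prop j) (ysp _ jt) => //; exact: inspanS ysp.
have UE : {in E, forall t, pointing s p t = U0 t || U1 t}.
  move=> t tE; rewrite /pointing /U0 /U1 /pointing finset.subUset.
  case: (boolP (z s \subset z t)) => //= st.
  have [Jt|Jt] := ptE t tE st.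
    rewrite Jt /= [X in _ || X](introF idP) ?orbF; last first.
      move=> /forall_inP /(_ j0); rewrite inE j0s (fintype.subsetP Jt) // => /(_ isT).
      by move: j0J; rewrite inE => /andP[_ /eqP ->]; rewrite ltxx.
    apply/forall_inP/forall_inP => H j; rewrite !inE.
      rewrite negb_or => /andP[/andP[js jJ] jt].
      have jp := H j; rewrite inE js jt in jp.
      by move: jJ; rewrite js /= lt_def => -> /=; apply/p0pos/jp.
    move=> /andP[js jt]; apply/contraT => hj; have := p0neg _ js hj.
    case: (boolP (j \in J0)) => [/J0p hj'|jJ]; first by rewrite hj' in hj.
    have := H j; rewrite !inE negb_or js jt /=; rewrite inE js /= in jJ; rewrite jJ => /(_ isT).
    by move=> h1 h2; have := lt_trans h1 h2; rewrite ltxx.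
  rewrite [X in X && _](introF idP) /=; last first.
    by move=> /fintype.subsetP /(_ _ j0J) j0t; have := disjointFr Jt j0J; rewrite j0t.
  apply/forall_inP/forall_inP => H j jts; move: (jts); rewrite inE => /andP[js jt].
    have := p0pos _ (H j jts); rewrite le_eqVlt => /orP[/eqP hj|//].
    by have := disjointFl Jt jt; rewrite inE js -hj eqxx.
  by apply/contraT => /(p0neg _ js); rewrite ltNge (ltW (H j jts)).
have U01 : {in E, forall t, ~~ (U0 t && U1 t)}.
  move=> t tE; apply/negP => /andP[/andP[Ft _] /andP[_ /forall_inP /(_ j0)]].
  rewrite inE j0s (fintype.subsetP Ft _ j0F) => /(_ isT).
  by move: j0J; rewrite inE => /andP[_ /eqP ->]; rewrite ltxx.
have eUV : {in E &, forall s t, U0 s -> U1 t -> e s t = 0}.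
  move=> t w tE wE /andP[Ft _] /andP[_ /forall_inP Hw]; apply/eqP/contraT => etw.
  have := e_sub tE wE etw => /fintype.proper_sub tw.
  have := Hw j0; rewrite inE j0s (fintype.subsetP tw _ (fintype.subsetP Ft _ j0F)) => /(_ isT).
  by move: j0J; rewrite inE => /andP[_ /eqP ->]; rewrite ltxx.
have sq0p : sq0 E e (pointing s p).
  apply: (sq0_sub e_sq0) => // s1 t w s1E tE wE /andP[ss1 _] /andP[_ /forall_inP Hw] _ npt.
  apply/eqP; rewrite mulf_eq0; apply/contraT; rewrite negb_or => /andP[e1 e2].
  have /fintype.proper_sub s1t := e_sub s1E tE e1; have /fintype.proper_sub tw := e_sub tE wE e2.
  move/negP: npt; case; rewrite /pointing (fintype.subset_trans ss1) //=.
  apply/forall_inP => j; rewrite inE => /andP[js jt]; apply: Hw.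
  by rewrite inE js (fintype.subsetP tw).
have hcard : (#|[set j | (0 < h j p0)%R]%SET| < m)%N.
  apply: leq_trans hm; apply: fintype.proper_card; apply/fintype.properP; split.
    apply/fintype.subsetP => j; rewrite !inE => hj.
    apply/contraT => np; case: (boolP (j \in z s)) => js.
      by rewrite p0sp // ltxx in hj.
    by have := p0neg _ js np; rewrite ltNge (ltW hj).
  exists j0; rewrite !inE //; move: j0J; rewrite inE => /andP[_ /eqP ->].
  by rewrite ltxx.
(* If [ZF] is realizable it is the zero set of the facet [f]; otherwise [U0] is empty and crossing
   these hyperplanes changes nothing. *)
case: (pselect (realizable ZF)) => [rF|nrF].
  have [f fE fF] := z_surj rF.
  have U0E : U0 = pointing f p0 by rewrite /U0 /pointing fF.
  case: (pselect (exists j, 0 < h j p0)) => [pos|npos].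
    apply: (exact_extension sq0p UE U01 eUV); last exact: IHm.
    rewrite U0E; apply: IHn => //; last first.
      by rewrite fF => j /finset.setUP[/p0sp //|]; rewrite inE => /andP[_ /eqP].
    apply: leq_trans hn; rewrite fF; apply: fintype.proper_card; rewrite finset.properC.
    apply/fintype.properP; split=> //; exists j0 => //; by rewrite inE j0J orbT.
  (* Here [- p0] lies in [s], and from no proper face does [p0] point inwards: only [s] and [f] are
     left. *)
  have npos' j : (0 < h j p0) = false by apply/negP => hj; apply: npos; exists j.
  apply: (@eq_exact _ _ _ _ (pred2 s f)).
    move=> t tE; rewrite UE // U0E /U1 /pointing /= orbC.
    have H u : u \in E -> (t == u) =
        (z u \subset z t) && [forall (j | j \in z t :\: z u), 0 < h j p0].
      move=> uE; apply/eqP/andP => [->|[ut /forall_inP Hj]].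
        by split=> //; apply/forall_inP => j; rewrite finset.setDv inE.
      apply: z_inj => //; apply/eqP; rewrite finset.eqEsubset ut andbT.
      apply/fintype.subsetP => j jt; apply/contraT => ju; have := Hj j; rewrite inE ju jt npos'.
      by move=> /(_ isT).
    by rewrite -!H.
  apply: exact_pair => //; apply: e_cov => //; rewrite fF; split=> //.
  exists j0; first by rewrite inE j0J orbT j0s.
  move=> x xsp hx j /finset.setUP[/xsp //|jJ]; exact: (J0prop j0).
(* A point inside a face of [U0], pushed along [p0], would realize [ZF]. *)
have U0F : {in E, forall t, U0 t = false}.
  move=> t tE; apply/negP => /andP[Ft /forall_inP Ht]; apply: nrF.
  have [y ry] := z_real tE; have [d d0 hd] := realizes_push p0 ry.
  exists (y + d *: p0) => j; case: (boolP (j \in z t)) => jt; last first.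
    by rewrite ifN ?hd //; apply: contra jt; exact: (fintype.subsetP Ft).
  rewrite linearD linearZ /= (realizes_inspan ry) // add0r.
  case: (boolP (j \in ZF)) => jF; last by rewrite mulr_gt0 // Ht // inE jF.
  move: jF; rewrite inE => /orP[/p0sp ->|]; first by rewrite mulr0.
  by rewrite inE => /andP[_ /eqP ->]; rewrite mulr0.
apply: (@eq_exact _ _ _ _ U1); first by move=> t tE; rewrite UE // U0F.
apply: IHm => //.
(* If no form were positive at [p0], the point [- p0] would realize [ZF]. *)
apply/not_existsP => npos; apply: nrF; exists (- p0) => j.
rewrite linearN /= oppr_gt0 /ZF inE.
case: (boolP (j \in z s)) => js /=; first by rewrite p0sp // oppr0.
have jp : h j p0 <= 0 by rewrite leNgt; apply/negP/npos.
rewrite inE js /=; case: eqP => [->|/eqP hj]; first by rewrite oppr0.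
by rewrite lt_neqAle hj.
Qed.

End Sweep.
End Cone.

(** * Cells of alpha + M (x) R *)

Section CellGeometry.
Variables (R : realType) (X : toric) (alpha : 'rV[int]_(nray X)).
Local Notation r := (nray X).
Local Notation n := (tdim X).
Local Notation cell := (cell r).
Local Notation open_cell := (open_cell R alpha).
Local Notation closed_cell := (closed_cell R alpha).
Local Notation face := (face R alpha).
Local Notation facet := (facet R alpha).
Local Notation cell_dim := (cell_dim R alpha).
Implicit Types (c s t w : cell).

Definition rayR : 'M[R]_(r, n) := map_mx intr (ray X).

Lemma floor_ceilP (x : R) (f c : int) :
  (Num.floor x = f /\ Num.ceil x = c) <->
  (if f == c then x = f%:~R else c = f + 1 /\ f%:~R < x < c%:~R).
Proof.
split=> [[<- <-]|].
  have hf := floor_le x; have hc := ceil_ge x.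
  case: eqP => [e|/eqP ne]; first by apply/le_anti; rewrite hf e hc.
  have nx : x \isn't a Num.int.
    apply/negP => xi; move: ne; rewrite ceil_floor xi addr0 eqxx //.
  have e : Num.ceil x = Num.floor x + 1 by rewrite ceil_floor nx.
  split=> //; rewrite !lt_neqAle hf hc !andbT; apply/andP; split.
    by apply: contra nx => /eqP <-; rewrite intr_int.
  by apply: contra nx => /eqP ->; rewrite intr_int.
case: eqP => [<- ->|_ [-> /andP[h1 h2]]]; first by rewrite intrKfloor intrKceil.
by split; [apply: floor_def; rewrite (ltW h1) h2
          |apply: ceil_def; rewrite addrK h1 (ltW h2)].
Qed.

Lemma open_cellP c (b : 'rV[R]_r) : open_cell c b <-> affM R alpha b /\ forall i,
  if c.1 0 i == c.2 0 i then b 0 i = (c.1 0 i)%:~R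
  else c.2 0 i = c.1 0 i + 1 /\ (c.1 0 i)%:~R < b 0 i < (c.2 0 i)%:~R.
Proof.
by split=> -[ab hb]; split=> // i; apply/floor_ceilP; apply: hb.
Qed.

Definition cell_of (b : 'rV[R]_r) : cell :=
  (\row_i Num.floor (b 0 i), \row_i Num.ceil (b 0 i)).

Lemma cell_ofP b : affM R alpha b -> open_cell (cell_of b) b.
Proof. by move=> ab; split=> // i; rewrite !mxE. Qed.

Lemma open_cell_of c b : open_cell c b -> c = cell_of b.
Proof.
move=> [_ hb]; case: c hb => f c /= hb; rewrite /cell_of.
by congr (_, _); apply/rowP => i; rewrite mxE; have [e1 e2] := hb i; rewrite ?e1 ?e2.
Qed.

Lemma open_cell_width c : open_cell c !=set0 ->
  forall i, c.1 0 i <= c.2 0 i <= c.1 0 i + 1.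
Proof.
move=> [b /open_cellP[_ hb]] i; have := hb i.
by case: eqP => [-> _|_ [-> _]]; lia.
Qed.

Lemma open_closed_cell c : open_cell c `<=` closed_cell c.
Proof.
move=> b /open_cellP[ab hb]; split=> // i; have := hb i.
by case: eqP => [<- ->|_ [_ /andP[/ltW h1 /ltW h2]]].
Qed.

Lemma cell_le_closed c s b : (forall i, s.1 0 i <= c.1 0 i /\ c.2 0 i <= s.2 0 i) ->
  closed_cell c b -> closed_cell s b.
Proof.
move=> le [ab hb]; split=> // i; have [h1 h2] := hb i; have [l1 l2] := le i.
by split; [apply: le_trans h1|apply: le_trans h2 _]; rewrite ler_int.
Qed.

Lemma closed_cell_le c s b : open_cell c b -> closed_cell s b ->
  forall i, s.1 0 i <= c.1 0 i /\ c.2 0 i <= s.2 0 i.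
Proof.
move=> [_ hc] [_ hs] i; have [h1 h2] := hs i; have [<- <-] := hc i.
by rewrite floor_ge_int ceil_le_int.
Qed.

Lemma faceP s t : face s t <-> open_cell t !=set0 /\
  forall i, s.1 0 i <= t.1 0 i /\ t.2 0 i <= s.2 0 i.
Proof.
split=> [[t0 ts]|[t0 le]]; split=> //.
  by have [b tb] := t0; apply: closed_cell_le tb (ts _ tb).
by move=> b /open_closed_cell; apply: cell_le_closed.
Qed.

Lemma affM_line b b' (d : R) : affM R alpha b -> affM R alpha b' ->
  affM R alpha (b + d *: (b' - b)).
Proof.
move=> [m ->] [m' ->]; exists (m + d *: (m' - m)).
rewrite mulmxDl -scalemxAl mulmxBl addrA; congr (_ + _ *: _).
by rewrite opprD addrACA subrr add0r.
Qed.

Definition fixed_coords c : 'M[R]_r := diag_mx (\row_i (c.1 0 i == c.2 0 i)%:R).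

(* The directions of the affine hull of the open cell c. *)
Definition dirs c : 'M[R]_r := (rayR^T :&: kermx (fixed_coords c))%MS.

Lemma dirsP c (v : 'rV[R]_r) : (v <= dirs c)%MS <->
  (exists m : 'rV[R]_n, v = m *m rayR^T) /\ forall i, c.1 0 i = c.2 0 i -> v 0 i = 0.
Proof.
rewrite sub_capmx; split=> [/andP[/submxP h1 /sub_kermxP h2]|[h1 h2]].
  split=> // i e; have /rowP/(_ i) := h2.
  by rewrite mul_mx_diag !mxE e eqxx mulr1.
apply/andP; split; first exact/submxP.
apply/sub_kermxP/rowP => i; rewrite mul_mx_diag !mxE.
by case: eqP => [/h2 ->|]; rewrite ?mul0r ?mulr0.
Qed.

Lemma open_cell_sub_dirs c b b' : open_cell c b -> open_cell c b' -> (b' - b <= dirs c)%MS.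
Proof.
move=> /open_cellP[[m ->] hb] /open_cellP[[m' ->] hb']; apply/dirsP; split.
  by exists (m' - m); rewrite mulmxBl opprD addrACA subrr add0r.
move=> i e; have := hb i; have := hb' i; rewrite e eqxx => h1 h2.
by rewrite mxE h1 mxE h2 subrr.
Qed.

Lemma open_cell_push c b (k : nat) (V : 'M[R]_(k, r)) : open_cell c b -> (V <= dirs c)%MS ->
  exists2 d : R, 0 < d & forall j, open_cell c (b + d *: row j V).
Proof.
move=> cb Vc; move: (cb) => /open_cellP[[m bE] hb].
have [d1 d10 hd1] := small_scalar (enum (('I_k * 'I_r)%type : finType))
  (fun ji => b 0 ji.2 - (c.1 0 ji.2)%:~R) (fun ji => V ji.1 ji.2).
have [d2 d20 hd2] := small_scalar (enum (('I_k * 'I_r)%type : finType))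
  (fun ji => (c.2 0 ji.2)%:~R - b 0 ji.2) (fun ji => V ji.1 ji.2).
have [d [d0 dd1 dd2]] : exists d : R, [/\ 0 < d, d <= d1 & d <= d2].
  by exists (Num.min d1 d2); rewrite lt_min d10 d20 !ge_min !lexx orbT.
exists d => // j; have /dirsP[[m' vE] hv] := submx_trans (row_sub j V) Vc.
apply/open_cellP; split.
  by exists (m + d *: m'); rewrite mulmxDl -scalemxAl -vE bE addrA.
move=> i; have := hb i; case: eqP => [e|_ [e hi]].
  by move=> h; rewrite mxE h mxE hv // mulr0 addr0.
split=> //; rewrite !mxE; move: hi => /andP[h1 h2].
have := hd1 (j, i); have := hd2 (j, i); rewrite !mem_enum /= => /(_ isT) H2 /(_ isT) H1.
rewrite -subr_gt0 in h1; rewrite -subr_gt0 in h2.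
have {}H1 := H1 (lt0r_neq0 h1); have {}H2 := H2 (lt0r_neq0 h2).
rewrite (gtr0_norm h1) in H1; rewrite (gtr0_norm h2) in H2.
have G1 : d * `|V j i| < b 0 i - (c.1 0 i)%:~R.
  by apply: le_lt_trans H1; rewrite ler_wpM2r.
have G2 : d * `|V j i| < (c.2 0 i)%:~R - b 0 i.
  by apply: le_lt_trans H2; rewrite ler_wpM2r.
have : `|d * V j i| <= d * `|V j i| by rewrite normrM gtr0_norm.
rewrite ler_norml => /andP[? ?]; apply/andP; split; lra.
Qed.

Lemma cell_dim_rank c i : cell_dim i c -> \rank (dirs c) = i.
Proof.
move=> [b [V [fV cb cV sV]]]; rewrite -(eqP fV).
apply/eqP; rewrite eqn_leq; apply/andP; split; apply: mxrankS.
  have [d d0 hd] := open_cell_push cb (submx_refl (dirs c)).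
  apply/row_subP => j; have := sV _ (hd j).
  by rewrite addrC addKr eqmx_scale ?gt_eqF.
apply/row_subP => j; have := open_cell_sub_dirs cb (cV j).
by rewrite addrC addKr.
Qed.

Lemma rank_cell_dim c : open_cell c !=set0 -> cell_dim (\rank (dirs c)) c.
Proof.
move=> [b cb].
have sub : (row_base (dirs c) <= dirs c)%MS by rewrite eq_row_base.
have [d d0 hd] := open_cell_push cb sub.
exists b, (d *: row_base (dirs c)); split=> //.
- rewrite /row_free mxrank_scale_nz ?lt0r_neq0 //.
  exact: row_base_free.
- by move=> j; rewrite linearZ; exact: hd.
- move=> y cy; rewrite eqmx_scale ?gt_eqF // eq_row_base.
  exact: open_cell_sub_dirs.
Qed.

Lemma cell_dim_open c i : cell_dim i c -> open_cell c !=set0.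
Proof. by move=> [b [V [_ cb _ _]]]; exists b. Qed.

Lemma cell_dimP c i : cell_dim i c <-> open_cell c !=set0 /\ \rank (dirs c) = i.
Proof.
split=> [ci|[c0 <-]]; last exact: rank_cell_dim.
by split; [exact: cell_dim_open ci|exact: cell_dim_rank].
Qed.

Lemma cell_dim_le c i : cell_dim i c -> (i <= n)%N.
Proof.
move/cell_dim_rank <-; apply: leq_trans (mxrankS (capmxSl _ _)) _.
by rewrite mxrank_tr rank_leq_col.
Qed.

End CellGeometry.

(** * The cone over a closed cell and its faces *)

Section ClosedCellForms.
Variables (R : realType) (X : toric) (alpha : 'rV[int]_(nray X)).
Local Notation r := (nray X).
Local Notation n := (tdim X).

(* A pair (m, l) stands for the point l alpha + m of the cone over             *)
(* alpha + M (x) R.                                                            *)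
Definition cone_space : lmodType R := ('rV[R]_n * R^o)%type.

Definition cone_pt (w : cone_space) : 'rV[R]_r :=
  (w.2 : R) *: map_mx intr alpha + w.1 *m (rayR R X)^T.

Lemma cone_pt_lin (a : R) (w w' : cone_space) :
  cone_pt (a *: w + w') = a *: cone_pt w + cone_pt w'.
Proof.
rewrite /cone_pt /= mulmxDl -scalemxAl scalerDl scalerDr addrACA.
by rewrite -scalerA.
Qed.

(* The forms cutting out the cone over the closed cell s: the homogenizing     *)
(* coordinate, and the slacks of the lower and the upper bounds.               *)
Definition cell_form (s : cell r) (j : option (bool * 'I_r)) (w : cone_space) : R :=
  match j with
  | None => w.2
  | Some (false, i) => cone_pt w 0 i - (s.1 0 i)%:~R * w.2
  | Some (true, i) => (s.2 0 i)%:~R * w.2 - cone_pt w 0 i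
  end.

Lemma cell_form_lin s j : scalar (cell_form s j).
Proof.
move=> a w w'; have e2 : (a *: w + w').2 = a * w.2 + w'.2 by [].
have eP i : cone_pt (a *: w + w') 0 i = a * cone_pt w 0 i + cone_pt w' 0 i.
  by rewrite cone_pt_lin [LHS]mxE [X in X + _]mxE.
by case: j => [[[] i]|]; rewrite /cell_form ?eP e2 //; lra.
Qed.

HB.instance Definition _ s j :=
  GRing.isLinear.Build R cone_space R^o *%R (cell_form s j) (cell_form_lin s j).

(** The forms vanishing on a face of [s]. The empty face is the apex of the cone, where the
    homogenizing coordinate vanishes too. *)
Definition zset (s : cell r) (t : option (cell r)) : {set option (bool * 'I_r)} :=
  match t with
  | None => [set: _]
  | Some c => [set j | match j with
      | None => false
      | Some (false, i) => (c.1 0 i == s.1 0 i) && (c.2 0 i == s.1 0 i)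
      | Some (true, i) => (c.1 0 i == s.2 0 i) && (c.2 0 i == s.2 0 i)
      end]
  end.

Definition cell_forms s j : {scalar cone_space} := cell_form s j.

Local Notation open_cell := (open_cell R alpha).
Local Notation closed_cell := (closed_cell R alpha).
Local Notation face := (face R alpha).
Local Notation facet := (facet R alpha).
Local Notation cell_dim := (cell_dim R alpha).
Local Notation dirs := (dirs R).

Lemma affM_cone_pt b : affM R alpha b -> exists m, b = cone_pt (m, 1).
Proof. by move=> [m ->]; exists m; rewrite /cone_pt scale1r. Qed.

Lemma cone_pt_affM (w : cone_space) : w.2 = 1 -> affM R alpha (cone_pt w).
Proof. by move=> e; exists w.1; rewrite /cone_pt e scale1r. Qed.

Lemma cell_formsDZ s j (x : cone_space) a y :
  cell_forms s j (x + a *: y) = cell_forms s j x + a * cell_forms s j y.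
Proof. by rewrite addrC; have := cell_form_lin s j a y x; rewrite addrC. Qed.

(* The faces of s, the empty face [None] included. *)
Definition oface (s : cell r) (t : option (cell r)) : Prop :=
  if t is Some c then face s c else True.

Section Faces.
Variable s : cell r.
Hypothesis s0 : open_cell s !=set0.
Local Notation realizes := (realizes (cell_forms s)).
Local Notation inspan := (inspan (cell_forms s)).
Local Notation covers := (covers (cell_forms s)).
Local Notation zset := (zset s).

Lemma face_bounds t : face s t -> forall i,
  [/\ s.1 0 i <= t.1 0 i, t.1 0 i <= t.2 0 i, t.2 0 i <= s.2 0 i,
      s.1 0 i <= s.2 0 i & s.2 0 i <= s.1 0 i + 1].
Proof.
move=> /faceP[t0 le] i; have [? ?] := le i.
have /andP[? ?] := open_cell_width t0 i; have /andP[? ?] := open_cell_width s0 i.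
by split.
Qed.

Lemma face_refl : face s s.
Proof. by apply/faceP; split. Qed.

Lemma face_realizes t m : face s t -> open_cell t (cone_pt (m, 1)) ->
  realizes (m, 1) (zset (Some t)).
Proof.
move=> st /open_cellP[_ hb] [[[] i]|]; rewrite !inE /= ?mulr1 //=.
- have [*] := face_bounds st i; have := hb i; case: eqP => [e|/eqP ne [e /andP[h1 h2]]].
    move=> ->; rewrite e andbb; case: eqP => [->|/eqP]; first by rewrite subrr.
    by move=> ne; rewrite subr_gt0 ltr_int lt_neqAle ne.
  rewrite ifN; last by apply/negP; lia.
  by rewrite subr_gt0; apply: lt_le_trans h2 _; rewrite ler_int.
- have [*] := face_bounds st i; have := hb i; case: eqP => [e|/eqP ne [e /andP[h1 h2]]].
    move=> ->; rewrite e andbb; case: eqP => [->|/eqP]; first by rewrite subrr.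
    by move=> ne; rewrite subr_gt0 ltr_int lt_neqAle eq_sym ne -e.
  rewrite ifN; last by apply/negP; lia.
  by rewrite subr_gt0; apply: le_lt_trans h1; rewrite ler_int.
Qed.

Lemma face_realizable t : face s t -> exists2 m, open_cell t (cone_pt (m, 1)) &
  realizes (m, 1) (zset (Some t)).
Proof.
move=> st; have /faceP[[b tb] _] := st; have [m e] := affM_cone_pt tb.1.
by exists m; [rewrite -e|apply: face_realizes => //; rewrite -e].
Qed.

Lemma realizes0 : realizes 0 (zset None).
Proof. by move=> j; rewrite inE linear0. Qed.

Lemma realizes_ge0 w Z j : realizes w Z -> 0 <= cell_form s j w.
Proof. by move=> /(_ j) /=; case: ifP => _ => [->|/ltW]. Qed.

(** At height 0 the lower and upper slacks of a coordinate are opposite and nonnegative, so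
    everything vanishes and the face is the apex. At positive height one rescales to height 1 and
    takes the cell of the point. *)
Lemma zset_surj Z : realizable (cell_forms s) Z ->
  exists2 t, oface s t & zset t = Z.
Proof.
move=> [w rw]; have ge j := realizes_ge0 j rw.
have [w2|w2] := eqVneq (w.2 : R) 0.
  exists None => //; apply/setP => j; rewrite inE; symmetry; apply: (realizes_eq0 rw).
  case: j => [[[] i]|] //=; move: (ge (Some (false, i))) (ge (Some (true, i)));
    rewrite /= w2 !mulr0 ?subr0 ?sub0r => h1 h2; apply/le_anti; rewrite ?h1 ?h2 ?andbT //.
    by rewrite oppr_le0.
  by rewrite -oppr_ge0.
have w2p : 0 < (w.2 : R) by rewrite lt_neqAle eq_sym w2; exact: (ge None).
pose w' : cone_space := (w.2 : R)^-1 *: w.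
have w'2 : w'.2 = 1 by rewrite /w' /= -[_ *: _]/(_ * _) mulVf.
have rw' : realizes w' Z.
  move=> j; have := rw j; rewrite linearZ /=; case: ifP => _ => [->|hj]; first by rewrite mulr0.
  by rewrite mulr_gt0 // invr_gt0.
clearbody w'; have ew' : w' = (w'.1, 1) by case: w' w'2 {rw'} => ? ? /= ->.
have ge' j := realizes_ge0 j rw'.
have aw := cone_pt_affM w'2; have cw := cell_ofP aw.
have sc : face s (cell_of (cone_pt w')).
  apply/faceP; split; first by exists (cone_pt w').
  apply: closed_cell_le cw _; split=> // i.
  move: (ge' (Some (false, i))) (ge' (Some (true, i))); rewrite /cell_form w'2 !mulr1.
  by rewrite !subr_ge0.
exists (Some (cell_of (cone_pt w'))) => //.
apply: realizes_inj rw'; rewrite {1}ew'; apply: face_realizes => //.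
by rewrite -ew'.
Qed.

Lemma zset_inj t t' : oface s t ->
  oface s t' -> zset t = zset t' -> t = t'.
Proof.
case: t t' => [t|] [t'|] //= st st' /setP e; last first.
- by have := e None; rewrite !inE.
- by have := e None; rewrite !inE.
suff H i : t.1 0 i = t'.1 0 i /\ t.2 0 i = t'.2 0 i.
  case: t t' H {e st st'} => [t1 t2] [t'1 t'2] H.
  by congr (Some (_, _)); apply/rowP => i; have [] := H i.
have [*] := face_bounds st i; have [*] := face_bounds st' i.
by have := e (Some (false, i)); have := e (Some (true, i)); rewrite !inE; lia.
Qed.

Lemma zset_sub_face t t' : face s t -> face s t' ->
  zset (Some t) \subset zset (Some t') -> face t t'.
Proof.
move=> st st' /fintype.subsetP sub; apply/faceP; split; first by have /faceP[] := st'.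
move=> i; have [*] := face_bounds st i; have [*] := face_bounds st' i.
by have := sub (Some (false, i)); have := sub (Some (true, i)); rewrite !inE; lia.
Qed.

Lemma face_sub_zset t t' : face s t -> face s t' -> face t t' ->
  zset (Some t) \subset zset (Some t').
Proof.
move=> st st' /faceP[_ le]; apply/fintype.subsetP => -[[[] i]|]; rewrite !inE //;
have [*] := face_bounds st i; have [*] := face_bounds st' i; have := le i; lia.
Qed.

Lemma inspan_dirs t (w : cone_space) : face s t -> w.2 = 0 ->
  inspan (zset (Some t)) w <-> (cone_pt w <= dirs t)%MS.
Proof.
move=> st w2; rewrite dirsP; split=> [hw|[_ hw] j].
  split; first by exists w.1; rewrite /cone_pt w2 scale0r add0r.
  move=> i e; have [*] := face_bounds st i.
  have [e1|e1] : t.1 0 i = s.1 0 i \/ t.1 0 i = s.2 0 i by lia.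
    have := hw (Some (false, i)); rewrite inE -e e1 eqxx /= w2 mulr0 subr0.
    by apply.
  have := hw (Some (true, i)); rewrite inE -e e1 eqxx /= w2 mulr0 sub0r.
  by move=> /(_ isT) /eqP; rewrite oppr_eq0 => /eqP.
case: j => [[[] i]|]; rewrite inE //= w2 mulr0 => /andP[/eqP e1 /eqP e2];
by rewrite hw ?e1 ?e2 // ?subr0 ?sub0r ?oppr0.
Qed.

Lemma dirs_lift t v : (v <= dirs t)%MS -> exists m, v = cone_pt (m, 0).
Proof. by move=> /dirsP[[m ->] _]; exists m; rewrite /cone_pt scale0r add0r. Qed.

Lemma face_dirs t t' : face s t -> face s t' -> face t t' -> (dirs t' <= dirs t)%MS.
Proof.
move=> st st' tt'; apply/row_subP => j; have := row_sub j (dirs t').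
move: (row _ _) => v vt'; have [m e] := dirs_lift vt'.
move: vt'; rewrite e -!inspan_dirs //; apply: inspanS; exact: face_sub_zset.
Qed.

Definition coord_hyper t (i : 'I_r) : 'M[R]_r :=
  (dirs t :&: kermx (@delta_mx R r 1 i ord0))%MS.

Lemma coord_hyperP t i (v : 'rV[R]_r) : (v <= coord_hyper t i)%MS <-> (v <= dirs t)%MS /\ v 0 i = 0.
Proof.
rewrite sub_capmx; split=> [/andP[-> /sub_kermxP/rowP/(_ 0)]|[-> vi]].
  by rewrite -colE !mxE.
by apply/sub_kermxP; rewrite -colE; apply/rowP => j; rewrite !mxE.
Qed.

Lemma rank_coord_hyper t i (v : 'rV[R]_r) : (v <= dirs t)%MS -> v 0 i != 0 ->
  \rank (dirs t) = (\rank (coord_hyper t i)).+1.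
Proof.
move=> vt vi; rewrite /coord_hyper -(mxrank_mul_ker (dirs t) (@delta_mx R r 1 i ord0)).
rewrite -[RHS]add1n; congr (_ + _)%N; apply/eqP; rewrite eqn_leq rank_leq_col lt0n mxrank_eq0.
apply: contra vi => /eqP d0; have /submxP[u uE] := vt.
have -> : v 0 i = (v *m @delta_mx R r 1 i ord0) 0 0 by rewrite -colE mxE.
by rewrite uE -mulmxA d0 mulmx0 mxE.
Qed.

(** A slack vanishing on [t'] but not on [t] cuts a hyperplane out of the directions of [t]. It
    contains the directions of [t'], and the dimensions agree, so that single slack determines the
    span of [t']. *)
Lemma facet_covers t t' : face s t -> face s t' -> facet t t' ->
  covers (zset (Some t)) (zset (Some t')).
Proof.
move=> st st' [tt' [d [/cell_dim_rank rt /cell_dim_rank rt']]].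
have sub := face_sub_zset st st' tt'; split=> //.
have /subsetPn[j jt' jt] : ~~ (zset (Some t') \subset zset (Some t)).
  apply/negP => sub'; have e : zset (Some t') = zset (Some t).
    by apply/eqP; rewrite finset.eqEsubset sub sub'.
  by have [e'] := @zset_inj (Some t') (Some t) st' st e; move: rt; rewrite -e' rt' => /n_Sn.
exists j; first by rewrite jt' jt.
case: j jt jt' => [[b i]|]; last by rewrite !inE.
move=> jt jt' w wt wj.
have [m _ rm] := face_realizable st'; have [m1 _ rm1] := face_realizable st.
have mt := inspanS sub (realizes_inspan rm).
have form0 (x : cone_space) : x.2 = 0 -> (cell_forms s (Some (b, i)) x == 0) = (cone_pt x 0 i == 0).
  by move=> x2; case: (b); rewrite /= x2 mulr0 ?subr0 ?sub0r ?oppr_eq0.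
(* Subtracting a multiple of this point of [t'] brings a vector to height 0, where it is a
   direction, without changing the value of the chosen slack. *)
pose y : cone_space := ((m, 1) : cone_space).
have sub1 (x : cone_space) : inspan (zset (Some t)) x ->
    inspan (zset (Some t)) (x + (- (x.2 : R)) *: y).
  by move=> xt; apply: inspan_comb.
have sub2 (x : cone_space) : (x + (- (x.2 : R)) *: y).2 = 0.
  by rewrite /= -[_ *: _]/(_ * _) mulr1 addrN.
have formj (x : cone_space) : cell_forms s (Some (b, i)) (x + (- (x.2 : R)) *: y) =
    cell_forms s (Some (b, i)) x.
  by rewrite cell_formsDZ (realizes_inspan rm) // mulr0 addr0.
have hyp : (dirs t' == coord_hyper t i)%MS.
  have le : (dirs t' <= coord_hyper t i)%MS.
    apply/row_subP => k; have := row_sub k (dirs t').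
    move: (row _ _) => v vt'; apply/coord_hyperP; split.
      exact: submx_trans vt' (face_dirs st st' tt').
    have [mv e] := dirs_lift vt'; move: vt'; rewrite e -inspan_dirs // => /(_ _ jt') /eqP.
    by rewrite form0 // => /eqP.
  rewrite -(geq_leqif (mxrank_leqif_eq le)) rt'.
  rewrite -ltnS -rt -(@rank_coord_hyper t i (cone_pt ((m1, 1) + (- (1 : R)) *: y))) //.
    by apply/inspan_dirs => //; apply: sub1 (realizes_inspan rm1).
  rewrite -form0 //; rewrite formj gt_eqF //; exact: realizes_gt0 rm1 _.
have : (cone_pt (w + (- (w.2 : R)) *: y) <= dirs t')%MS.
  rewrite (eqmxP hyp); apply/coord_hyperP; split; first by apply/inspan_dirs => //; exact: sub1.
  by apply/eqP; rewrite -form0 // formj wj.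
move=> /(inspan_dirs st' (sub2 w)) H k kt'; have := H _ kt'.
by rewrite cell_formsDZ (realizes_inspan rm) // mulr0 addr0.
Qed.

Lemma covers_facet t t' : face s t -> face s t' ->
  covers (zset (Some t)) (zset (Some t')) -> facet t t'.
Proof.
move=> st st' [sub [j /andP[jt' jt] hj]].
have tt' := zset_sub_face st st' sub; split=> //.
case: j jt jt' hj => [[b i]|] jt jt' hj; last by rewrite inE in jt'.
have [m om rm] := face_realizable st'; have [m1 om1 rm1] := face_realizable st.
have mt := inspanS sub (realizes_inspan rm).
have form0 (x : cone_space) : x.2 = 0 -> (cell_forms s (Some (b, i)) x == 0) = (cone_pt x 0 i == 0).
  by move=> x2; case: (b); rewrite /= x2 mulr0 ?subr0 ?sub0r ?oppr_eq0.
exists (\rank (dirs t')); split; apply/cell_dimP; split=> //;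
  [by exists (cone_pt (m1, 1))| |by exists (cone_pt (m, 1))].
pose u : cone_space := ((m1, 1) : cone_space) + (- (1 : R)) *: ((m, 1) : cone_space).
have u2 : u.2 = 0 by rewrite /u /= -[_ *: _]/(_ * _) mulr1 addrN.
rewrite (@rank_coord_hyper t i (cone_pt u)).
- congr S; apply/eqP; rewrite eqn_leq; apply/andP; split; apply: mxrankS.
    apply/row_subP => k; have := row_sub k (coord_hyper t i).
    move: (row _ _) => v /coord_hyperP[vt vi].
    have [mv e] := dirs_lift vt; move: vt vi; rewrite e -!inspan_dirs // => vt /eqP.
    by rewrite -form0 // => /eqP; apply: hj.
  apply/row_subP => k; have := row_sub k (dirs t').
  move: (row _ _) => v vt'; apply/coord_hyperP; split.
    exact: submx_trans vt' (face_dirs st st' tt').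
  have [mv e] := dirs_lift vt'; move: vt'; rewrite e -inspan_dirs // => /(_ _ jt') /eqP.
  by rewrite form0 // => /eqP.
- by apply/inspan_dirs => //; apply: inspan_comb => //; exact: realizes_inspan rm1.
rewrite -form0 // /u cell_formsDZ (realizes_inspan rm jt') mulr0 addr0 gt_eqF //.
exact: realizes_gt0 rm1 jt.
Qed.

(** Together with [covers_vertex]: the apex is a facet of the cone over [t] exactly when [t] is a
    point, which is how the augmentation fits the covering relation. *)
Lemma vertex_covers t : face s t -> cell_dim 0 t -> covers (zset (Some t)) (zset None).
Proof.
move=> st /cell_dim_rank /eqP; rewrite mxrank_eq0 => /eqP d0; split; first exact: finset.subsetT.
exists None; first by rewrite !inE.
move=> w wt w2; have := (inspan_dirs st w2).1 wt; rewrite d0 submx0 => /eqP e.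
by case=> [[[] i]|] _ //; rewrite /= e mxE (w2 : w.2 = 0) mulr0 subr0.
Qed.

Lemma covers_vertex t : face s t -> covers (zset (Some t)) (zset None) -> cell_dim 0 t.
Proof.
move=> st [_ [j /andP[_ jt] hj]]; have [m om rm] := face_realizable st.
apply/cell_dimP; split; first by exists (cone_pt (m, 1)).
apply/eqP; rewrite mxrank_eq0 -submx0; apply/row_subP => k; have := row_sub k (dirs t).
move: (row _ _) => v vt; have [mv e] := dirs_lift vt.
move: vt; rewrite submx0 e -inspan_dirs // => vt.
have jm : 0 < cell_forms s j (m, 1) := realizes_gt0 rm jt.
set d : cone_space := (mv, 0) in vt *.
(* [q] is chosen so that form [j] vanishes on [d] minus [q] times the point; all forms then vanish
   there, and the homogenizing coordinate gives [q = 0]. *)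
pose q := cell_forms s j d / cell_forms s j (m, 1).
have := hj (d + (- q) *: ((m, 1) : cone_space)) (inspan_comb _ vt (realizes_inspan rm)).
rewrite cell_formsDZ mulNr divfK ?lt0r_neq0 // addrN => /(_ erefl) H.
have q0 : q = 0.
  have := H None; rewrite inE => /(_ isT) /=.
  by rewrite -[_ *: _]/(_ * _) mulr1 add0r => /eqP; rewrite oppr_eq0 => /eqP.
apply/eqP/rowP => i; have := H (Some (false, i)); rewrite inE => /(_ isT).
rewrite cell_formsDZ q0 oppr0 mul0r addr0 => h0; rewrite [RHS]mxE -[RHS]h0.
by rewrite -[RHS]/(cone_pt d 0 i - (s.1 0 i)%:~R * 0) mulr0 subr0.
Qed.

End Faces.
End ClosedCellForms.

(** * Boxes of cells and their augmented chain complexes *)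

Section Boxes.
Variables (R : realType) (X : toric) (alpha : 'rV[int]_(nray X)).
Local Notation r := (nray X).
Local Notation n := (tdim X).
Local Notation open_cell := (open_cell R alpha).
Local Notation closed_cell := (closed_cell R alpha).
Local Notation face := (face R alpha).
Local Notation facet := (facet R alpha).
Local Notation cell_dim := (cell_dim R alpha).
Implicit Types (a b : 'rV[int]_r) (c s t w : cell r).

Definition box_points a b : seq 'rV[int]_r :=
  let N := \max_i `|(b 0 i - a 0 i)%R|%N in
  [seq \row_i (a 0 i + (v 0 i : nat)%:Z) | v : 'rV['I_N.+1]_r].

Definition in_box a b c := [forall i, (a 0 i <= c.1 0 i) && (c.2 0 i <= b 0 i)].

Lemma in_boxP a b c : reflect (forall i, a 0 i <= c.1 0 i /\ c.2 0 i <= b 0 i) (in_box a b c).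
Proof. by apply: (iffP forallP) => h i; apply/andP; apply: h. Qed.

Definition box_cells a b : seq (cell r) :=
  undup [seq c <- [seq (x, y) | x <- box_points a b, y <- box_points a b] |
    `[< open_cell c !=set0 >] && in_box a b c].

Lemma mem_box_points a b (v : 'rV[int]_r) :
  (forall i, a 0 i <= v 0 i <= b 0 i) -> v \in box_points a b.
Proof.
move=> hv; set N := \max_i `|(b 0 i - a 0 i)%R|%N.
apply/mapP; exists (\row_i inord `|(v 0 i - a 0 i)%R|%N); first by rewrite mem_enum.
apply/rowP => i; rewrite !mxE inordK; last first.
  by rewrite ltnS; apply: leq_trans (leq_bigmax i); case/andP: (hv i); lia.
by case/andP: (hv i) => h1 h2; rewrite gez0_abs ?subr_ge0 // addrC subrK.
Qed.

Lemma mem_box_cells a b c :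
  (c \in box_cells a b) = `[< open_cell c !=set0 >] && in_box a b c.
Proof.
rewrite mem_undup mem_filter; apply: andb_idr => /andP[/asboolP c0 /in_boxP cab].
case: c c0 cab => f c c0 cab; have := open_cell_width c0 => /= w.
apply/allpairsP; exists (f, c); split=> //; apply: mem_box_points => i /=;
have := cab i; have := w i => /=; lia.
Qed.

Lemma box_cellsP a b c : reflect (open_cell c !=set0 /\
  forall i, a 0 i <= c.1 0 i /\ c.2 0 i <= b 0 i) (c \in box_cells a b).
Proof.
rewrite mem_box_cells; apply: (iffP andP) => [[/asboolP ? /in_boxP ?]|[? ?]] //.
by split; [apply/asboolP|apply/in_boxP].
Qed.

Lemma face_box_cells s t : face s t <-> t \in box_cells s.1 s.2.
Proof. by rewrite faceP; split=> /box_cellsP. Qed.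

Lemma in_box_trans a b c t : (forall i, a 0 i <= c.1 0 i /\ c.2 0 i <= b 0 i) ->
  (forall i, c.1 0 i <= t.1 0 i /\ t.2 0 i <= c.2 0 i) ->
  forall i, a 0 i <= t.1 0 i /\ t.2 0 i <= b 0 i.
Proof.
move=> h h' i; have [h1 h2] := h i; have [h3 h4] := h' i.
by split; [exact: le_trans h3|exact: le_trans h2].
Qed.

Lemma face_trans s t w : face s t -> face t w -> face s w.
Proof.
move=> /faceP[_ le] /faceP[w0 le']; apply/faceP; split=> // i.
by have := le i; have := le' i; lia.
Qed.

(* Take the cell of a point of the box with the fewest tight inequalities. *)
Lemma box_top a b : (exists c : cell r, c \in box_cells a b) -> (forall i, b 0 i <= a 0 i + 1) ->
  exists2 s : cell r, s \in box_cells a b & forall t : cell r, t \in box_cells a b -> face s t.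
Proof.
move=> [c cab] ab; pose free c := #|[set i | c.1 0 i != c.2 0 i]|%SET.
have [s sab smax] : exists2 s : cell r, s \in box_cells a b &
    forall t : cell r, t \in box_cells a b -> (free t <= free s)%N.
  pose P m := [exists s : seq_sub (box_cells a b), free (ssval s) == m].
  have Pc : exists m, P m by exists (free c); apply/existsP; exists (SeqSub cab).
  have Pub m : P m -> (m <= r)%N.
    move=> /existsP[s /eqP <-]; apply: leq_trans (max_card _) _; by rewrite card_ord.
  case: (ex_maxnP Pc Pub) => m /existsP[s /eqP sm] mmax.
  exists (ssval s); first exact: ssvalP.
  by move=> t tab; rewrite sm; apply: mmax; apply/existsP; exists (SeqSub tab).
exists s => // t tab.
have /box_cellsP[[x sx] sle] := sab; have /box_cellsP[t0 tle] := tab.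
have [y ty] := t0.
(* The cell [m] of the midpoint has at least the free coordinates of [s], hence exactly those by
   maximality. A coordinate fixed on [s] must then be fixed on [t], at the same bound. *)
pose z := x + 2^-1 *: (y - x).
have za : affM R alpha z by apply: affM_line; [case: sx|case: ty].
have zi i : z 0 i = (x 0 i + y 0 i) / 2 by rewrite !mxE; lra.
have cz := cell_ofP za; set m := cell_of z in cz.
have xab : closed_cell (a, b) x.
  by apply: (@cell_le_closed _ _ _ s (a, b)) sle _; exact: open_closed_cell.
have yab : closed_cell (a, b) y.
  by apply: (@cell_le_closed _ _ _ t (a, b)) tle _; exact: open_closed_cell.
have zab : closed_cell (a, b) z.
  split=> // i; have [/= ? ?] := xab.2 i; have [/= ? ?] := yab.2 i.
  by rewrite zi; split; lra.
have mab : m \in box_cells a b.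
  by apply/box_cellsP; split; [exists z|exact: closed_cell_le cz zab].
have mfree i : (a 0 i)%:~R < z 0 i < (b 0 i)%:~R -> m.1 0 i != m.2 0 i.
  move=> hz; apply/eqP => e; have /open_cellP[_ /(_ i)] := cz.
  rewrite e eqxx => zE; move: hz; rewrite zE !ltr_int.
  by have := ab i; lia.
have sub : ([set i | s.1 0 i != s.2 0 i] \subset [set i | m.1 0 i != m.2 0 i])%SET.
  apply/fintype.subsetP => i; rewrite !inE => si; apply: mfree.
  have /open_cellP[_ /(_ i)] := sx; rewrite (negbTE si) => -[e /andP[h1 h2]].
  have [/= ? ?] := yab.2 i; have [l1 l2] := sle i.
  have e1 : s.1 0 i = a 0 i by have := ab i; lia.
  have e2 : s.2 0 i = b 0 i by have := ab i; lia.
  by rewrite e1 in h1; rewrite e2 in h2; rewrite zi; lra.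
have eqf : [set i | s.1 0 i != s.2 0 i]%SET = [set i | m.1 0 i != m.2 0 i]%SET.
  by apply/eqP; rewrite eqEcard sub smax.
apply/faceP; split=> // i.
have [l1 l2] := sle i; have [l3 l4] := tle i.
have /andP[w1 w2] := open_cell_width t0 i.
have [si|si] := eqVneq (s.1 0 i) (s.2 0 i); last first.
  have /andP[w3 w4] := open_cell_width (ex_intro _ x sx) i.
  by have := ab i; move/eqP: si; lia.
have : m.1 0 i = m.2 0 i.
  by apply/eqP; move/setP/(_ i): eqf; rewrite !inE si eqxx => /esym /negbFE.
move=> mi; have : ~ ((a 0 i)%:~R < z 0 i < (b 0 i)%:~R).
  by move=> /mfree; rewrite mi eqxx.
have /open_cellP[_ /(_ i)] := sx; rewrite si eqxx zi => ->.
have [/= y1 y2] := yab.2 i; have [/= x1 x2] := xab.2 i => hz.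
have [e|e] : s.2 0 i = a 0 i \/ s.2 0 i = b 0 i by have := ab i; lia.
  have ya : y 0 i = (a 0 i)%:~R.
    apply/le_anti; rewrite y1 andbT leNgt; apply/negP => ya; apply: hz.
    rewrite e; have : ((a 0 i)%:~R : R) < (b 0 i)%:~R by apply: lt_le_trans y2.
    by lra.
  have [_ /(_ i)] := ty; rewrite ya intrKfloor intrKceil.
  by lia.
have yb : y 0 i = (b 0 i)%:~R.
  apply/le_anti; rewrite y2 /= leNgt; apply/negP => yb; apply: hz.
  rewrite e; have : ((a 0 i)%:~R : R) < (b 0 i)%:~R by apply: le_lt_trans yb.
  by lra.
by have [_ /(_ i)] := ty; rewrite yb intrKfloor intrKceil; lia.
Qed.

Section Complex.
Variables (A : fieldType) (eps : cell r -> cell r -> int).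
Hypothesis Heps : incidence R alpha eps.

(* The augmented cellular chain complex; None is the empty face. *)
Definition bdry (s t : option (cell r)) : A :=
  match s, t with
  | Some c, Some d => (eps c d)%:~R
  | Some c, None => `[< cell_dim 0 c >]%:R
  | None, _ => 0
  end.

Definition box_faces a b : seq (option (cell r)) := None :: map Some (box_cells a b).

Lemma mem_box_faces a b c : (Some c \in box_faces a b) = (c \in box_cells a b).
Proof. by rewrite inE /= mem_map //; move=> ? ? []. Qed.

Lemma box_faces_uniq a b : uniq (box_faces a b).
Proof.
rewrite /= map_inj_uniq ?undup_uniq ?andbT; last by move=> ? ? [].
by apply/mapP => -[].
Qed.

Lemma bdry_covers s t (w : option (cell r)) : open_cell s !=set0 -> face s t ->
  oface R alpha s w -> bdry (Some t) w != 0 <->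
  covers (@cell_forms R X alpha s) (zset s (Some t)) (zset s w).
Proof.
move=> s0 st; case: w => [w|] sw /=; last first.
  split=> [h|/(covers_vertex s0 st)/asboolP ->]; last exact: oner_neq0.
  apply: vertex_covers => //; apply/asboolP; move: h.
  by case: `[< _ >] => //; rewrite eqxx.
split=> [h|/(covers_facet s0 st sw)/(inc_facet Heps)[] ->]; last 2 first.
- exact: oner_neq0.
- by rewrite rmorphN1 oppr_eq0 oner_neq0.
apply: facet_covers => //; apply: contrapT => /(inc_out Heps) e.
by rewrite e eqxx in h.
Qed.

Lemma box_facesP s (t : option (cell r)) : t \in box_faces s.1 s.2 <->
  oface R alpha s t.
Proof. by case: t => [c|]; rewrite ?mem_box_faces -?face_box_cells. Qed.

Lemma bdry_face s (t : option (cell r)) : bdry (Some s) t != 0 ->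
  oface R alpha s t.
Proof.
case: t => [t|] //= h; suff [] : facet s t by [].
by apply: contrapT => /(inc_out Heps) e; rewrite e eqxx in h.
Qed.

Lemma covers_proper (R' : realFieldType) (V : lmodType R') (J : finType)
  (h : J -> {scalar V}) (Z Z' : {set J}) : covers h Z Z' -> Z \proper Z'.
Proof.
by move=> [sub [j /andP[j1 j2] _]]; apply/fintype.properP; split=> //; exists j.
Qed.

(** By [diamond], a two-step descent passes through exactly two intermediate faces. Their
    contributions cancel by [inc_diamond], or by [inc_edge] when the descent ends at the empty
    face. *)
Lemma box_sq0 a b : sq0 (box_faces a b) bdry xpredT.
Proof.
move=> s w sE wE _ _; case: s sE => [s|] sE; last first.
  by rewrite big1 // => t _; rewrite mul0r.
have [s0 sab] : open_cell s !=set0 /\ forall i, a 0 i <= s.1 0 i /\ s.2 0 i <= b 0 i.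
  by apply/box_cellsP; rewrite -mem_box_faces.
have faceE (t : cell r) : face s t -> Some t \in box_faces a b.
  move=> /faceP[t0 st]; rewrite mem_box_faces; apply/box_cellsP; split=> //.
  exact: in_box_trans sab st.
case: (pselect (exists2 t, t \in box_faces a b & bdry (Some s) t * bdry t w != 0)); last first.
  move=> /forall2NP no; rewrite big_seq big1 // => t tE.
  by have [//|/negP] := no t; rewrite negbK => /eqP.
move=> [[t1|] t1E]; last by rewrite /= mulr0 eqxx.
rewrite mulf_eq0 negb_or => /andP[n1 n2].
have st1 := bdry_face n1.
have sw : oface R alpha s w.
  by case: w wE n2 => // w _ /bdry_face; apply: face_trans.
have c1 := (bdry_covers s0 (face_refl s0) st1).1 n1.
have c2 := (bdry_covers s0 st1 sw).1 n2.
have rZ (t : option (cell r)) : oface R alpha s t ->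
    realizable (@cell_forms R X alpha s) (zset s t).
  case: t => [t|] st; last by exists 0; exact: realizes0.
  by have [m _ rm] := face_realizable s0 st; exists (m, 1).
have [Z' [rZ' Z'1 c1' c2' two]] :=
  diamond (rZ (Some s) (face_refl s0)) (rZ (Some t1) st1) (rZ w sw) c1 c2.
have [t2o st2 t2Z] := zset_surj s0 rZ'; case: t2o st2 t2Z => [t2|] st2 t2Z; last first.
  by case: c2' => _ [j /andP[_]]; rewrite -t2Z finset.in_setT.
rewrite -t2Z in c1' c2' Z'1 two.
have n1' := (bdry_covers s0 (face_refl s0) st2).2 c1'.
have n2' := (bdry_covers s0 st2 sw).2 c2'.
have t12 : t1 <> t2 by move=> e; rewrite e eqxx in Z'1.
rewrite (@sum_pair _ _ _ _ (Some t1) (Some t2)) ?box_faces_uniq ?faceE //; last 2 first.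
- by apply/eqP => -[].
- move=> [t|] tE /eqP tt1 /eqP tt2; last by rewrite /= mulr0.
  apply/eqP/contraT; rewrite mulf_eq0 negb_or => /andP[m1 m2].
  have st := bdry_face m1.
  have d1 := covers_proper ((bdry_covers s0 (face_refl s0) st).1 m1).
  have d2 := covers_proper ((bdry_covers s0 st sw).1 m2).
  have [e|e] := two _ (rZ (Some t) st) d1 d2.
    by case: tt1; exact: (zset_inj s0 (t := Some t) (t' := Some t1) st st1 e).
  by case: tt2; exact: (zset_inj s0 (t := Some t) (t' := Some t2) st st2 e).
have f1 := covers_facet s0 (face_refl s0) st1 c1.
have f1' := covers_facet s0 (face_refl s0) st2 c1'.
case: w wE sw n2 n2' c2 c2' two => [w|] wE sw n2 n2' c2 c2' two; rewrite /bdry.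
  have f2 := covers_facet s0 st1 sw c2; have f2' := covers_facet s0 st2 sw c2'.
  by rewrite -!rmorphM -rmorphD /= (inc_diamond Heps t12 f1 f1' f2 f2').
have v1 := covers_vertex s0 st1 c2; have v2 := covers_vertex s0 st2 c2'.
rewrite (asboolT v1) (asboolT v2) !mulr1 -rmorphD /=.
rewrite (inc_edge Heps _ t12 f1 f1') //.
have [_ [d [ds dt]]] := f1.
by move: (cell_dim_rank v1) ds; rewrite (cell_dim_rank dt) => ->.
Qed.

(** From every face of [s], an interior point of [s] points into the interior, so [pointing] selects
    all faces. *)
Lemma exact_closed_cell s : open_cell s !=set0 ->
  exact (box_faces s.1 s.2) bdry xpredT.
Proof.
move=> s0; have [m om rm] := face_realizable s0 (face_refl s0).
apply: (eq_exact (U := pointing (@cell_forms R X alpha s) (zset s) (Some s) (m, 1))).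
  move=> t /box_facesP st; rewrite /pointing; apply/andP; split.
    case: t st => [t|] st; last exact: finset.subsetT.
    exact: (face_sub_zset s0 (face_refl s0) st st).
  by apply/forall_inP => j; rewrite inE => /andP[js _]; exact: realizes_gt0 rm js.
apply: exact_pointing.
- exact: box_faces_uniq.
- by move=> t t' /box_facesP st /box_facesP st'; exact: (zset_inj s0 st st').
- move=> t /box_facesP st; case: t st => [t|] st; last by exists 0; exact: realizes0.
  by have [m' _ rm'] := face_realizable s0 st; exists (m', 1).
- move=> Z /(zset_surj s0)[t st tZ]; exists t => //; exact/box_facesP.
- move=> [t|] w /box_facesP st /box_facesP sw; last by rewrite eqxx.
  by move=> /(bdry_covers s0 st sw)/covers_proper.
- move=> [t|] w /box_facesP st /box_facesP sw; first by move=> /(bdry_covers s0 st sw).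
  by move=> /covers_proper/fintype.properP[_ [j _]]; rewrite inE.
- exact: box_sq0.
- by apply/box_facesP; exact: face_refl.
- exact: realizes_inspan rm.
- by exists None; exact: ltr01.
Qed.

(* Cut the box by an integral hyperplane as long as possible; a box that no    *)
(* hyperplane cuts is a single closed cell.                                    *)
Lemma exact_box a b : (exists c : cell r, c \in box_cells a b) ->
  exact (box_faces a b) bdry xpredT.
Proof.
have [N] := ubnP (\sum_i `|(b 0%R i - a 0%R i)%R|)%N.
elim: N a b => // N IH a b; rewrite ltnS => hN [c cab].
have exact_le a' b' (U : pred (option (cell r))) :
    (forall t : cell r, t \in box_cells a b -> U (Some t) = (t \in box_cells a' b')) ->
    {subset box_cells a' b' <= box_cells a b} ->
    U None -> exact (box_faces a' b') bdry xpredT -> exact (box_faces a b) bdry U.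
  move=> UE sub U0 ex; apply: exact_change ex; rewrite ?box_faces_uniq //.
  case=> [t|]; rewrite ?andbT ?mem_box_faces ?U0 //.
  by apply/idP/andP => [tab'|[tab]]; [have tab := sub _ tab'; rewrite UE|rewrite UE].
case: (pselect (exists i nu, a 0 i < nu < b 0 i)) => [[i [nu /andP[anu nub]]]|nocut]; last first.
  have ab1 i : b 0 i <= a 0 i + 1.
    rewrite leNgt; apply/negP => lt; apply: nocut; exists i, (a 0 i + 1); lia.
  have [s sab smax] := box_top (ex_intro _ c cab) ab1.
  have [s0 sle] := box_cellsP a b s sab.
  have sub : {subset box_cells s.1 s.2 <= box_cells a b}.
    move=> t /face_box_cells/faceP[t0 st]; apply/box_cellsP; split=> //.
    exact: in_box_trans sle st.
  apply: (exact_le s.1 s.2) sub _ _ => //; last exact: exact_closed_cell.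
  by move=> t /smax st; apply/esym; apply/face_box_cells.
pose b' : 'rV[int]_r := \row_l (if l == i then nu else b 0 l).
pose a' : 'rV[int]_r := \row_l (if l == i then nu else a 0 l).
have b'E l : b' 0 l = if l == i then nu else b 0 l by rewrite mxE.
have a'E l : a' 0 l = if l == i then nu else a 0 l by rewrite mxE.
clearbody a' b'.
have smaller (u v : 'rV[int]_r) : (forall l, l != i -> u 0 l = a 0 l /\ v 0 l = b 0 l) ->
    a 0 i <= u 0 i -> u 0 i <= v 0 i -> v 0 i <= b 0 i -> v 0 i - u 0 i < b 0 i - a 0 i ->
    ((\sum_l `|(v 0%R l - u 0%R l)%R|) < N)%N.
  move=> uv h1 h2 h3 h4; apply: leq_trans hN.
  rewrite (bigD1 i) //= [X in (_ < X)%N](bigD1 i) //= -addSn; apply: leq_add; first by lia.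
  by apply: leq_sum => l /uv[-> ->].
pose P : pred (option (cell r)) := fun t : option (cell r) =>
  if t is Some c then c.2 0 i <= nu else true.
pose Q : pred (option (cell r)) := fun t : option (cell r) =>
  if t is Some c then nu <= c.1 0 i else true.
have PE (t : cell r) : t \in box_cells a b -> P (Some t) = (t \in box_cells a b').
  move=> /box_cellsP[t0 tle]; apply/idP/box_cellsP => [h|[_ /(_ i)]]; last first.
    by rewrite b'E eqxx => -[].
  split=> // l; rewrite b'E; case: eqP => [->|_] //; split=> //; exact: (tle i).1.
have QE (t : cell r) : t \in box_cells a b -> Q (Some t) = (t \in box_cells a' b).
  move=> /box_cellsP[t0 tle]; apply/idP/box_cellsP => [h|[_ /(_ i)]]; last first.
    by rewrite a'E eqxx => -[].
  split=> // l; rewrite a'E; case: eqP => [->|_] //; split=> //; exact: (tle i).2.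
have PQE (t : cell r) : t \in box_cells a b -> predI P Q (Some t) = (t \in box_cells a' b').
  move=> /box_cellsP[t0 tle]; apply/andP/box_cellsP => [[h h']|[_ /(_ i)]]; last first.
    by rewrite a'E b'E eqxx => -[].
  by split=> // l; rewrite a'E b'E; case: eqP => [->|_].
have subP : {subset box_cells a b' <= box_cells a b}.
  move=> t /box_cellsP[t0 tle]; apply/box_cellsP; split=> // l; have := tle l.
  by rewrite b'E; case: eqP => [->|_] //; lia.
have subQ : {subset box_cells a' b <= box_cells a b}.
  move=> t /box_cellsP[t0 tle]; apply/box_cellsP; split=> // l; have := tle l.
  by rewrite a'E; case: eqP => [->|_] //; lia.
have subPQ : {subset box_cells a' b' <= box_cells a b}.
  move=> t /box_cellsP[t0 tle]; apply/box_cellsP; split=> // l; have := tle l.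
  by rewrite a'E b'E; case: eqP => [->|_] //; lia.
have PorQ (t : option (cell r)) : t \in box_faces a b -> P t || Q t.
  case: t => [t|] //; rewrite mem_box_faces => /box_cellsP[t0 tle] /=.
  by have /andP[] := open_cell_width t0 i; lia.
have exP' : (exists t : cell r, t \in box_cells a b') -> exact (box_faces a b) bdry P.
  move=> ne; apply: (exact_le a b') => //; apply: IH => //.
  by apply: smaller => [l /negbTE li||||]; rewrite ?b'E ?li ?eqxx //; lia.
have exQ' : (exists t : cell r, t \in box_cells a' b) -> exact (box_faces a b) bdry Q.
  move=> ne; apply: (exact_le a' b) => //; apply: IH => //.
  by apply: smaller => [l /negbTE li||||]; rewrite ?a'E ?li ?eqxx //; lia.
have closedP : closed_in (box_faces a b) bdry P.
  move=> [s|] t sE tE //= Ps nPt; apply/eqP/contraT => /bdry_face.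
  by case: t tE nPt => [t|] // tE /= nPt /faceP[_ /(_ i)]; lia.
have closedQ : closed_in (box_faces a b) bdry Q.
  move=> [s|] t sE tE //= Qs nQt; apply/eqP/contraT => /bdry_face.
  by case: t tE nQt => [t|] // tE /= nQt /faceP[_ /(_ i)]; lia.
(* An empty half is set aside, the other one being the whole box: a box without cells leaves the
   empty face alone, which is not exact. *)
case: (pselect (exists t : cell r, t \in box_cells a b')) => [neP|emP]; last first.
  apply: (eq_exact (U := Q)); last first.
    apply: exQ'; exists c; rewrite -QE //.
    have := PorQ (Some c); rewrite mem_box_faces cab PE // => /(_ isT) /orP[] // h.
    by case: emP; exists c.
  move=> t tE; have := PorQ t tE; case: t tE => [t|] // tE.
  rewrite mem_box_faces in tE; rewrite PE // => /orP[h|-> //].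
  by case: emP; exists t.
case: (pselect (exists t : cell r, t \in box_cells a' b)) => [neQ|emQ]; last first.
  apply: (eq_exact (U := P)); last exact: exP'.
  move=> t tE; have := PorQ t tE; case: t tE => [t|] // tE.
  rewrite mem_box_faces in tE; rewrite QE // => /orP[-> //|h].
  by case: emQ; exists t.
apply: (eq_exact (U := predU P Q)); first by move=> t /PorQ.
apply: mayer_vietoris => //; [exact: box_sq0|exact: exP'|exact: exQ'|].
apply: (exact_le a' b') => //; apply: IH.
  by apply: smaller => [l /negbTE li||||]; rewrite ?a'E ?b'E ?li ?eqxx //; lia.
have [t1 /box_cellsP[[x tx] t1le]] := neP; have [t2 /box_cellsP[[y ty] t2le]] := neQ.
have xab : closed_cell (a, b') x.
  by apply: (@cell_le_closed _ _ _ t1 (a, b')) => //; exact: open_closed_cell.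
have yab : closed_cell (a', b) y.
  by apply: (@cell_le_closed _ _ _ t2 (a', b)) => //; exact: open_closed_cell.
have /= [_] := xab.2 i; have /= [yi _] := yab.2 i; move: yi; rewrite a'E b'E eqxx => yi xi.
(* The segment from [x] to [y] crosses the cutting hyperplane, so the intersection of the two halves
   has a cell. *)
have [d [d0 d1 dE]] : exists d : R, [/\ 0 <= d, d <= 1 & x 0 i + d * (y 0 i - x 0 i) = nu%:~R].
  have [e|ne] := eqVneq (x 0 i) (y 0 i).
    exists 0; split=> //; rewrite mul0r addr0; apply/le_anti.
    by rewrite xi /= e yi.
  have p : 0 < y 0 i - x 0 i.
    by rewrite subr_gt0 lt_neqAle ne /=; exact: le_trans xi yi.
  exists ((nu%:~R - x 0 i) / (y 0 i - x 0 i)); split.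
  - by apply: divr_ge0; [rewrite subr_ge0|exact: ltW].
  - by rewrite ler_pdivrMr // mul1r lerD2r.
  - by rewrite divfK ?gt_eqF // addrC subrK.
pose z := x + d *: (y - x).
have zi l : z 0 l = x 0 l + d * (y 0 l - x 0 l) by rewrite !mxE.
have za : affM R alpha z by apply: affM_line; [case: tx|case: ty].
have cz := cell_ofP za; exists (cell_of z); apply/box_cellsP; split; first by exists z.
apply: (@closed_cell_le _ _ _ _ (a', b')) cz _; split=> //= l.
rewrite zi a'E b'E; case: eqP => [->|/eqP/negbTE li]; first by rewrite dE.
have /= := xab.2 l; have /= := yab.2 l; rewrite a'E b'E li => -[y1 y2] [x1 x2].
split; nra.
Qed.

End Complex.
End Boxes.

(** * Coefficients of finitely supported families *)

Lemma eq_sum_support (A : nmodType) (T : eqType) (r1 r2 : seq T) (F : T -> A) :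
  uniq r1 -> uniq r2 -> {in r1, forall x, x \notin r2 -> F x = 0} ->
  {in r2, forall x, x \notin r1 -> F x = 0} ->
  \sum_(x <- r1) F x = \sum_(x <- r2) F x.
Proof.
move=> u1 u2 h1 h2.
have sub (s1 s2 : seq T) : {in s1, forall x, x \notin s2 -> F x = 0} ->
    \sum_(x <- s1) F x = \sum_(x <- s1 | x \in s2) F x.
  move=> h; rewrite (bigID (mem s2)) /= [X in _ + X]big_seq_cond.
  by rewrite [X in _ + X]big1 ?addr0 // => x /andP[? ?]; exact: h.
rewrite (sub r1 r2) // [RHS](sub r2 r1) // -big_filter -[RHS]big_filter.
apply: perm_big; apply: uniq_perm; rewrite ?filter_uniq // => x.
by rewrite !mem_filter andbC.
Qed.

Lemma mcoeff_linext (A : nzRingType) (I J : choiceType) (e : I -> {malg A[J]})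
    (g : {malg A[I]}) t :
  monalg.mcoeff t (linext e g) =
  \sum_(c <- monalg.msupp g) monalg.mcoeff c g * monalg.mcoeff t (e c).
Proof.
by rewrite /linext raddf_sum /=; apply: eq_bigr => c _; rewrite monalg.mcoeffZ.
Qed.

Lemma sum_msupp (A B : zmodType) (I : choiceType) (F : I -> A -> B)
    (g : {malg A[I]}) (r : seq I) : (forall c, F c 0 = 0) -> uniq r ->
  {subset monalg.msupp g <= r} ->
  \sum_(c <- monalg.msupp g) F c (monalg.mcoeff c g) =
  \sum_(c <- r) F c (monalg.mcoeff c g).
Proof.
move=> F0 ur sub; apply: eq_sum_support => // [x /sub -> //|x _ nx].
by rewrite monalg.mcoeff_outdom.
Qed.

Lemma mcoeff_sumU (A : nzRingType) (J : choiceType) (s : seq J) (a : J -> A) t :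
  uniq s -> monalg.mcoeff t (\sum_(u <- s) monalg.mkmalgU u (a u)) =
  if t \in s then a t else 0.
Proof.
move=> us; rewrite raddf_sum /=.
have F0 i : i != t -> monalg.mcoeff t (monalg.mkmalgU i (a i)) = 0.
  by move=> /negbTE it; rewrite monalg.mcoeffU it.
case: (boolP (t \in s)) => ts.
  rewrite (bigD1_seq t) //= monalg.mcoeffUU big1 ?addr0 //.
rewrite big_seq big1 // => i si; apply: F0.
by apply: contraNneq ts => <-.
Qed.

Lemma mcoeff_fsum (A : nzRingType) (J : choiceType) (P : set J) (r : seq J)
    (a : J -> A) t : P `<=` [set` r] ->
  monalg.mcoeff t (\sum_(u \in P) monalg.mkmalgU u (a u)) =
  if `[< P t >] then a t else 0.
Proof.
move=> Pr; rewrite (fsbigE (undup [seq x <- r | `[< P x >]])) ?undup_uniq //.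
- rewrite -big_filter mcoeff_sumU ?filter_uniq ?undup_uniq //.
  rewrite mem_filter mem_undup mem_filter; congr (if _ then _ else _).
  apply/idP/idP => [/andP[] _ /andP[] //|tP]; move/asboolP: (tP) => Pt.
  by rewrite mem_set // tP /=; exact: Pr.
- by move=> x /=; rewrite mem_undup mem_filter => /andP[/asboolP].
- move=> i Pi; rewrite mem_undup mem_filter (Pr i Pi) andbT => /negP.
  by case; apply/asboolP.
Qed.

(** * The complex F in a single Z^r-degree *)

Section Differential.
Variables (R : realType) (X : toric) (k : fieldType) (alpha : 'rV[int]_(nray X)).
Variable eps : cell (nray X) -> cell (nray X) -> int.
Local Notation r := (nray X).
Local Notation cell := (cell r).
Local Notation Dcell := (Dcell R alpha).
Local Notation cell_dim := (cell_dim R alpha).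
Local Notation face := (face R alpha).
Local Notation facet := (facet R alpha).
Local Notation inD := (inD R alpha).

Hypothesis Heps : incidence R alpha (transport alpha eps).

Lemma DcellP i (c : Dcell i) : inD (val c) /\ cell_dim i (val c).
Proof. by apply/asboolP; exact: (valP c). Qed.

Lemma inDP (c : cell) : inD c <-> open_cell R alpha c !=set0 /\ forall i, 0 <= c.1 0 i.
Proof.
split=> [[[b cb] le]|[c0 le]]; split=> //.
- by exists b.
- by move=> i; have := le b cb i; rewrite -floor_ge0; have [_ /(_ i)[-> _]] := cb.
- by move=> b [_ cb] i; rewrite /= -floor_ge0; have [-> _] := cb i.
Qed.

Lemma inD_ge0 (c : cell) : inD c -> forall i, 0 <= c.2 0 i.
Proof.
by move=> /inDP[c0 le] i; have := le i; have /andP[] := open_cell_width c0 i; lia.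
Qed.

Lemma mcoeff_Fbd (A : nzRingType) (h : Cox k X -> A) (h0 : h 0 = 0) i
    (g : {malg A[Dcell i.+1]}) (t : Dcell i) :
  monalg.mcoeff t (Fbd h eps g) = \sum_(c <- monalg.msupp g) monalg.mcoeff c g *
    h (xmon k ((val c).2 - (val t).2) *~ transport alpha eps (val c) (val t)).
Proof.
rewrite mcoeff_linext; apply: eq_bigr => c _; congr (_ * _).
rewrite (@mcoeff_fsum _ _ _ (pmap insub (box_cells R alpha (val c).1 (val c).2))).
  case: asboolP => // nf; rewrite (inc_out Heps) ?mulr0z //.
move=> u /= [fu _]; rewrite mem_pmap; apply/mapP; exists (val u).
  exact/face_box_cells.
by rewrite valK.
Qed.

Local Notation Fmod := (Fmod R k alpha).
Local Notation bdry := (@bdry R X alpha k (transport alpha eps)).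

Definition label (c : cell) : 'X_{1..r} := [multinom `|c.2 0%R i|%N | i < r].

Lemma xmon_label c : xmon k c.2 = 'X_[label c]. Proof. by []. Qed.

Lemma labelE c i : inD c -> (label c i)%:Z = c.2 0 i.
Proof. by move=> /inD_ge0/(_ i) h; rewrite mnmE gez0_abs. Qed.

(* The cells whose labels divide x^m, and the empty face. *)
Definition faces_below (m : 'X_{1..r}) := box_faces R alpha 0 (expo m).

Lemma mem_faces_below m (c : cell) :
  Some c \in faces_below m <-> inD c /\ (label c <= m)%MM.
Proof.
rewrite mem_box_faces; split=> [/box_cellsP[c0 le]|[cD /mnm_lepP le]].
  have cD : inD c by apply/inDP; split=> // i; have [] := le i; rewrite mxE.
  by split=> //; apply/mnm_lepP => i; have [_] := le i; rewrite mxE -labelE // lez_nat.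
have /inDP[c0 ge] := cD; apply/box_cellsP; split=> // i.
by rewrite !mxE -(labelE i cD) lez_nat.
Qed.

Definition gcoef i (g : Fmod i) (c : cell) : Cox k X :=
  if insub c is Some d then monalg.mcoeff d g else 0.

(* The part of g of degree x^m, as a chain on the cells with label below x^m.  *)
Definition chain i (g : Fmod i) m (t : option cell) : k :=
  if t is Some c then
    if (label c <= m)%MM then (gcoef g c)@_(m - label c) else 0
  else 0.

Lemma gcoef_val i (g : Fmod i) d : gcoef g (val d) = monalg.mcoeff d g.
Proof. by rewrite /gcoef valK. Qed.

Lemma gcoef_neq0 i (g : Fmod i) c : gcoef g c != 0 ->
  exists2 d : Dcell i, d \in monalg.msupp g & c = val d.
Proof.
rewrite /gcoef; case: insubP => [d _ <-|]; last by rewrite eqxx.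
by rewrite monalg.mcoeff_neq0; exists d.
Qed.

Lemma chain_neq0 i (g : Fmod i) m t : chain g m t != 0 ->
  exists2 d : Dcell i, d \in monalg.msupp g &
    t = Some (val d) /\ (label (val d) <= m)%MM.
Proof.
case: t => [c|] /=; last by rewrite eqxx.
case: ifP => [le|]; last by rewrite eqxx.
move=> h; have [|d dg cE] := @gcoef_neq0 i g c; last by exists d; rewrite -?cE.
by apply: contra_neq h => ->; rewrite mcoeff0.
Qed.

Lemma chain_ext i (g h : Fmod i) :
  (forall m t, t \in faces_below m -> chain g m t = chain h m t) -> g = h.
Proof.
move=> gh; apply/monalg.malgP => d; apply/mpolyP => n.
have := gh (label (val d) + n)%MM (Some (val d)); rewrite /chain lem_addr !gcoef_val.
rewrite addmC addmK => -> //.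
by apply/mem_faces_below; split; [exact: (DcellP d).1|exact: lem_addl].
Qed.

Lemma mcoeffMX_eq0 (p : Cox k X) u n : ~~ (u <= n)%MM -> (p * 'X_[u])@_n = 0.
Proof.
move=> h; apply/eqP/contraT; rewrite -mcoeff_msupp (perm_mem (msuppMX _ _)).
by move=> /mapP[m' _ e]; rewrite e lem_addr in h.
Qed.

Lemma face_label c d : inD c -> inD d -> face c d -> (label d <= label c)%MM.
Proof.
move=> cD dD /faceP[_ le]; apply/mnm_lepP => i.
by rewrite -lez_nat !labelE //; have [] := le i.
Qed.

Lemma face_inD c d : inD c -> face c d -> inD d.
Proof.
move=> /inDP[c0 ge] /faceP[d0 le]; apply/inDP; split=> // i.
by have [h _] := le i; exact: le_trans h.
Qed.

Lemma xmon_ratio c d : inD c -> inD d -> face c d ->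
  xmon k (c.2 - d.2) = 'X_[label c - label d].
Proof.
move=> cD dD cd; rewrite /xmon; congr 'X_[_]; apply/mnmP => i.
rewrite mnmBE mnmE !mxE -!labelE //.
by have /mnm_lepP/(_ i) := face_label cD dD cd; lia.
Qed.

Lemma mcoeff_ratio (p : Cox k X) c d (z : int) m : inD c -> inD d -> face c d ->
  (label d <= m)%MM ->
  (p * (xmon k (c.2 - d.2) *~ z))@_(m - label d) =
  (if (label c <= m)%MM then p@_(m - label c) else 0) * z%:~R.
Proof.
move=> cD dD cd dm; have dc := face_label cD dD cd.
rewrite mulrzAr raddfMz /= -mulrzr xmon_ratio //; congr (_ * _).
case: ifP => cm; last first.
  rewrite mcoeffMX_eq0 //; apply: contraFN cm => /mnm_lepP h; apply/mnm_lepP => i.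
  have := h i; rewrite !mnmBE; have /mnm_lepP/(_ i) := dc; have /mnm_lepP/(_ i) := dm; lia.
rewrite -[RHS](mcoeffMX p (label c - label d)); congr (_@__); apply/mnmP => i.
rewrite mnmDE !mnmBE; have /mnm_lepP/(_ i) := dc; have /mnm_lepP/(_ i) := cm; lia.
Qed.

Lemma facet_inc c d : transport alpha eps c d != 0 -> facet c d.
Proof. by move=> h; apply: contrapT => /(inc_out Heps) e; rewrite e eqxx in h. Qed.

Lemma bdry_neq0 (c d : cell) : bdry (Some c) (Some d) != 0 -> facet c d.
Proof.
move=> h; apply: facet_inc; apply: contra_neq h => /= e.
by rewrite [X in X%:~R]e.
Qed.

Lemma facet_dim c d i : facet c d -> cell_dim i.+1 c <-> cell_dim i d.
Proof.
move=> [_ [j [/cell_dimP[c0 cj] /cell_dimP[d0 dj]]]].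
split=> /cell_dimP[_]; rewrite ?cj ?dj => e; apply/cell_dimP; split=> //.
  by rewrite dj; case: e.
by rewrite cj e.
Qed.

(** The ratios of labels in the differential are absorbed by the indexing with [m - label], which
    leaves only the signs. *)
Lemma chain_Fd i (g : Fmod i.+1) m t : t \in faces_below m ->
  chain (Fd eps g) m t = \sum_(s <- faces_below m) chain g m s * bdry s t.
Proof.
have zero : (forall c : Dcell i.+1, bdry (Some (val c)) t != 0 -> False) ->
    \sum_(s <- faces_below m) chain g m s * bdry s t = 0.
  move=> h; rewrite big1 // => s _; apply/eqP/contraT; rewrite mulf_eq0 negb_or.
  by move=> /andP[/chain_neq0[c _ [-> _]] /h].
case: t zero => [d|] zero; last first.
  move=> _; rewrite zero // => c; have [_ /cell_dim_rank rc] := DcellP c.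
  by rewrite /=; case: asboolP => [/cell_dim_rank|]; rewrite ?rc ?eqxx.
move=> /mem_faces_below[dD dm]; rewrite {1}/chain dm.
case: (pselect (cell_dim i d)) => [di|ndi]; last first.
  rewrite /gcoef insubF ?mcoeff0; last by apply/asboolP => -[].
  rewrite zero // => c /bdry_neq0 f; apply: ndi; apply/(facet_dim i f).
  exact: (DcellP c).2.
have dP : `[< inD d /\ cell_dim i d >] by apply/asboolP.
pose d' : Dcell i := Sub d dP; have dE : d = val d' by [].
rewrite [in gcoef _ _]dE gcoef_val mcoeff_Fbd // raddf_sum /=.
under eq_bigr => c _.
  have -> : (monalg.mcoeff c g *
      (xmon k ((val c).2 - d.2) *~ transport alpha eps (val c) d))@_(m - label d)
     = chain g m (Some (val c)) * bdry (Some (val c)) (Some d).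
    case: (pselect (facet (val c) d)) => [f|nf].
      by rewrite mcoeff_ratio //; [rewrite /chain gcoef_val|exact: (DcellP c).1|case: f].
    by rewrite /= (inc_out Heps nf) mulr0z !mulr0 mcoeff0.
  over.
rewrite -(big_map (fun c : Dcell i.+1 => Some (val c)) xpredT
  (fun s => chain g m s * bdry s (Some d))).
apply: eq_sum_support.
- by rewrite map_inj_uniq ?fset_uniq // => x y [/val_inj].
- exact: box_faces_uniq.
- move=> s /mapP[c _ ->] nE; rewrite /chain; case: ifP => // cm; last by rewrite /= ?mul0r ?mulr0.
  by move/negP: nE; case; apply/mem_faces_below; split=> //; exact: (DcellP c).1.
- move=> s _ ns; apply/eqP/contraT; rewrite mulf_eq0 negb_or.
  move=> /andP[/chain_neq0[c cg [e _]] _]; move/negP: ns; case; apply/mapP.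
  by exists c.
Qed.

(** Values prescribed in finitely many degrees [Ms] come from one element of the free module: the
    value at a cell in degree [m] becomes a multiple of the monomial [m - label] on that cell. *)
Lemma chain_exists i (b : 'X_{1..r} -> option cell -> k) (Ms : seq 'X_{1..r}) :
  exists h : Fmod i, forall m t, t \in faces_below m ->
  chain h m t = if t is Some c then
    if (m \in Ms) && `[< cell_dim i c >] then b m (Some c) else 0 else 0.
Proof.
pose cells m : seq (Dcell i) := pmap insub (box_cells R alpha 0 (expo m)).
pose mon m (d : Dcell i) : Cox k X := b m (Some (val d)) *: 'X_[m - label (val d)].
exists (\sum_(m <- undup Ms) \sum_(d <- cells m) monalg.mkmalgU d (mon m d)) => m0 [c|] //.
move=> /mem_faces_below[cD cm]; rewrite /chain cm /gcoef.
case: insubP => [d dP dE|ndP]; last first.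
  rewrite mcoeff0 ifF //; apply: contraNF ndP => /andP[_ /asboolP ci].
  by apply/asboolP.
have [_ di] := DcellP d; rewrite dE in di.
rewrite (asboolT di) andbT raddf_sum /= raddf_sum /=.
have cellE m : (d \in cells m) = (label c <= m)%MM.
  rewrite mem_pmap; apply/mapP/idP => [[c' c'm /esym]|le].
    case: insubP => // d' _ d'E [e]; move: c'm; rewrite -d'E e dE -mem_box_faces.
    by move=> /mem_faces_below[].
  exists c; last by rewrite -dE valK.
  by rewrite -mem_box_faces; apply/mem_faces_below.
have cellU m : uniq (cells m).
  by apply: pmap_uniq (undup_uniq _); exact: insubK.
have inner m : (monalg.mcoeff d (\sum_(d' <- cells m) monalg.mkmalgU d' (mon m d')))@_(m0 - label c)
    = if m == m0 then b m (Some c) else 0.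
  rewrite mcoeff_sumU // cellE; case: ifPn => le; last first.
    by rewrite mcoeff0; case: eqP => // e; rewrite e cm in le.
  rewrite /mon dE mcoeffZ mcoeffX.
  have -> : (m - label c == m0 - label c)%MM = (m == m0).
    apply/eqP/eqP => [e|-> //]; rewrite -(submK le) -(submK cm) e //.
  by case: eqP; rewrite ?mulr1 ?mulr0.
under eq_bigr do rewrite inner.
case: (boolP (m0 \in Ms)) => mM.
  rewrite (bigD1_seq m0) ?mem_undup ?undup_uniq //= eqxx big1 ?addr0 //.
  by move=> m /negbTE ->.
rewrite big_seq big1 // => m; rewrite mem_undup; case: eqP => // ->.
by rewrite (negbTE mM).
Qed.

(** Each degree is filled by [exact_box]; then only the cells of dimension [i.+1] and the degrees
    where [g] is nonzero are kept. As the boundary lowers dimensions by one, the cells left out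
    contribute nothing in dimension [i]. *)
Lemma lift_cycle i (g : Fmod i) :
  (forall m t, t \in faces_below m ->
     \sum_(s <- faces_below m) chain g m s * bdry s t = 0) ->
  exists h : Fmod i.+1, Fd eps h = g.
Proof.
move=> cyc.
have ex m : exists b : option cell -> k, forall t, t \in faces_below m ->
    \sum_(s <- faces_below m) b s * bdry s t = chain g m t.
  (* Without a cell below x^m only the empty face is left, where [chain] is zero, so the zero chain
     will do. *)
  case: (pselect (exists c : cell, c \in box_cells R alpha 0 (expo m))) => [ne|em].
    have [|b hb] := @exact_box R X alpha k _ Heps 0 (expo m) ne (chain g m).
      by move=> t tE _; exact: cyc.
    by exists b => t tE; exact: hb.
  exists (fun _ => 0) => t tE; rewrite big1; last by move=> s _; rewrite mul0r.
  case: t tE => [t|] //; rewrite mem_box_faces => tE; case: em; by exists t.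
have [b hb] := choice ex.
pose Ms := [seq (label (val cn.1) + cn.2)%MM | cn <-
  [seq (c, n) | c <- (monalg.msupp g : seq _), n <- msupp (monalg.mcoeff c g)]].
have gMs m t : chain g m t != 0 -> m \in Ms.
  move=> h; have [c cg [tE le]] := chain_neq0 h; move: h.
  rewrite tE /chain le gcoef_val -mcoeff_msupp => mg.
  apply/mapP; exists (c, (m - label (val c))%MM); last by rewrite addmC submK.
  by apply/allpairsPdep; exists c, (m - label (val c))%MM.
have [h hh] := chain_exists i.+1 b Ms.
exists h; apply: chain_ext => m t tE; rewrite chain_Fd //.
case: (boolP (m \in Ms)) => mM; last first.
  rewrite big_seq big1; last first.
    by move=> s sE; rewrite hh // (negbTE mM); case: s sE => [s|] _; exact: mul0r.
  by apply/esym/eqP/contraT => /gMs; rewrite (negbTE mM).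
case: t tE => [t|] tE; last first.
  rewrite big_seq big1 // => s sE; rewrite hh // mM; case: s sE => [s|] sE; last exact: mul0r.
  rewrite andTb.
  case: asboolP => [/cell_dim_rank si|]; last by rewrite /= ?mul0r ?mulr0.
  by rewrite /=; case: asboolP => [/cell_dim_rank|]; rewrite ?si ?mulr0.
case: (pselect (cell_dim i t)) => [ti|nti]; last first.
  rewrite [RHS](_ : _ = 0); last first.
    apply/eqP/contraT => /chain_neq0[c _ [[e] _]]; case: nti; rewrite e.
    exact: (DcellP c).2.
  rewrite big_seq big1 // => s sE; rewrite hh // mM; case: s sE => [s|] sE; last exact: mul0r.
  rewrite andTb.
  case: asboolP => [si|]; last by rewrite /= ?mul0r ?mulr0.
  apply/eqP/contraT; rewrite mulf_eq0 negb_or => /andP[_ /bdry_neq0 f].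
  by case: nti; apply/(facet_dim i f).
rewrite -hb //; apply: eq_big_seq => s sE; rewrite hh // mM.
case: s sE => [s|] sE; last by rewrite mul0r mulr0.
rewrite andTb.
case: asboolP => // nsi; rewrite mul0r; apply/esym/eqP/contraT.
rewrite mulf_eq0 negb_or => /andP[_ /bdry_neq0 f].
by case: nsi; apply/(facet_dim i f).
Qed.

Lemma sq0_below m : sq0 (faces_below m) bdry xpredT.
Proof. exact: box_sq0. Qed.

Lemma Fd_Fd i (g : Fmod i.+2) : Fd eps (Fd eps g) = 0.
Proof.
apply: chain_ext => m t tE; rewrite chain_Fd //.
rewrite [RHS](_ : _ = 0); last first.
  by apply/eqP/contraT => /chain_neq0[c]; rewrite monalg.msupp0.
rewrite -[RHS](sq0_bd (chain g m) (@sq0_below m) tE isT).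
by apply: eq_big_seq => s sE; rewrite chain_Fd.
Qed.

Lemma Fd_exact i (g : Fmod i.+1) : Fd eps g = 0 -> exists h : Fmod i.+2, Fd eps h = g.
Proof.
move=> g0; apply: lift_cycle => m t tE; rewrite -chain_Fd // g0.
by apply/eqP/contraT => /chain_neq0[c]; rewrite monalg.msupp0.
Qed.

End Differential.

(** * Degrees in the Cox ring *)

Section Degrees.
Variables (k : fieldType) (X : toric).
Local Notation r := (nray X).
Implicit Types (a b e : 'rV[int]_r) (p q : Cox k X).

Lemma same_deg_refl a : same_deg a a.
Proof. by exists 0; rewrite subrr /Mincl mul0mx. Qed.

Lemma same_deg_sym a b : same_deg a b -> same_deg b a.
Proof. by move=> [m e]; exists (- m); rewrite /Mincl mulNmx -[_ *m _]e opprB. Qed.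

Lemma same_deg_trans a b e : same_deg a b -> same_deg b e -> same_deg a e.
Proof.
move=> [m h] [m' h']; exists (m + m').
by rewrite /Mincl mulmxDl -[m *m _]h -[m' *m _]h' addrA subrK.
Qed.

Lemma same_degD a b e e' : same_deg a b -> same_deg e e' -> same_deg (a + e) (b + e').
Proof.
move=> [m h] [m' h']; exists (m + m').
by rewrite /Mincl mulmxDl -[m *m _]h -[m' *m _]h' opprD addrACA.
Qed.

Lemma in_deg0 a : in_deg a (0 : Cox k X).
Proof. by move=> m; rewrite msupp0. Qed.

Lemma in_degD a p q : in_deg a p -> in_deg a q -> in_deg a (p + q).
Proof. by move=> hp hq m /msuppD_le; rewrite mem_cat => /orP[/hp|/hq]. Qed.

Lemma in_degMz a p z : in_deg a p -> in_deg a (p *~ z).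
Proof.
move=> hp m; rewrite mcoeff_msupp raddfMz /= => h; apply: hp.
by rewrite mcoeff_msupp; apply: contra_neq h => ->; rewrite mul0rz.
Qed.

Lemma in_deg_sum (I : eqType) (s : seq I) (F : I -> Cox k X) a :
  {in s, forall i, in_deg a (F i)} -> in_deg a (\sum_(i <- s) F i).
Proof.
move=> h; rewrite big_seq; apply: (big_ind (in_deg a)); [exact: in_deg0|exact: in_degD|exact: h].
Qed.

Lemma in_degW a b p : same_deg a b -> in_deg a p -> in_deg b p.
Proof. by move=> ab h m /h ma; exact: same_deg_trans ma ab. Qed.

Lemma expoD n (m m' : 'X_{1..n}) : expo (m + m')%MM = expo m + expo m'.
Proof. by apply/rowP => i; rewrite !mxE mnmDE PoszD. Qed.

Lemma in_degM a b p q : in_deg a p -> in_deg b q -> in_deg (a + b) (p * q).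
Proof.
move=> hp hq m /msuppM_le /allpairsP[[m1 m2] /= [/hp h1 /hq h2 ->]].
by rewrite expoD; exact: same_degD.
Qed.

Lemma in_deg_xmon e : (forall i, 0 <= e 0 i) -> in_deg e (xmon k e).
Proof.
move=> e0 m; rewrite msuppX inE => /eqP ->.
rewrite (_ : expo _ = e); first exact: same_deg_refl.
by apply/rowP => i; rewrite mxE mnmE gez0_abs.
Qed.

Lemma xmonD e e' : (forall i, 0 <= e 0 i) -> (forall i, 0 <= e' 0 i) ->
  xmon k (e + e') = xmon k e * xmon k e'.
Proof.
move=> h h'; rewrite -mpolyXD; congr 'X_[_]; apply/mnmP => i.
rewrite mnmDE !mnmE mxE; have := h i; have := h' i.
by move: (e 0 i) (e' 0 i) => x y; lia.
Qed.

End Degrees.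

(** * The augmentation onto the truncation ideal *)

Section Augmentation.
Variables (R : realType) (X : toric) (k : fieldType) (alpha : 'rV[int]_(nray X)).
Variable eps : cell (nray X) -> cell (nray X) -> int.
Local Notation r := (nray X).
Local Notation cell := (cell r).
Local Notation Dcell := (Dcell R alpha).
Local Notation cell_dim := (cell_dim R alpha).
Local Notation face := (face R alpha).
Local Notation facet := (facet R alpha).
Local Notation inD := (inD R alpha).
Local Notation Fmod := (Fmod R k alpha).
Local Notation bdry := (@bdry R X alpha k (transport alpha eps)).
Local Notation faces_below := (faces_below R alpha).

Hypothesis Heps : incidence R alpha (transport alpha eps).

Lemma Fd_deg i b (g : Fmod i.+1) : Fin_deg b g -> Fin_deg b (Fd eps g).
Proof.
move=> hg d; rewrite mcoeff_Fbd //; apply: in_deg_sum => c _.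
have [f|nf] := pselect (facet (val c) (val d)); last first.
  by rewrite (inc_out Heps nf) mulr0z mulr0; exact: in_deg0.
have -> : b + Fdeg d = (b + Fdeg c) + ((val c).2 - (val d).2).
  by rewrite /Fdeg addrA subrK.
apply: in_degM; [exact: hg|apply/in_degMz/in_deg_xmon => i'].
by have [/faceP[_ /(_ i')[_ h]] _] := f; rewrite !mxE subr_ge0.
Qed.

Definition augmentation (g : Fmod 0) : Cox k X :=
  \sum_(c <- monalg.msupp g) monalg.mcoeff c g * xmon k (val c).2.

Lemma augmentationE (g : Fmod 0) (s : seq (Dcell 0)) : uniq s ->
  {subset monalg.msupp g <= s} ->
  augmentation g = \sum_(c <- s) monalg.mcoeff c g * xmon k (val c).2.
Proof.
move=> us sub.
apply: (sum_msupp (F := fun (c : Dcell 0) (p : Cox k X) => p * xmon k (val c).2)) => //.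
by move=> c; rewrite mul0r.
Qed.

Lemma augmentation_linear : scalar augmentation.
Proof.
move=> a u v; pose s : seq (Dcell 0) := undup (monalg.msupp u ++ monalg.msupp v).
have us : uniq s := undup_uniq _.
rewrite (augmentationE us) ?(@augmentationE u s) ?(@augmentationE v s) //; last 3 first.
- by move=> c; rewrite mem_undup mem_cat => ->; rewrite orbT.
- by move=> c; rewrite mem_undup mem_cat => ->.
- move=> c; rewrite -monalg.mcoeff_neq0 monalg.mcoeffD monalg.mcoeffZ mem_undup mem_cat => h.
  rewrite -!monalg.mcoeff_neq0; apply/contraT; rewrite negb_or !negbK => /andP[/eqP e1 /eqP e2].
  by rewrite e1 e2 mulr0 addr0 eqxx in h.
rewrite mulr_sumr -big_split /=; apply: eq_bigr => c _.
by rewrite monalg.mcoeffD monalg.mcoeffZ mulrDl mulrA.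
Qed.

HB.instance Definition _ :=
  GRing.isLinear.Build (Cox k X) (Fmod 0) (Cox k X) *%R augmentation augmentation_linear.

Lemma augmentation_deg b (g : Fmod 0) : Fin_deg b g -> in_deg b (augmentation g).
Proof.
move=> hg; apply: in_deg_sum => c _.
have -> : b = b + Fdeg c + (val c).2 by rewrite subrK.
by apply: in_degM; [exact: hg|apply/in_deg_xmon/inD_ge0; exact: (DcellP c).1].
Qed.

(** In each degree the augmentation is the boundary towards the empty face, where vertices have
    coefficient 1. *)
Lemma mcoeff_augmentation (g : Fmod 0) m :
  (augmentation g)@_m = \sum_(s <- faces_below m) chain g m s * bdry s None.
Proof.
rewrite /augmentation raddf_sum /=.
under eq_bigr => c _.
  have -> : (monalg.mcoeff c g * xmon k (val c).2)@_m =
      chain g m (Some (val c)) * bdry (Some (val c)) None.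
    rewrite /chain gcoef_val [bdry _ _](_ : _ = 1) ?mulr1; last first.
      by rewrite /= (asboolT (DcellP c).2).
    rewrite xmon_label; case: ifPn => le; last exact: mcoeffMX_eq0.
    by rewrite -[in LHS](submK le) addmC mcoeffMX.
  over.
rewrite -(big_map (fun c : Dcell 0 => Some (val c)) xpredT (fun s => chain g m s * bdry s None)).
apply: eq_sum_support.
- by rewrite map_inj_uniq ?fset_uniq // => x y [/val_inj].
- exact: box_faces_uniq.
- move=> s /mapP[c _ ->] nE; rewrite /chain; case: ifP => // cm; last by rewrite mul0r.
  by move/negP: nE; case; apply/mem_faces_below; split=> //; exact: (DcellP c).1.
- move=> s _ ns; apply/eqP/contraT; rewrite mulf_eq0 negb_or.
  move=> /andP[/chain_neq0[c cg [e _]] _]; move/negP: ns; case; apply/mapP.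
  by exists c.
Qed.

(** Exactness at the vertices: the only cycle condition there is the one at the empty face. *)
Lemma augmentation_ker (g : Fmod 0) : augmentation g = 0 <->
  exists h : Fmod 1, Fd eps h = g.
Proof.
split=> [g0|[h <-]].
  apply: lift_cycle => // m [d|] tE; last first.
    by rewrite -mcoeff_augmentation g0 mcoeff0.
  rewrite big1 // => s _; apply/eqP/contraT; rewrite mulf_eq0 negb_or.
  move=> /andP[/chain_neq0[c _ [-> _]] /(bdry_neq0 Heps)[_ [i [hi _]]]].
  by have /cell_dim_rank := (DcellP c).2; rewrite (cell_dim_rank hi).
apply/mpolyP => m; rewrite mcoeff0 mcoeff_augmentation.
have NE : None \in faces_below m by rewrite mem_head.
rewrite -[RHS](sq0_bd (chain h m) (@sq0_below R X k alpha eps Heps m) NE isT).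
by apply: eq_big_seq => s sE; rewrite chain_Fd.
Qed.

(* Exactness of the augmented complex of the closed cell at the empty face. *)
Lemma vertex_below (c : cell) : inD c -> exists2 v : Dcell 0, True & face c (val v).
Proof.
move=> cD; have /inDP[c0 _] := cD.
have [|b hb] := @exact_closed_cell R X alpha k _ Heps c c0 (fun t => (t == None)%:R).
  move=> t tE _; rewrite big1 // => -[s|] _; [exact: mul0r|exact: mulr0].
have := hb None (mem_head _ _) isT; rewrite eqxx => h.
have [s sE ns] : exists2 s, s \in box_faces R alpha c.1 c.2 & bdry s None != 0.
  apply: contrapT => /forall2NP no; move: h; rewrite big_seq big1 => [/esym /eqP|s sE].
    by rewrite oner_eq0.
  by have [//|/negP] := no s; rewrite negbK => /eqP ->; rewrite mulr0.
case: s sE ns => [v|] vE; last by rewrite eqxx.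
rewrite /=; case: asboolP => [v0 _|]; last by rewrite eqxx.
rewrite mem_box_faces in vE; have cv := (face_box_cells R alpha c v).2 vE.
have vP : `[< inD v /\ cell_dim 0 v >] by apply/asboolP; split=> //; exact: face_inD cv.
by exists (Sub v vP).
Qed.

(** Every cell has a vertex, whose label divides its own, so the labels of the vertices generate the
    ideal. *)
Lemma range_augmentation : range augmentation = trunc R k alpha.
Proof.
apply/seteqP; split=> [f [g _ <-]|f [s [sD ->]]].
  exists [seq (monalg.mcoeff c g, val c) | c <- (monalg.msupp g : seq _)]; split.
    by move=> p /mapP[c _ ->]; exact: (DcellP c).1.
  by rewrite big_map.
elim: s sD => [|[p c] s IH] sD.
  by exists 0 => //; rewrite big_nil; exact: (linear0 augmentation).
have [|g _ gE] := IH; first by move=> q qs; apply: sD; rewrite inE qs orbT.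
have cD : inD c by apply: (sD (p, c)); rewrite mem_head.
have [v _ cv] := vertex_below cD.
exists (monalg.mkmalgU v (p * xmon k (c.2 - (val v).2)) + g) => //.
rewrite (linearD augmentation) big_cons /= gE; congr (_ + _).
rewrite (@augmentationE _ [:: v]) //; last first.
  move=> u; rewrite inE -monalg.mcoeff_neq0; apply: contraR => uv.
  by rewrite monalg.mcoeffU [v == u]eq_sym (negbTE uv).
have vD := (DcellP v).1.
rewrite big_seq1 monalg.mcoeffUU -mulrA -xmonD ?subrK // => i.
  by have /faceP[_ /(_ i)[_ h]] := cv; rewrite !mxE subr_ge0.
exact: (inD_ge0 vD).
Qed.

Lemma Fmod_length i : (tdim X < i)%N -> forall g : Fmod i, g = 0.
Proof.
move=> lt g; apply/monalg.malgP => c; have /cell_dim_le := (DcellP c).2.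
by rewrite leqNgt lt.
Qed.

End Augmentation.

(** * The labeled complex D *)

Section Translation.
Variables (R : realType) (X : toric).
Local Notation r := (nray X).
Local Notation cell := (cell r).
Implicit Types (beta e : 'rV[int]_r) (c s t : cell).

Lemma shiftK e : cancel (shift e) (shift (- e)).
Proof. by move=> [f c]; rewrite /shift /= !addrK. Qed.

Lemma shiftNK e : cancel (shift (- e)) (shift e).
Proof. by move=> [f c]; rewrite /shift /= !subrK. Qed.

Lemma affM_shift beta e b :
  affM R (beta + e) (b + map_mx intr e) <-> affM R beta b.
Proof.
split=> -[m bE]; exists m; last by rewrite bE map_mxD addrAC.
by apply: (addIr (map_mx intr e)); rewrite bE map_mxD addrAC.
Qed.

Lemma open_cell_shift beta e c b :
  open_cell R (beta + e) (shift e c) (b + map_mx intr e) <-> open_cell R beta c b.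
Proof.
have fl i : Num.floor ((b + map_mx intr e) 0 i) = Num.floor (b 0 i) + e 0 i.
  by rewrite !mxE floorDrz ?intr_int // intrKfloor.
have cl i : Num.ceil ((b + map_mx intr e) 0 i) = Num.ceil (b 0 i) + e 0 i.
  by rewrite !mxE ceilDrz ?intr_int // intrKceil.
rewrite /open_cell /=; split=> -[/affM_shift ab hb]; split=> // i; have := hb i.
  by rewrite fl cl !mxE => -[/addIr -> /addIr ->].
by rewrite fl cl !mxE => -[-> ->].
Qed.

Lemma open_cell_shift_ne beta e c :
  open_cell R (beta + e) (shift e c) !=set0 <-> open_cell R beta c !=set0.
Proof.
split=> -[b cb]; last by exists (b + map_mx intr e); apply/open_cell_shift.
exists (b - map_mx intr e); apply/(open_cell_shift beta e); by rewrite subrK.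
Qed.

Lemma face_shift beta e s t :
  face R (beta + e) (shift e s) (shift e t) <-> face R beta s t.
Proof.
rewrite !faceP open_cell_shift_ne; split=> -[t0 le]; split=> // i; have := le i;
  by rewrite !mxE !lerD2r.
Qed.

Lemma dirs_shift e c : dirs R (shift e c) = dirs R c.
Proof.
rewrite /dirs /fixed_coords; congr (_ :&: kermx (diag_mx _))%MS.
by apply/rowP => i; rewrite !mxE (inj_eq (addIr _)).
Qed.

Lemma cell_dim_shift beta e i c :
  cell_dim R (beta + e) i (shift e c) <-> cell_dim R beta i c.
Proof. by rewrite !cell_dimP dirs_shift open_cell_shift_ne. Qed.

Lemma facet_shift beta e s t :
  facet R (beta + e) (shift e s) (shift e t) <-> facet R beta s t.
Proof.
by split=> -[/face_shift f [i [/cell_dim_shift ds /cell_dim_shift dt]]]; split=> //; exists i.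
Qed.

Lemma affM_Mincl beta m : affM R (beta + Mincl m) = affM R beta.
Proof.
have e : map_mx intr (beta + Mincl m) =
    map_mx intr beta + map_mx intr m *m (map_mx intr (ray X))^T :> 'rV[R]_r.
  by rewrite map_mxD; congr (_ + _); rewrite map_mxM map_trmx.
apply/seteqP; split=> b [m' ->].
  by exists (map_mx intr m + m'); rewrite e mulmxDl addrA.
exists (m' - map_mx intr m); rewrite e mulmxBl.
by rewrite -addrA; congr (_ + _); rewrite addrC subrK.
Qed.

Lemma cell_dim_Mincl beta m i c : cell_dim R (beta + Mincl m) i c = cell_dim R beta i c.
Proof. by rewrite /cell_dim /open_cell affM_Mincl. Qed.

Lemma facet_Mincl beta m s t : facet R (beta + Mincl m) s t = facet R beta s t.
Proof.
by rewrite /facet /face /cell_dim /open_cell /closed_cell affM_Mincl.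
Qed.

Lemma incidence_transport alpha (eps : cell -> cell -> int) :
  incidence R 0 eps -> incidence R alpha (transport alpha eps).
Proof.
have dimE i s : cell_dim R 0 i (shift (- alpha) s) <-> cell_dim R alpha i s.
  by rewrite -(cell_dim_shift alpha (- alpha)) subrr.
have facetE s t : facet R 0 (shift (- alpha) s) (shift (- alpha) t) <-> facet R alpha s t.
  by rewrite -(facet_shift alpha (- alpha)) subrr.
have neq t1 t2 : t1 <> t2 -> shift (- alpha) t1 <> shift (- alpha) t2.
  by move=> h /(can_inj (shiftNK alpha)).
move=> [h1 h2 h3 h4]; split=> [s t|s t|s t1 t2|s t1 t2 w].
- by move=> /facetE; exact: h1.
- by move=> nf; apply: h2 => /facetE.
- by move=> /dimE s1 /neq t12 /facetE f1 /facetE f2; exact: h3.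
- by move=> /neq t12 /facetE f1 /facetE f2 /facetE f3 /facetE f4; exact: h4.
Qed.

End Translation.

(** * The polytope, its cells and its integral points *)

Section Polytope.
Variables (R : realType) (X : toric) (HX : smooth_projective R X).
Local Notation r := (nray X).
Local Notation n := (tdim X).
Local Notation cell := (cell r).
Variable alpha : 'rV[int]_r.
Local Notation open_cell := (open_cell R alpha).
Local Notation closed_cell := (closed_cell R alpha).
Local Notation face := (face R alpha).
Local Notation inD := (inD R alpha).
Local Notation Mpolytope := (Mpolytope R alpha).
Implicit Types c s t : cell.

(** By completeness each [- u_i] is a nonnegative combination of rays, and on the polytope the
    pairings with the rays are bounded below by [- alpha]; this bounds the pairing with [u_i] from
    above. *)
Lemma Mpolytope_bounded : exists B : R, forall b, Mpolytope b -> forall i, b 0 i <= B.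
Proof.
have bound (i : 'I_r) : exists B : R, forall b, Mpolytope b -> b 0 i <= B.
  have : [set: 'rV[R]_n] (- row i (rayR R X)) by [].
  rewrite -(sp_complete HX) => -[s _ [t [t0 _ tE]]].
  exists ((alpha 0 i)%:~R + \sum_j t j * (alpha 0 j)%:~R) => b [[m bE] b0].
  have pair j : (m *m (row j (rayR R X))^T) 0 0 = b 0 j - (alpha 0 j)%:~R.
    rewrite bE -[map_mx _ (ray X)]/(rayR R X) !mxE addrAC subrr add0r.
    by apply: eq_bigr => l _; rewrite !mxE.
  have : (m *m (- row i (rayR R X))^T) 0 0 = \sum_j t j * (b 0 j - (alpha 0 j)%:~R).
    rewrite tE raddf_sum /= mulmx_sumr summxE; apply: eq_bigr => j _.
    by rewrite -pair linearZ /= -scalemxAr mxE.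
  rewrite raddfN mulmxN mxE pair => e.
  have : 0 <= \sum_j t j * b 0 j by apply: sumr_ge0 => j _; rewrite mulr_ge0.
  have : \sum_j t j * (b 0 j - (alpha 0 j)%:~R) = \sum_j t j * b 0 j - \sum_j t j * (alpha 0 j)%:~R.
    by rewrite -sumrB; apply: eq_bigr => j _; rewrite mulrBr.
  lra.
have [B hB] := choice bound.
exists (\sum_i `|B i|) => b bP i; apply: le_trans (hB i b bP) _.
rewrite (bigD1 i) //=; apply: le_trans (ler_norm _) _.
by rewrite lerDl sumr_ge0.
Qed.

Lemma cell_of_inD b : Mpolytope b -> inD (cell_of b).
Proof.
move=> [ab b0]; apply/inDP; split; first by exists b; exact: cell_ofP.
by move=> i; rewrite mxE floor_ge0.
Qed.

Lemma labeled_cell_complex : labeled_cell_complex_on R alpha Mpolytope.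
Proof.
split.
- have [B hB] := Mpolytope_bounded.
  apply: (@sub_finite_set _ _ [set` box_cells R alpha 0 (const_mx (Num.ceil B))]) => // c cD.
  have /inDP[c0 ge] := cD; apply/box_cellsP; split=> // i; rewrite !mxE; split=> //.
  have [b cb] := c0; have [ab hb] := cb; have [_ <-] := hb i.
  by apply: le_ceil; apply: hB; split=> //; case: cD => _; apply.
- by move=> c /inDP[c0 _]; exists (\rank (dirs R c)); exact: rank_cell_dim.
- apply/seteqP; split=> [b [c [c0 sub] cb]|b bP].
    by split; [case: cb|exact: sub].
  by exists (cell_of b); [exact: cell_of_inD|apply: cell_ofP; case: bP].
- by move=> c c' _ _ [b [/open_cell_of -> /open_cell_of ->]].
- move=> c cD; apply/seteqP; split=> [b bc|b [t [tD [_ ct]] tb]]; last exact: ct.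
  have cb := cell_ofP bc.1.
  have ct : face c (cell_of b).
    by apply/faceP; split; [exists b|exact: closed_cell_le cb bc].
  by exists (cell_of b) => //; split=> //; exact: face_inD ct.
- move=> c c' cD c'D [x [xc xc']].
  have /inDP[c0 _] := cD; have /inDP[c'0 _] := c'D.
  (* The common faces of [c] and [c'] are the cells of a box of width at most 1, whose top cell is
     the intersection. *)
  pose a : 'rV[int]_r := \row_i Num.max (c.1 0 i) (c'.1 0 i).
  pose b : 'rV[int]_r := \row_i Num.min (c.2 0 i) (c'.2 0 i).
  have boxE t : t \in box_cells R alpha a b <-> face c t /\ face c' t.
    split=> [/box_cellsP[t0 le]|[/faceP[t0 le] /faceP[_ le']]].
      by split; apply/faceP; split=> // i; have [] := le i;
        rewrite !mxE ge_max le_min => /andP[? ?] /andP[].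
    apply/box_cellsP; split=> // i; rewrite !mxE ge_max le_min.
    by have [-> ->] := le i; have [-> ->] := le' i.
  have boxP y : closed_cell c y -> closed_cell c' y -> cell_of y \in box_cells R alpha a b.
    move=> yc yc'; have cy := cell_ofP yc.1; apply/boxE; split; apply/faceP.
      by split; [exists y|exact: closed_cell_le cy yc].
    by split; [exists y|exact: closed_cell_le cy yc'].
  have ab i : b 0 i <= a 0 i + 1.
    rewrite !mxE; have /andP[_ h] := open_cell_width c0 i.
    by rewrite ge_min (le_trans h) // lerD2r le_max lexx.
  have [s sab smax] := box_top (ex_intro (fun t : cell => t \in _) _ (boxP x xc xc')) ab.
  have [cs c's] := (boxE s).1 sab; exists s; split=> //; first exact: face_inD cs.
  apply/seteqP; split=> y.
    move=> [yc yc']; have [_ sy] := smax _ (boxP y yc yc'); apply: sy.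
    exact: cell_ofP yc.1.
  move=> ys; have /faceP[_ le] := cs; have /faceP[_ le'] := c's.
  by split; [exact: cell_le_closed le ys|exact: cell_le_closed le' ys].
- move=> c t cD ct i; rewrite (inD_ge0 (face_inD cD ct)) /=.
  by have /faceP[_ /(_ i)[]] := ct.
Qed.

(* The cones of full dimension cover: a generic vector avoids the hyperplanes  *)
(* containing the other ones.                                                  *)
Lemma unimodular_rays : exists (B : 'M[int]_n) (f : 'I_n -> 'I_r),
  B \in unitmx /\ forall j, row j B = row (f j) (ray X).
Proof.
apply: contrapT => none.
(* The rays of [s] belong to a basis of N and miss one of its vectors, since otherwise they would be
   the rays sought. The coordinate along that vector vanishes on the cone. *)
have form (s : {set 'I_r}) : exists g : 'rV[R]_n -> R,
    (forall y a w, g (y + a *: w) = g y + a * g w) /\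
    (s \in cones X -> (forall w, rcone R s w -> g w = 0) /\ exists y, g y != 0).
  case: (boolP (s \in cones X)) => sX; last first.
    by exists (fun=> 0); split=> // y a w; rewrite mulr0 addr0.
  have [B [f [Bu fi Bf]]] := sp_smooth HX sX.
  have [j jf] : exists j, forall i, i \in s -> f i != j.
    apply: contrapT => all; apply: none.
    have ex j : exists i, i \in s /\ f i = j.
      apply: contrapT => no; apply: all; exists j => i si.
      by apply/eqP => e; apply: no; exists i.
    have [g hg] := choice ex; exists B, g; split=> // j.
    by have [gs fg] := hg j; rewrite -Bf // fg.
  pose Bi : 'M[R]_n := map_mx intr (invmx B).
  have BBi : map_mx intr B *m Bi = 1%:M by rewrite -map_mxM mulmxV // map_mx1.
  exists (fun w => (w *m Bi) 0 j); split=> [y a w|_].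
    by rewrite mulmxDl -scalemxAl !mxE.
  split=> [w [t [_ t0 ->]]|].
    rewrite mulmx_suml summxE big1 // => i _; rewrite -scalemxAl mxE.
    have [si|si] := boolP (i \in s); last by rewrite t0 // mul0r.
    rewrite -map_row -Bf // map_row -row_mul BBi row1 mxE eqxx /=.
    by rewrite eq_sym (negbTE (jf i si)) mulr0.
  exists (row j (map_mx intr B)); rewrite -row_mul BBi row1 mxE !eqxx.
  exact: oner_neq0.
have [g hg] := choice form.
(* With an empty family of forms, the generic point ranges over the whole space. *)
have r0 : realizes (fun j : void => match j with end : {scalar 'rV[R]_n}) 0 finset.set0 by case.
have [a _ ha] := generic_realizer (enum [set: {set 'I_r}]%SET) (fun s : {set 'I_r} => (hg s).1) r0.
have : [set: 'rV[R]_n] a by [].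
rewrite -(sp_complete HX) => -[s sX sa]; have [/(_ a sa) ga [y /eqP]] := (hg s).2 sX.
by apply; apply: (ha s) => //; rewrite mem_enum inE.
Qed.

(** Integral pairings with rays forming a basis of N force [m] into M. Hence an integral point of
    alpha + M (x) R has the class of [alpha]. *)
Lemma Mincl_saturated (d : 'rV[int]_r) (m : 'rV[R]_n) :
  map_mx intr d = m *m (rayR R X)^T -> exists m' : 'rV[int]_n, d = Mincl m'.
Proof.
move=> dE; have [B [f [Bu Bf]]] := unimodular_rays.
pose d' : 'rV[int]_n := \row_j d 0 (f j).
pose m' : 'rV[int]_n := d' *m (invmx B)^T; exists m'.
have mB : m *m (map_mx intr B)^T = map_mx intr d'.
  apply/rowP => j; rewrite !mxE; have /rowP/(_ (f j)) := dE; rewrite !mxE => ->.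
  apply: eq_bigr => l _; rewrite !mxE; congr (_ * _%:~R).
  by have /rowP/(_ l) := Bf j; rewrite !mxE.
have mE : m = map_mx intr m'.
  rewrite /m' map_mxM -mB map_trmx -mulmxA -map_mxM -trmx_mul mulVmx //.
  by rewrite trmx1 map_mx1 mulmx1.
have E : map_mx intr d = map_mx intr (Mincl m') :> 'rV[R]_r.
  by rewrite dE mE /rayR /Mincl map_trmx -map_mxM.
by apply/rowP => i; have /rowP/(_ i) := E; rewrite mxE [RHS]mxE => /intr_inj.
Qed.

Lemma Mpolytope_monomials (k : fieldType) (e : 'rV[int]_r) :
  Mpolytope (map_mx intr e) <->
  exists m : 'X_{1..r}, e = expo m /\ in_deg alpha ('X_[m] : Cox k X).
Proof.
split=> [[[m eE] e0]|[m [-> /(_ m)]]].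
  have ge0 i : 0 <= e 0 i by have := e0 i; rewrite mxE ler0z.
  have eE' : e = expo [multinom `|e 0%R i|%N | i < r].
    by apply/rowP => i; rewrite mxE mnmE gez0_abs.
  exists [multinom `|e 0%R i|%N | i < r]; split=> // m'.
  rewrite msuppX inE => /eqP ->; rewrite -eE'.
  apply: (@Mincl_saturated _ m); rewrite map_mxB eE.
  by rewrite addrC addKr.
rewrite msuppX mem_head => /(_ isT)[m' e']; split; last first.
  by move=> i; rewrite !mxE ler0z.
exists (map_mx intr m'); rewrite map_trmx -map_mxM -[m' *m _]e' map_mxB.
by rewrite addrC subrK.
Qed.

End Polytope.

(** * Sections of sheaves on X and X x X *)

Section FracMap.
Variables (A B : idomainType).

Lemma fracE (f : {fraction A}) :
  f = tofrac (frac (repr f)).1 / tofrac (frac (repr f)).2.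
Proof.
set x := repr f; have d0 : tofrac x.2 != 0 :> {fraction A}.
  by rewrite tofrac_eq0; exact: denom_ratioP.
apply: (mulIf d0); rewrite divfK // -[f]reprK -/x.
unlock FracField.tofrac; rewrite -[LHS]FracField.pi_mul.
apply/eqmodP; rewrite /= FracField.equivfE /FracField.mulf.
by rewrite !numden_Ratio ?oner_eq0 ?mulr1 ?denom_ratioP // mulrC.
Qed.

Variable h : {rmorphism A -> B}.
Hypothesis h_inj : injective h.
Local Notation hF := (frac_map h).

Lemma tofrac_neq0 (C : idomainType) (p : C) : p != 0 -> tofrac p != 0.
Proof. by rewrite tofrac_eq0. Qed.

Lemma rmorph_neq0 p : p != 0 -> h p != 0.
Proof. by apply: contra_neq => e; apply: h_inj; rewrite e rmorph0. Qed.

Lemma frac_mapE p q : q != 0 -> hF (tofrac p / tofrac q) = tofrac (h p) / tofrac (h q).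
Proof.
move=> q0; set f := tofrac p / tofrac q.
have d0 : (frac (repr f)).2 != 0 by exact: denom_ratioP.
rewrite /frac_map; apply/eqP; rewrite eqr_div ?tofrac_neq0 ?rmorph_neq0 //.
rewrite -!tofracM tofrac_eq -!rmorphM; apply/eqP; congr (h _).
have := fracE f; rewrite {1}/f => /eqP; rewrite eqr_div ?tofrac_neq0 //.
by rewrite -!tofracM tofrac_eq => /eqP ->.
Qed.

Lemma frac_map_tofrac p : hF (tofrac p) = tofrac (h p).
Proof.
by have := frac_mapE p (oner_neq0 A); rewrite !rmorph1 !divr1.
Qed.

Lemma frac_rep (f : {fraction A}) : exists p q, q != 0 /\ f = tofrac p / tofrac q.
Proof.
exists (frac (repr f)).1, (frac (repr f)).2.
by split; [exact: denom_ratioP|exact: fracE].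
Qed.

Lemma frac_mapD : {morph hF : f g / f + g}.
Proof.
move=> f g; have [p [q [q0 ->]]] := frac_rep f; have [p' [q' [q'0 ->]]] := frac_rep g.
rewrite addf_div ?tofrac_neq0 // -!tofracM -tofracD !frac_mapE ?mulf_neq0 //.
by rewrite addf_div ?tofrac_neq0 ?rmorph_neq0 // -!tofracM -tofracD rmorphD !rmorphM.
Qed.

Lemma frac_mapM : {morph hF : f g / f * g}.
Proof.
move=> f g; have [p [q [q0 ->]]] := frac_rep f; have [p' [q' [q'0 ->]]] := frac_rep g.
by rewrite mulf_div -!tofracM !frac_mapE ?mulf_neq0 // mulf_div -!tofracM !rmorphM.
Qed.

Lemma common_denominator (I : eqType) (s : seq I) (f : I -> {fraction A}) :
  exists (q : A) (p : I -> A), q != 0 /\ {in s, forall i, f i = tofrac (p i) / tofrac q}.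
Proof.
elim: s => [|i s [q [p [q0 hp]]]]; first by exists 1, (fun=> 0); rewrite oner_neq0.
have [p' [q' [q'0 fi]]] := frac_rep (f i).
exists (q * q'), (fun j => if j == i then p' * q else p j * q'); split; first by rewrite mulf_neq0.
move=> j; rewrite inE; case: eqP => [-> _|_ /= /hp ->].
  by rewrite fi !tofracM [tofrac q * _]mulrC -mulf_div divff ?tofrac_neq0 // mulr1.
by rewrite !tofracM -mulf_div divff ?tofrac_neq0 // mulr1.
Qed.

End FracMap.

(** * Polynomials in two sets of variables *)

Section TwoSetsOfVariables.
Variables (k : fieldType) (r r' : nat).
Implicit Types (u : 'X_{1..r}) (v : 'X_{1..r'}) (M : 'X_{1..r + r'}).

Definition mcat u v : 'X_{1..r + r'} :=
  [multinom match fintype.split i with inl a => u a | inr b => v b end | i < r + r'].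

Definition mleft M : 'X_{1..r} := [multinom M (lshift r' i) | i < r].
Definition mright M : 'X_{1..r'} := [multinom M (rshift r i) | i < r'].

Lemma mcat_lshift u v i : mcat u v (lshift r' i) = u i.
Proof. by rewrite mnmE -[lshift r' i]/(unsplit (inl i)) unsplitK. Qed.

Lemma mcat_rshift u v i : mcat u v (rshift r i) = v i.
Proof. by rewrite mnmE -[rshift r i]/(unsplit (inr i)) unsplitK. Qed.

Lemma mcatK M : mcat (mleft M) (mright M) = M.
Proof.
apply/mnmP => i; rewrite -[i]splitK; case: (fintype.split i) => j /=.
  by rewrite mcat_lshift mnmE.
by rewrite mcat_rshift mnmE.
Qed.

Lemma mleftK u v : mleft (mcat u v) = u.
Proof. by apply/mnmP => i; rewrite mnmE mcat_lshift. Qed.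

Lemma mrightK u v : mright (mcat u v) = v.
Proof. by apply/mnmP => i; rewrite mnmE mcat_rshift. Qed.

Lemma mcatD u v u' v' : (mcat u v + mcat u' v')%MM = mcat (u + u')%MM (v + v')%MM.
Proof.
apply/mnmP => i; rewrite mnmDE -[i]splitK; case: (fintype.split i) => j /=.
  by rewrite !mcat_lshift mnmDE.
by rewrite !mcat_rshift mnmDE.
Qed.

Lemma expo_mcat u v : expo (mcat u v) = row_mx (expo u) (expo v).
Proof.
apply/rowP => i; rewrite !mxE -[i]splitK; case: (fintype.split i) => j /=.
  by rewrite mcat_lshift -[lshift _ _]/(unsplit (inl j)) unsplitK mxE.
by rewrite mcat_rshift -[rshift _ _]/(unsplit (inr j)) unsplitK mxE.
Qed.

Local Notation inl := (@inl_poly k r r').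

Lemma inl_poly_additive : zmod_morphism inl.
Proof. by move=> p q; rewrite /inl_poly raddfB. Qed.

Lemma inl_poly_multiplicative : monoid_morphism inl.
Proof. by split=> [|p q]; rewrite /inl_poly ?rmorph1 ?rmorphM. Qed.

HB.instance Definition _ :=
  GRing.isZmodMorphism.Build (mpoly.mpoly r k) (mpoly.mpoly (r + r') k) inl inl_poly_additive.
HB.instance Definition _ :=
  GRing.isMonoidMorphism.Build (mpoly.mpoly r k) (mpoly.mpoly (r + r') k) inl
    inl_poly_multiplicative.

Lemma inl_polyX u : inl 'X_[u] = 'X_[mcat u 0].
Proof.
rewrite /inl_poly comp_mpolyX [RHS]mpolyXE_id big_split_ord /=.
rewrite [X in _ = _ * X]big1 ?mulr1 => [|i _]; last by rewrite mcat_rshift mnm0E expr0.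
by apply: eq_bigr => i _; rewrite tnth_mktuple mcat_lshift.
Qed.

Lemma inl_polyZ c p : inl (c *: p) = c *: inl p.
Proof. exact: comp_mpolyZ. Qed.

Lemma inl_polyE p : inl p = \sum_(u <- msupp p) p@_u *: 'X_[mcat u 0].
Proof.
rewrite {1}[p]mpolyE raddf_sum /=; apply: eq_bigr => u _.
by rewrite -inl_polyX -inl_polyZ.
Qed.

Lemma mcoeff_inl_poly p v u w : (inl p * 'X_[mcat 0 v])@_(mcat u w) = if w == v then p@_u else 0.
Proof.
rewrite inl_polyE mulr_suml raddf_sum /=.
under eq_bigr => u' _ do
  rewrite -scalerAl -mpolyXD mcatD addm0 add0m mcoeffZ mcoeffX.
have inj u' : (mcat u' v == mcat u w) = (u' == u) && (w == v).
  apply/eqP/andP => [e|[/eqP -> /eqP ->] //].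
  split; first by rewrite -(mleftK u' v) e mleftK.
  by rewrite -(mrightK u' v) e mrightK.
under eq_bigr do rewrite inj.
case: eqP => [_|_]; last by rewrite big1 // => u' _; rewrite andbF mulr0.
under eq_bigr do rewrite andbT.
have [up|up] := boolP (u \in msupp p).
  rewrite (bigD1_seq u) ?msupp_uniq //= eqxx mulr1 big1 ?addr0 // => u' /negbTE ->.
  by rewrite mulr0.
rewrite big_seq big1; first by rewrite memN_msupp_eq0.
by move=> u' u'p; case: eqP => [e|]; rewrite ?mulr0 // -e u'p in up *.
Qed.

Lemma inl_poly_inj : injective inl.
Proof.
move=> p q e; apply/mpolyP => u.
have := mcoeff_inl_poly p 0 u 0; rewrite e mcoeff_inl_poly eqxx.
by move=> ->.
Qed.

Lemma xmon_row_mx (a : 'rV[int]_r) (b : 'rV[int]_r') :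
  xmon k (row_mx a b) = inl (xmon k a) * xmon k (row_mx 0 b).
Proof.
rewrite /xmon inl_polyX -mpolyXD; congr 'X_[_]; apply/mnmP => i.
rewrite mnmDE !mnmE !mxE; case: (fintype.split i) => j; rewrite ?mnmE ?mxE ?mnm0E.
  by rewrite absz0 addn0.
by rewrite add0n.
Qed.

Lemma xmon_right (b : 'rV[int]_r') :
  xmon k (row_mx 0 b) = 'X_[mcat 0 [multinom `|b 0%R i|%N | i < r']].
Proof.
rewrite /xmon; congr 'X_[_]; apply/mnmP => i.
rewrite !mnmE !mxE; case: (fintype.split i) => j; rewrite ?mnmE ?mxE ?mnm0E //.
Qed.

End TwoSetsOfVariables.

(** * Sections of twists over the charts of X and X x X *)

Section Localization.
Variables (k : fieldType) (X : toric).
Local Notation r := (nray X).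
Implicit Types (a b e : 'rV[int]_r) (s : {set 'I_r}) (f g : CoxFrac k X).

Lemma xmonMn e N : (forall i, 0 <= e 0 i) -> xmon k (e *+ N) = xmon k e ^+ N.
Proof.
move=> e0; elim: N => [|N IH].
  rewrite mulr0n expr0 /xmon -mpolyX0; congr 'X_[_]; apply/mnmP => i.
  by rewrite mnmE mxE mnm0E.
rewrite mulrS exprS xmonD // ?IH // => i.
by elim: (N) => [|N' IHN]; rewrite ?mulr0n ?mxE // mulrS mxE addr_ge0.
Qed.

Lemma xmon_neq0 e : xmon k e != 0.
Proof. by rewrite /xmon -msupp_eq0 msuppX. Qed.

Lemma xhat_ge0 s i : 0 <= (xhat s) 0 i.
Proof. by rewrite mxE. Qed.

Lemma in_deg_xmonX e N : (forall i, 0 <= e 0 i) -> in_deg (e *+ N) (xmon k e ^+ N).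
Proof.
move=> e0; rewrite -xmonMn //; apply: in_deg_xmon => i.
by elim: N => [|N IHN]; rewrite ?mulr0n ?mxE // mulrS mxE addr_ge0.
Qed.

Lemma loc0 s a : loc s a (0 : CoxFrac k X).
Proof. by exists 0%N, 0; split; [exact: in_deg0|rewrite tofrac0 mul0r]. Qed.

Lemma locW s a b f : same_deg a b -> loc s a f -> loc s b f.
Proof.
move=> ab [N [p [hp ->]]]; exists N, p; split=> //; apply: in_degW hp.
by apply: same_degD => //; exact: same_deg_refl.
Qed.

Lemma locD s a f g : loc s a f -> loc s a g -> loc s a (f + g).
Proof.
move=> [N [p [hp ->]]] [M [q [hq ->]]].
exists (N + M)%N, (p * xmon k (xhat s) ^+ M + q * xmon k (xhat s) ^+ N); split.
  have xM n : in_deg (xhat s *+ n) (xmon k (xhat s) ^+ n) by apply/in_deg_xmonX/xhat_ge0.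
  apply: in_degD; rewrite mulrnDr addrA; first exact: in_degM.
  by rewrite addrAC; exact: in_degM.
have x0 : tofrac (xmon k (xhat s)) != 0 by rewrite tofrac_eq0 xmon_neq0.
by rewrite addf_div ?expf_neq0 // tofracD !tofracM !tofracXn exprD.
Qed.

Lemma loc_sum s a (I : eqType) (l : seq I) (P : pred I) (F : I -> CoxFrac k X) :
  {in l, forall i, P i -> loc s a (F i)} -> loc s a (\sum_(i <- l | P i) F i).
Proof.
move=> h; rewrite big_seq_cond.
by apply: (big_ind (loc s a)); [exact: loc0|exact: locD|move=> i /andP[il Pi]; exact: h].
Qed.

End Localization.

Section Product.
Variables (k : fieldType) (X : toric).
Local Notation r := (nray X).
Local Notation XX := (tprod X X).
Local Notation ipoly := (@inl_poly k r r).
Local Notation FM := (frac_map ipoly).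
Implicit Types (a b e : 'rV[int]_r) (s t : {set 'I_r}).

Lemma Mincl_prod (m m' : 'rV[int]_(tdim X)) :
  Mincl (X := XX) (row_mx m m') = row_mx (Mincl m) (Mincl m').
Proof.
rewrite /Mincl -[ray XX]/(block_mx (ray X) 0 0 (ray X)) tr_block_mx !trmx0.
by rewrite (mul_row_block m m') !mulmx0 addr0 add0r.
Qed.

Lemma same_deg_prod a b a' b' :
  same_deg (X := XX) (row_mx a b) (row_mx a' b') <-> same_deg a a' /\ same_deg b b'.
Proof.
split=> [[m]|[[m h] [m' h']]].
  rewrite -[m]hsubmxK Mincl_prod => e.
  have : row_mx (a - a') (b - b') = row_mx (Mincl (lsubmx m)) (Mincl (rsubmx m)).
    by rewrite -e opp_row_mx add_row_mx.
  by move=> /eq_row_mx[h h']; split; [exists (lsubmx m)|exists (rsubmx m)].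
by exists (row_mx m m'); rewrite Mincl_prod -h -h' opp_row_mx add_row_mx.
Qed.

Lemma mem_prod_cone s t (i : 'I_(nray XX)) :
  (i \in prod_cone s t) =
  match fintype.split (i : 'I_(r + r)) with inl a => a \in s | inr b => b \in t end.
Proof.
rewrite inE -[i](@splitK r r); case: (fintype.split _) => j /=.
  rewrite mem_imset ?unsplitK; last exact: lshift_inj.
  rewrite -[lshift _ _]/(unsplit (inl j)) unsplitK orbC; case: imsetP => // -[j' _ /eqP].
  by rewrite eq_lrshift.
rewrite [X in _ || X]mem_imset; last exact: rshift_inj.
rewrite -[rshift _ _]/(unsplit (inr j)) unsplitK; case: imsetP => // -[j' _ /eqP].
by rewrite eq_rlshift.
Qed.

Lemma xhat_prod s t : xhat (X := XX) (prod_cone s t) = row_mx (xhat s) (xhat t).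
Proof.
apply/rowP => i; rewrite !mxE mem_prod_cone.
by case: (fintype.split _) => j; rewrite mxE.
Qed.

Lemma mcat00 : mcat (0 : 'X_{1..r}) (0 : 'X_{1..r}) = 0%MM.
Proof.
apply/mnmP => i; rewrite mnm0E mnmE; case: (fintype.split i) => j; exact: mnm0E.
Qed.

Lemma in_deg_inl a p : in_deg a p -> in_deg (X := XX) (row_mx a 0) (ipoly p).
Proof.
move=> hp M; rewrite -[M]mcatK -[ipoly p]mulr1 -mpolyX0 -mcat00 mcoeff_msupp mcoeff_inl_poly.
case: (eqVneq (mright M) 0%MM) => [->|_]; last by rewrite eqxx.
rewrite -mcoeff_msupp => /hp h; rewrite expo_mcat; apply/same_deg_prod; split=> //.
rewrite (_ : expo _ = 0); first exact: same_deg_refl.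
by apply/rowP => i; rewrite !mxE mnm0E.
Qed.

Lemma row_mxMn a b N : row_mx a b *+ N = row_mx (a *+ N) (b *+ N).
Proof. by elim: N => [|N IH]; rewrite ?mulr0n ?row_mx0 // !mulrS IH add_row_mx. Qed.

Lemma row_mx_ge0 a b : (forall i, 0 <= a 0 i) -> (forall i, 0 <= b 0 i) ->
  forall i, 0 <= (row_mx a b) 0 i.
Proof. by move=> ha hb i; rewrite mxE; case: fintype.split. Qed.

Lemma zero_ge0 (i : 'I_r) : 0 <= (0 : 'rV[int]_r) 0 i.
Proof. by rewrite mxE. Qed.

(** The monomial y^b, with [b] nonnegative, is regular on every chart. Numerator and denominator are
    multiplied by the y part of the denominator of the product chart. *)
Lemma loc_prod s t a b f : (forall i, 0 <= b 0 i) -> loc s a f ->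
  loc (X := XX) (prod_cone s t) (row_mx a b) (FM f * tofrac (xmon k (row_mx 0 b))).
Proof.
move=> b0 [N [p [hp ->]]].
exists N, (ipoly p * xmon k (row_mx 0 b) * xmon k (row_mx 0 (xhat t)) ^+ N); split.
  have -> : row_mx a b + xhat (X := XX) (prod_cone s t) *+ N =
      row_mx (a + xhat s *+ N) 0 + row_mx 0 b + row_mx 0 (xhat t) *+ N.
    by rewrite xhat_prod !row_mxMn !add_row_mx mul0rn !addr0 !add0r.
  have ge := row_mx_ge0 zero_ge0.
  apply: in_degM; last by apply: in_deg_xmonX => //; apply: ge; exact: xhat_ge0.
  by apply: in_degM; [exact: in_deg_inl|apply: in_deg_xmon; exact: ge].
rewrite -tofracXn (frac_mapE (@inl_poly_inj k r r)) ?expf_neq0 ?xmon_neq0 //.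
rewrite xhat_prod (xmon_row_mx k (xhat s)) rmorphXn !tofracM !tofracXn /= exprMn.
have x0 : tofrac (xmon k (row_mx 0 (xhat t)) : Cox k XX) ^+ N != 0.
  by rewrite expf_neq0 // tofrac_eq0 (@xmon_neq0 k XX).
by rewrite -mulf_div divff // mulr1 mulrAC.
Qed.

Lemma mpoly_divX (n : nat) (p : mpoly.mpoly n k) W :
  {in msupp p, forall M, (W <= M)%MM} ->
  exists2 q, p = q * 'X_[W] & {in msupp q, forall M, (M + W)%MM \in msupp p}.
Proof.
move=> hW; pose q := \sum_(M <- msupp p) p@_M *: 'X_[M - W].
have pE : p = q * 'X_[W].
  rewrite {1}[p]mpolyE /q mulr_suml big_seq [RHS]big_seq.
  apply: eq_bigr => M /hW le; by rewrite -scalerAl -mpolyXD submK.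
exists q => // M; rewrite [X in _ -> _ \in msupp X]pE (perm_mem (msuppMX _ _)) => Mq.
by rewrite addmC; apply/mapP; exists M.
Qed.

(* A section over U_s x X of a twist O(a, b) has no pole along the divisors    *)
(* y_i = 0, because it is regular on the chart of the ray i.                   *)
Lemma loc_all_charts (R : realType) (HX : smooth_projective R X) s a b (G : CoxFrac k XX) :
  (forall t, t \in cones X -> loc (X := XX) (prod_cone s t) (row_mx a b) G) ->
  exists N (P : Cox k XX), in_deg (X := XX) (row_mx (a + xhat s *+ N) b) P /\
    G = tofrac P / tofrac (ipoly (xmon k (xhat s)) ^+ N).
Proof.
move=> hG; have [t0 t0X] : exists t, t \in cones X.
  have : [set: 'rV[R]_(tdim X)] 0 by [].
  by rewrite -(sp_complete HX) => -[t tX _]; exists t.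
have [N [P [hP GE]]] := hG _ t0X.
pose xN (t : {set 'I_r}) n : 'X_{1..r + r} :=
  mcat [multinom (`|(xhat s) 0%R i|%N * n)%N | i < r]
       [multinom (`|(xhat t) 0%R i|%N * n)%N | i < r].
have xE t n : xmon k (xhat (X := XX) (prod_cone s t)) ^+ n = 'X_[xN t n].
  rewrite /xmon mpolyXn; congr 'X_[_]; apply/mnmP => i.
  rewrite mulmnE !mnmE xhat_prod mxE.
  by case: (fintype.split i) => j; rewrite !mnmE.
pose W := [multinom (`|(xhat t0) 0%R i|%N * N)%N | i < r].
(* The chart of the ray [j] does not invert y_j. Comparing with the fraction given there, the power
   of y_j in the denominator divides [P]. *)
have hW : {in msupp P, forall M, (mcat 0 W <= M)%MM}.
  move=> M MP; apply/mnm_lepP => i; rewrite -[i]splitK; case: (fintype.split i) => j /=.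
    by rewrite mcat_lshift mnm0E.
  rewrite mcat_rshift; have [Nj [Pj [_ GjE]]] := hG _ (sp_ray HX j).
  have eq : P * 'X_[xN [set j]%SET Nj] = Pj * 'X_[xN t0 N].
    apply/eqP; rewrite -!xE -tofrac_eq !tofracM !tofracXn.
    have x0 t : tofrac (xmon k (xhat (X := XX) (prod_cone s t))) != 0.
      by rewrite tofrac_eq0 (@xmon_neq0 k XX).
    by rewrite -eqr_div ?expf_neq0 // -GE -GjE.
  have : (xN [set j]%SET Nj + M)%MM \in msupp (P * 'X_[xN [set j]%SET Nj]).
    by rewrite (perm_mem (msuppMX _ _)) map_f.
  rewrite eq (perm_mem (msuppMX _ _)) => /mapP[M' _ /mnmP/(_ (rshift r j))].
  rewrite !mnmDE !mcat_rshift !mnmE !mxE inE eqxx mul0n add0n => ->.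
  by rewrite leq_addr.
have [Q PE QP] := mpoly_divX hW; exists N, Q; split.
  move=> M /QP /hP; rewrite xhat_prod row_mxMn add_row_mx -[M]mcatK mcatD !expo_mcat addm0.
  move=> /same_deg_prod[h1 h2]; apply/same_deg_prod; split=> //.
  have := same_degD h2 (same_deg_refl (- (xhat t0 *+ N))); rewrite addrK.
  rewrite expoD (_ : expo W = xhat t0 *+ N) ?addrK //.
  apply/rowP => i; rewrite mxE mnmE PoszM gez0_abs ?xhat_ge0 //.
  by rewrite mulmxnE -mulr_natr natz.
rewrite GE PE -tofracXn xE.
have -> : 'X_[xN t0 N] = ipoly (xmon k (xhat s)) ^+ N * 'X_[mcat 0 W] :> Cox k XX.
  rewrite /xmon inl_polyX mpolyXn -mpolyXD; congr 'X_[_]; apply/mnmP => i.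
  rewrite -[i]splitK; case: (fintype.split i) => j /=.
    by rewrite mnmDE mulmnE !mcat_lshift !mnmE ?mnm0E addn0.
  by rewrite mnmDE mulmnE !mcat_rshift !mnmE ?mnm0E mul0n.
have x0 : tofrac ('X_[mcat 0 W] : Cox k XX) != 0 by rewrite tofrac_eq0 -msupp_eq0 msuppX.
by rewrite !tofracM -mulf_div divff // mulr1.
Qed.

End Product.

Section SumOverSupport.
Variables (A B : zmodType) (I : choiceType) (F : I -> A -> B).
Hypothesis FD : forall c, {morph F c : a b / a + b}.

Lemma sum_msupp0 c : F c 0 = 0.
Proof. by apply: (addIr (F c 0)); rewrite -FD !add0r. Qed.

Lemma sum_msuppD (g h : {malg A[I]}) :
  \sum_(c <- monalg.msupp (g + h)) F c (monalg.mcoeff c (g + h)) =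
  \sum_(c <- monalg.msupp g) F c (monalg.mcoeff c g) +
  \sum_(c <- monalg.msupp h) F c (monalg.mcoeff c h).
Proof.
pose s : seq I := undup (monalg.msupp g ++ monalg.msupp h).
have us : uniq s := undup_uniq _.
have gs : {subset monalg.msupp g <= s}.
  by move=> c; rewrite mem_undup mem_cat => ->.
have hs : {subset monalg.msupp h <= s}.
  by move=> c; rewrite mem_undup mem_cat => ->; rewrite orbT.
have ghs : {subset monalg.msupp (g + h) <= s}.
  by move=> c /(fsubsetP (monalg.msuppD_le g h)); rewrite in_fsetU => /orP[/gs|/hs].
rewrite !(sum_msupp (r := s) sum_msupp0 us) // -big_split.
by apply: eq_bigr => c _; rewrite monalg.mcoeffD FD.
Qed.

Lemma sum_msuppU c a :
  \sum_(d <- monalg.msupp (monalg.mkmalgU c a)) F d (monalg.mcoeff d (monalg.mkmalgU c a))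
  = F c a.
Proof.
rewrite (sum_msupp (r := [:: c]) sum_msupp0) // ?big_seq1 ?monalg.mcoeffUU //.
by move=> d /(fsubsetP monalg.msuppU_le); rewrite in_fset1 inE.
Qed.

End SumOverSupport.

Lemma linextD (A : nzRingType) (I J : choiceType) (e : I -> {malg A[J]}) :
  {morph linext e : g h / g + h}.
Proof.
move=> g h; apply: (sum_msuppD (F := fun c (a : A) => a *: e c)) => c a b.
exact: scalerDl.
Qed.

Lemma linextU (A : nzRingType) (I J : choiceType) (e : I -> {malg A[J]}) c a :
  linext e (monalg.mkmalgU c a) = a *: e c.
Proof.
apply: (sum_msuppU (F := fun c (a : A) => a *: e c)) => {}c {}a b.
exact: scalerDl.
Qed.

Lemma linext0 (A : nzRingType) (I J : choiceType) (e : I -> {malg A[J]}) : linext e 0 = 0.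
Proof. by apply: (addIr (linext e 0)); rewrite -linextD !add0r. Qed.

Lemma scale_mkmalgU (A : nzRingType) (I : choiceType) (c : I) (a b : A) :
  a *: monalg.mkmalgU c b = monalg.mkmalgU c (a * b).
Proof.
by apply/monalg.malgP => d; rewrite monalg.mcoeffZ !monalg.mcoeffU mulrnAr.
Qed.

Lemma fsbig_uniq (B : nmodType) (I : choiceType) (P : set I) (s : seq I) (F : I -> B) :
  uniq s -> (forall x, x \in s <-> P x) -> \sum_(x \in P) F x = \sum_(x <- s) F x.
Proof.
move=> us sP; have -> : P = [set` s] by apply/seteqP; split=> x /sP.
by rewrite -fsbig_seq.
Qed.

(** * The map from F(d) to the Fourier-Mukai transform *)

Section SheafIsomorphism.
Variables (R : realType) (k : fieldType) (X : toric) (HX : smooth_projective R X).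
Variable alpha : 'rV[int]_(nray X).
Variable eps : cell (nray X) -> cell (nray X) -> int.
Hypothesis Heps : incidence R 0 eps.
Hypothesis Hinv : forall m s t, eps (shift (Mincl m) s) (shift (Mincl m) t) = eps s t.

Local Notation r := (nray X).
Local Notation cell := (cell r).
Local Notation XX := (tprod X X).
Local Notation ipoly := (@inl_poly k r r).
Local Notation FM := (frac_map ipoly).
Local Notation Dcell := (Dcell R alpha).
Local Notation Mcell := (Mcell R X).
Local Notation Ecell := (Ecell R X).
Local Notation K := (CoxFrac k X).
Local Notation L := (CoxFrac k XX).

Lemma shift_shift (a b : 'rV[int]_r) (c : cell) : shift a (shift b c) = shift (b + a) c.
Proof. by rewrite /shift /= !addrA. Qed.

Lemma cell_dim_translate m i (c : cell) :
  cell_dim R 0 i (shift (Mincl m - alpha) c) <-> cell_dim R alpha i c.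
Proof.
rewrite -(cell_dim_Mincl R 0 m) add0r -(cell_dim_shift R alpha (Mincl m - alpha)).
by rewrite addrCA subrr addr0.
Qed.

Lemma facet_translate m (s t : cell) :
  facet R 0 (shift (Mincl m - alpha) s) (shift (Mincl m - alpha) t) <-> facet R alpha s t.
Proof.
rewrite -(facet_Mincl R 0 m) add0r -(facet_shift R alpha (Mincl m - alpha)).
by rewrite addrCA subrr addr0.
Qed.

Lemma MinclN (m : 'rV[int]_(tdim X)) : Mincl (- m) = - Mincl m.
Proof. exact: mulNmx. Qed.

Lemma Mincl0 : Mincl (X := X) 0 = 0.
Proof. exact: mul0mx. Qed.

Lemma translate_proof m i (c : Dcell i) : `[< cell_dim R 0 i (shift (Mincl m - alpha) (val c)) >].
Proof. by apply/asboolP/cell_dim_translate; exact: (DcellP c).2. Qed.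

Definition translate m i (c : Dcell i) : Mcell i :=
  exist _ (shift (Mincl m - alpha) (val c)) (translate_proof m c).

Definition cls i (c : Dcell i) : Ecell i := \pi_(Ecell i)%qT (translate 0 c).

Lemma cls_translate m i (c : Dcell i) : \pi_(Ecell i)%qT (translate m c) = cls c.
Proof.
apply/eqmodP/asboolP; exists (- m); rewrite /= shift_shift; congr (shift _ _).
by rewrite Mincl0 add0r /Mincl mulNmx addrAC subrr add0r.
Qed.

Lemma cls_rep i (c : Dcell i) : exists m, Erep (cls c) = shift (Mincl m - alpha) (val c).
Proof.
have /eqmodP/asboolP[m e] : \pi_(Ecell i)%qT (translate 0 c) = \pi_(Ecell i)%qT (repr (cls c)).
  by rewrite reprK.
exists m; rewrite /Erep e /= shift_shift; congr (shift _ _).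
by rewrite Mincl0 add0r addrC.
Qed.

(** Cells of D with the same class are translates of one another, and equal floors make the
    translation zero. *)
Lemma cls_inj i (c d : Dcell i) : cls c = cls d -> (val c).1 = (val d).1 -> c = d.
Proof.
move=> e e1; apply: val_inj.
have [m hm] := cls_rep c; have [m' hm'] := cls_rep d.
have E : shift (Mincl m - alpha) (val c) = shift (Mincl m' - alpha) (val d) by rewrite -hm -hm' e.
case: (val c) (val d) e1 E => [c1 c2] [d1 d2] /= <- [/addrI e1 e2].
by congr (_, _); move: e2; rewrite e1 => /addIr.
Qed.

(** The translate of [e] with floor [b] lies in the nonnegative orthant, hence in D. So every
    monomial y^b of class d + floor(e) is accounted for by a cell of D over [e]. *)
Lemma cls_exists i (e : Ecell i) (b : 'rV[int]_r) : (forall l, 0 <= b 0 l) ->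
  same_deg b (alpha + (Erep e).1) -> exists2 c : Dcell i, cls c = e & (val c).1 = b.
Proof.
move=> b0 [m bE]; have hE : cell_dim R 0 i (Erep e) by apply/asboolP; exact: (valP (repr e)).
pose c := shift (alpha + Mincl m) (Erep e).
have c1 : c.1 = b by rewrite /c /= -bE addrA [(Erep e).1 + alpha]addrC addrC subrK.
have cE : shift (Mincl (- m) - alpha) c = Erep e.
  rewrite /c shift_shift [X in shift X _](_ : _ = 0).
    by rewrite /shift !addr0; case: (Erep e).
  by rewrite MinclN -opprD [Mincl m + _]addrC addrN.
have cd : cell_dim R alpha i c by apply/(cell_dim_translate (- m)); rewrite cE.
have cP : `[< inD R alpha c /\ cell_dim R alpha i c >].
  apply/asboolP; split=> //; apply/inDP; split; first exact: cell_dim_open cd.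
  by rewrite c1.
exists (exist _ c cP) => //; rewrite -(cls_translate (- m)) -[e]reprK.
by congr (\pi_(Ecell i)%qT _); apply: val_inj; rewrite /= cE.
Qed.

Definition ymon (c : cell) : L := tofrac (xmon k (row_mx 0 c.1)).

(* The section f e_c of F(d) corresponds to f(x) y^b on the cell c - alpha of  *)
(* E, where b is the common floor of the points of c.                          *)
Definition phi i (g : {malg K[Dcell i]}) : {malg L[Ecell i]} :=
  \sum_(c <- monalg.msupp g)
    monalg.mkmalgU (cls c) (FM (monalg.mcoeff c g) * ymon (val c)).

Let FMD : {morph FM : f g / f + g} := frac_mapD (@inl_poly_inj k r r).
Let FMM : {morph FM : f g / f * g} := frac_mapM (@inl_poly_inj k r r).

Let phi_termD i (c : Dcell i) : {morph (fun a : K =>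
  monalg.mkmalgU (cls c) (FM a * ymon (val c))) : a b / a + b}.
Proof. by move=> a b; rewrite FMD mulrDl monalg.monalgUD. Qed.

Lemma phiD i : {morph @phi i : g h / g + h}.
Proof. move=> g h; exact: (sum_msuppD (@phi_termD i)). Qed.

Lemma phiU i c a : @phi i (monalg.mkmalgU c a) = monalg.mkmalgU (cls c) (FM a * ymon (val c)).
Proof. exact: (sum_msuppU (@phi_termD i)). Qed.

Lemma phi0 i : @phi i 0 = 0.
Proof. by apply: (addIr (phi 0)); rewrite -phiD !add0r. Qed.

Lemma phi_sum i (I : Type) (s : seq I) (G : I -> {malg K[Dcell i]}) :
  phi (\sum_(x <- s) G x) = \sum_(x <- s) phi (G x).
Proof. exact: (big_morph _ (@phiD i) (@phi0 i)). Qed.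

Lemma phiZ i a g : @phi i (a *: g) = FM a *: phi g.
Proof.
have key (s : seq (Dcell i)) (G : Dcell i -> K) :
    phi (a *: \sum_(c <- s) monalg.mkmalgU c (G c)) =
    FM a *: phi (\sum_(c <- s) monalg.mkmalgU c (G c)).
  transitivity (\sum_(c <- s) phi (a *: monalg.mkmalgU c (G c))).
    by rewrite scaler_sumr; exact: phi_sum.
  rewrite [X in _ = _ *: X]phi_sum scaler_sumr; apply: eq_bigr => c _.
  rewrite scale_mkmalgU [LHS]phiU [X in _ = _ *: X]phiU [RHS]scale_mkmalgU.
  have e : FM (a * G c) = FM a * FM (G c).
    exact: FMM.
  by rewrite e -mulrA.
have := key (monalg.msupp g) (fun c => monalg.mcoeff c g).
by rewrite -(monalg.monalgE g).
Qed.

Lemma mcoeff_phi i (g : {malg K[Dcell i]}) e : monalg.mcoeff e (phi g) =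
  \sum_(c <- monalg.msupp g | cls c == e) FM (monalg.mcoeff c g) * ymon (val c).
Proof.
rewrite /phi raddf_sum /= [RHS]big_mkcond /=; apply: eq_bigr => c _.
by rewrite monalg.mcoeffU; case: eqP.
Qed.

Let Heps' : incidence R alpha (transport alpha eps) := incidence_transport alpha Heps.

Lemma Fbd_mkmalgU (A : nzRingType) (h : Cox k X -> A) i (s : Dcell i.+1) (f : A)
    (T : seq (Dcell i)) : uniq T ->
  (forall t, t \in T <-> facet R alpha (val s) (val t)) ->
  Fbd h eps (monalg.mkmalgU s f) = \sum_(t <- T) monalg.mkmalgU t
    (f * h (xmon k ((val s).2 - (val t).2) *~ transport alpha eps (val s) (val t))).
Proof.
move=> uT TP; rewrite /Fbd linextU (fsbig_uniq _ uT TP) scaler_sumr.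
by apply: eq_bigr => t _; exact: scale_mkmalgU.
Qed.

Lemma Gbd_mkmalgU (A : nzRingType) (h : Cox k XX -> A) i (e : Ecell i.+1) (f : A)
    (T : seq (Mcell i)) : uniq T ->
  (forall t, t \in T <-> facet R 0 (Erep e) (val t)) ->
  Gbd h eps (monalg.mkmalgU e f) = \sum_(t <- T) monalg.mkmalgU (\pi_(Ecell i)%qT t)
    (f * h (xmon k (row_mx ((Erep e).2 - (val t).2) ((val t).1 - (Erep e).1))
       *~ eps (Erep e) (val t))).
Proof.
move=> uT TP; rewrite /Gbd linextU (fsbig_uniq _ uT TP) scaler_sumr.
by apply: eq_bigr => t _; exact: scale_mkmalgU.
Qed.

Lemma translate_inj m i : injective (@translate m i).
Proof.
move=> c d /(congr1 val) /= e; apply: val_inj.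
by rewrite -[val c](shiftK (Mincl m - alpha)) e shiftK.
Qed.

Lemma translate_surj m i (s : Dcell i.+1) (t' : Mcell i) :
  facet R 0 (shift (Mincl m - alpha) (val s)) (val t') ->
  exists2 t : Dcell i, translate m t = t' & facet R alpha (val s) (val t).
Proof.
move=> ft'; pose t := shift (alpha - Mincl m) (val t').
have tE : shift (Mincl m - alpha) t = val t'.
  rewrite /t shift_shift [X in shift X _](_ : _ = 0).
    by rewrite /shift !addr0; case: (val t').
  by rewrite -[alpha - _]opprB addNr.
have ft : facet R alpha (val s) t by apply/(facet_translate m); rewrite tE.
have tP : `[< inD R alpha t /\ cell_dim R alpha i t >].
  apply/asboolP; split; first by apply: face_inD (DcellP s).1 _; case: ft.
  by apply/(facet_dim i ft); exact: (DcellP s).2.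
by exists (exist _ t tP) => //; apply: val_inj; rewrite /= tE.
Qed.

(** Translation preserves differences of ceilings and of floors. The x part of the coefficient in G
    is the ratio of labels, and its y part turns the floor monomial of [s] into that of [t]. *)
Lemma phi_coeff (s t : cell) (z : int) (e : cell) (m : 'rV[int]_(tdim X)) (f : K) :
  (forall j, 0 <= s.1 0 j) -> face R alpha s t ->
  e = shift (Mincl m - alpha) s ->
  FM (f * tofrac (xmon k (s.2 - t.2) *~ z)) * ymon t =
  FM f * ymon s * tofrac (xmon k (row_mx (e.2 - (shift (Mincl m - alpha) t).2)
     ((shift (Mincl m - alpha) t).1 - e.1)) *~ z).
Proof.
move=> s0 /faceP[_ le] ->.
have -> : (shift (Mincl m - alpha) s).2 - (shift (Mincl m - alpha) t).2 = s.2 - t.2.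
  by rewrite /= opprD addrACA subrr addr0.
have -> : (shift (Mincl m - alpha) t).1 - (shift (Mincl m - alpha) s).1 = t.1 - s.1.
  by rewrite /= opprD addrACA subrr addr0.
have b0 j : 0 <= (t.1 - s.1) 0 j by rewrite !mxE subr_ge0; case: (le j).
have yE : xmon k (row_mx 0 t.1) = xmon k (row_mx 0 s.1) * xmon k (row_mx 0 (t.1 - s.1)) :> Cox k XX.
  rewrite -(@xmonD k XX); last 2 first.
  - by apply: row_mx_ge0 => //; exact: zero_ge0.
  - by apply: row_mx_ge0 => //; exact: zero_ge0.
  by rewrite add_row_mx addr0 [s.1 + _]addrC subrK.
have xE : xmon k (row_mx (s.2 - t.2) (t.1 - s.1)) *~ z =
    ipoly (xmon k (s.2 - t.2) *~ z) * xmon k (row_mx 0 (t.1 - s.1)) :> Cox k XX.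
  by rewrite xmon_row_mx raddfMz mulrzAl.
rewrite FMM (frac_map_tofrac (@inl_poly_inj k r r)) xE /ymon yE !tofracM.
by move: (FM f) => a; rewrite -!mulrA; congr (_ * _); rewrite mulrCA.
Qed.

(** The translation taking [s] to the chosen representative of its class matches their facets, and
    those of [s] all lie in D. The signs agree by the invariance of [eps] under M. *)
Lemma phi_FbdU i (s : Dcell i.+1) (f : K) :
  phi (Fbd (@tofrac _) eps (monalg.mkmalgU s f)) =
  Gbd (@tofrac _) eps (phi (monalg.mkmalgU s f)).
Proof.
have [m mE] := cls_rep s.
pose T : seq (Dcell i) := undup [seq t <- pmap insub (box_cells R alpha (val s).1 (val s).2) |
   `[< facet R alpha (val s) (val t) >]].
have uT : uniq T := undup_uniq _.
have TP t : t \in T <-> facet R alpha (val s) (val t).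
  rewrite mem_undup mem_filter; split=> [/andP[/asboolP //]|ft].
  rewrite asboolT //= mem_pmap; apply/mapP; exists (val t); last by rewrite valK.
  by apply/face_box_cells; case: ft.
clearbody T.
have uT' : uniq [seq translate m t | t <- T].
  by rewrite map_inj_uniq //; exact: translate_inj.
have TP' (t' : Mcell i) : t' \in [seq translate m t | t <- T] <-> facet R 0 (Erep (cls s)) (val t').
  rewrite mE; split=> [/mapP[t /TP ft ->]|/translate_surj[t <- /TP tT]].
    by apply/facet_translate.
  exact: map_f.
apply: etrans (congr1 (@phi i) (Fbd_mkmalgU (@tofrac _) f uT TP)) _.
apply: etrans (phi_sum _ _) _.
apply: esym; apply: etrans (congr1 _ (phiU s f)) _.
apply: etrans (Gbd_mkmalgU (@tofrac _) _ uT' TP') _.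
rewrite big_map big_seq [RHS]big_seq; apply: eq_bigr => t /TP[ft _]; apply: esym.
apply: etrans (phiU _ _) _; rewrite cls_translate; congr (monalg.mkmalgU _ _).
have -> : eps (Erep (cls s)) (val (translate m t)) = transport alpha eps (val s) (val t).
  by rewrite mE /transport -[RHS](Hinv m) !shift_shift [- alpha + _]addrC.
apply: phi_coeff mE => //; by have /inDP[] := (DcellP s).1.
Qed.

Lemma phi_Fbd i (g : {malg K[Dcell i.+1]}) :
  phi (Fbd (@tofrac _) eps g) = Gbd (@tofrac _) eps (phi g).
Proof.
have key (s : seq (Dcell i.+1)) (G : Dcell i.+1 -> K) :
    phi (Fbd (@tofrac _) eps (\sum_(c <- s) monalg.mkmalgU c (G c))) =
    Gbd (@tofrac _) eps (phi (\sum_(c <- s) monalg.mkmalgU c (G c))).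
  elim: s => [|c s IH].
    rewrite !big_nil /Fbd /Gbd phi0.
    by apply: etrans (congr1 _ (linext0 _)) _; rewrite phi0; apply: esym; exact: linext0.
  rewrite !big_cons /Fbd /Gbd linextD phiD [X in _ = linext _ X]phiD [RHS]linextD.
  by congr (_ + _); [exact: phi_FbdU|exact: IH].
have := key (monalg.msupp g) (fun c => monalg.mcoeff c g).
by rewrite -(monalg.monalgE g).
Qed.

End SheafIsomorphism.

(** * Bijectivity on sections *)

Section Bijection.
Variables (R : realType) (k : fieldType) (X : toric) (HX : smooth_projective R X).
Variable alpha : 'rV[int]_(nray X).
Local Notation r := (nray X).
Local Notation cell := (cell r).
Local Notation XX := (tprod X X).
Local Notation ipoly := (@inl_poly k r r).
Local Notation FM := (frac_map ipoly).
Local Notation Dcell := (Dcell R alpha).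
Local Notation Ecell := (Ecell R X).
Local Notation K := (CoxFrac k X).
Local Notation L := (CoxFrac k XX).
Local Notation phi := (@phi R k X alpha).

Let F_secs i (s : {set 'I_r}) : set {malg K[Dcell i]} :=
  [set g | forall c, loc s (alpha + Fdeg c) (monalg.mcoeff c g)].

Let G_secs i (s : {set 'I_r}) : set {malg L[Ecell i]} :=
  [set g | forall t, t \in cones X -> forall e,
     loc (X := XX) (prod_cone s t) (row_mx 0 alpha + Gdeg e) (monalg.mcoeff e g)].

Lemma cls_deg i (c : Dcell i) :
  same_deg (alpha + Fdeg c) (- (Erep (cls c)).2) /\
  same_deg (val c).1 (alpha + (Erep (cls c)).1).
Proof.
have [m ->] := cls_rep c; split=> /=.
  by exists m; rewrite /Fdeg opprK addrA subrK addrCA subrr addr0.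
exists (- m); rewrite MinclN [alpha + _]addrCA [alpha + _]addrCA subrr addr0.
by rewrite opprD addrA subrr add0r.
Qed.

Lemma Gdeg_twist i (e : Ecell i) :
  row_mx 0 alpha + Gdeg e = row_mx (- (Erep e).2) (alpha + (Erep e).1).
Proof. by rewrite /Gdeg add_row_mx add0r. Qed.

Lemma phi_secs i s (g : {malg K[Dcell i]}) : F_secs s g -> G_secs s (phi g).
Proof.
move=> hg t tX e; rewrite mcoeff_phi Gdeg_twist.
apply: (@loc_sum k XX) => c _ /eqP <-; have [h1 h2] := cls_deg c.
apply: (@locW k XX _ (row_mx (alpha + Fdeg c) (val c).1)).
  by apply/same_deg_prod.
by apply: loc_prod; [have /inDP[] := (DcellP c).1|exact: hg].
Qed.

Definition floor_mon (c : cell) : 'X_{1..r} := [multinom `|c.1 0%R i|%N | i < r].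

Lemma ymonE c : ymon k c = tofrac 'X_[mcat 0 (floor_mon c)].
Proof. by rewrite /ymon xmon_right. Qed.

(** After clearing denominators, the coefficients at the y exponent [floor_mon (val c0)] isolate
    [c0]: by [cls_inj] no other cell has the same class and the same floor. *)
Lemma phi_eq0 i (g : {malg K[Dcell i]}) : phi g = 0 -> g = 0.
Proof.
move=> g0; apply/monalg.malgP => c0; rewrite monalg.mcoeff0.
have [c0g|] := boolP (c0 \in monalg.msupp g); last exact: monalg.mcoeff_outdom.
have [q [p [q0 hp]]] := common_denominator (monalg.msupp g) (fun c => monalg.mcoeff c g).
have q0' : tofrac (ipoly q) != 0.
  by rewrite tofrac_eq0; exact: (rmorph_neq0 (@inl_poly_inj k r r)).
have sum0 : \sum_(c <- monalg.msupp g | cls c == cls c0)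
    ipoly (p c) * 'X_[mcat 0 (floor_mon (val c))] = 0 :> Cox k XX.
  apply/eqP; rewrite -tofrac_eq0 raddf_sum /=; apply/eqP.
  apply: (mulIf (invr_neq0 q0')); rewrite mul0r mulr_suml.
  have := congr1 (monalg.mcoeff (cls c0)) g0; rewrite monalg.mcoeff0 mcoeff_phi => e.
  rewrite -[RHS]e big_seq_cond [RHS]big_seq_cond; apply: eq_bigr => c /andP[cg _].
  by rewrite hp // (frac_mapE (@inl_poly_inj k r r)) // ymonE tofracM mulrAC.
suff p0 : p c0 = 0 by rewrite hp // p0 tofrac0 mul0r.
apply/mpolyP => u; rewrite mcoeff0.
have := congr1 (mcoeff (mcat u (floor_mon (val c0)))) sum0; rewrite mcoeff0 raddf_sum /=.
under eq_bigr => c _ do rewrite mcoeff_inl_poly.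
rewrite big_mkcond (bigD1_seq c0) ?fset_uniq //= !eqxx big1 ?addr0 // => c cc0.
case: eqP => // ce; case: eqP => // fe; move: cc0; rewrite (cls_inj ce) ?eqxx //.
apply/rowP => j; have /mnmP/(_ j) := fe; rewrite !mnmE.
have /inDP[_ /(_ j)] := (DcellP c).1; have /inDP[_ /(_ j)] := (DcellP c0).1.
by move: ((val c).1 0 j) ((val c0).1 0 j) => x y; lia.
Qed.

Let sections_reached i s (G : {malg L[Ecell i]}) := exists2 g, F_secs s g & phi g = G.

Let reached0 i s : @sections_reached i s 0.
Proof. by exists 0; [move=> c; rewrite monalg.mcoeff0; exact: loc0|exact: phi0]. Qed.

Let reachedD i s (G H : {malg L[Ecell i]}) :
  sections_reached s G -> sections_reached s H -> sections_reached s (G + H).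
Proof.
move=> [g hg <-] [h hh <-]; exists (g + h); last exact: phiD.
by move=> c; rewrite monalg.mcoeffD; apply: locD; [exact: hg|exact: hh].
Qed.

Let reached_sum i s (I : eqType) (l : seq I) (G : I -> {malg L[Ecell i]}) :
  {in l, forall x, sections_reached s (G x)} -> sections_reached s (\sum_(x <- l) G x).
Proof.
move=> h; rewrite big_seq; apply: (big_ind (sections_reached s)).
- exact: reached0.
- exact: reachedD.
- exact: h.
Qed.

Let reached_monomial i s (e : Ecell i) N M (a : k) :
  same_deg (X := XX) (expo M) (row_mx (- (Erep e).2 + xhat s *+ N) (alpha + (Erep e).1)) ->
  sections_reached s (monalg.mkmalgU e
    (tofrac (a *: 'X_[M] : Cox k XX) / tofrac (ipoly (xmon k (xhat s)) ^+ N))).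
Proof.
rewrite -{1}[M]mcatK expo_mcat => /same_deg_prod[h1 h2].
have ge0 l : 0 <= (expo (mright M)) 0 l by rewrite mxE.
have [c ce c1] := cls_exists ge0 h2.
have [hc _] := cls_deg c; rewrite ce in hc.
exists (monalg.mkmalgU c (tofrac (a *: 'X_[mleft M] : Cox k X) / tofrac (xmon k (xhat s)) ^+ N)).
  move=> d; rewrite monalg.mcoeffU; case: eqP => [<-|_]; last exact: loc0.
  exists N, (a *: 'X_[mleft M]); split=> // m /msuppZ_le; rewrite msuppX inE => /eqP ->.
  apply: same_deg_trans h1 _; apply: same_degD; [exact: same_deg_sym|exact: same_deg_refl].
apply: etrans (phiU _ _) _; rewrite ce; congr (monalg.mkmalgU _ _).
rewrite -tofracXn (frac_mapE (@inl_poly_inj k r r)) ?expf_neq0 ?xmon_neq0 //.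
rewrite rmorphXn ymonE mulrAC -tofracM; congr (tofrac _ / _).
have E : ipoly (a *: 'X_[mleft M]) = a *: 'X_[mcat (mleft M) 0].
  by rewrite inl_polyZ inl_polyX.
apply: etrans (congr1 (fun p => p * 'X_[mcat 0 (floor_mon (val c))]) E) _.
rewrite -scalerAl -mpolyXD mcatD addm0 add0m.
congr (_ *: 'X_[_]); rewrite -[RHS]mcatK; congr mcat.
by apply/mnmP => l; rewrite mnmE c1 mxE.
Qed.

(** By [loc_all_charts] only powers of x remain in the denominator. The numerator then splits into
    monomials, each reached from the cell of D whose floor is its y exponent. *)
Lemma phi_surj i s (G : {malg L[Ecell i]}) : G_secs s G -> exists2 g, F_secs s g & phi g = G.
Proof.
move=> hG; rewrite (monalg.monalgE G); apply: reached_sum => e _.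
have [|N [P [hP ->]]] := @loc_all_charts k X R HX s (- (Erep e).2)
  (alpha + (Erep e).1) (monalg.mcoeff e G).
  by move=> t tX; rewrite -Gdeg_twist; exact: hG.
rewrite {1}[P]mpolyE raddf_sum /= mulr_suml raddf_sum /=; apply: reached_sum => M MP.
by apply: reached_monomial; exact: hP.
Qed.

End Bijection.

Section MainIso.
Variables (R : realType) (k : fieldType) (X : toric) (HX : smooth_projective R X).
Variable alpha : 'rV[int]_(nray X).
Variable eps : cell (nray X) -> cell (nray X) -> int.
Hypothesis Heps : incidence R 0 eps.
Hypothesis Hinv : forall m s t, eps (shift (Mincl m) s) (shift (Mincl m) t) = eps s t.

Lemma Ftilde_fourier_mukai :
  sheaf_complex_iso (Ftilde R k alpha eps alpha) (fourier_mukai R k eps alpha).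
Proof.
exists (fun i _ g => @phi R k X alpha i g); split.
- move=> i s sX; split.
  + move=> g; exact: phi_secs.
  + move=> g h _ _ e; apply/eqP; rewrite -subr_eq0; apply/eqP; apply: phi_eq0.
    apply: (addIr (phi h)); rewrite -phiD subrK add0r; exact: e.
  + by move=> G hG; have [g hg <-] := phi_surj HX hG; exists g.
- move=> i s sX g h _ _; exact: phiD.
- move=> i s sX f g _ _; exact: phiZ.
- by move=> i s t _ _ g _.
- move=> i s sX g _; exact: (phi_Fbd Hinv g).
Qed.

End MainIso.

Theorem mainTheorem1 (R : realType) (k : closedFieldType) (X : toric)
    (HX : smooth_projective R X)
    (alpha : 'rV[int]_(nray X)) (Hnef : nef k alpha)
    (eps : cell (nray X) -> cell (nray X) -> int)
    (Heps : incidence R 0 eps)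
    (Hinv : forall m s t,
      eps (shift (Mincl m) s) (shift (Mincl m) t) = eps s t) :
  (* (1) F is the cellular complex of the labeled cell complex D, supported on
     the polytope P_d of the monomials of S_d *)
  [/\ labeled_cell_complex_on R alpha (Mpolytope R alpha),
      incidence R alpha (transport alpha eps),
      exists B : R, forall b, Mpolytope R alpha b -> forall i, b 0 i <= B
    & forall e : 'rV[int]_(nray X),
        Mpolytope R alpha (map_mx intr e) <->
        exists m : 'X_{1..nray X}, e = expo m /\ in_deg alpha ('X_[m] : Cox k X)]
  /\
  (* (2) graded free resolution of trunc_d(S) *)
  [/\ forall i (g : Fmod R k alpha i.+2), Fd eps (Fd eps g) = 0,
      forall i b (g : Fmod R k alpha i.+1), Fin_deg b g -> Fin_deg b (Fd eps g),
      forall i (g : Fmod R k alpha i.+1), Fd eps g = 0 ->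
        exists h : Fmod R k alpha i.+2, Fd eps h = g
    & exists pi : {linear Fmod R k alpha 0 -> Cox k X | *%R},
        [/\ forall b (g : Fmod R k alpha 0), Fin_deg b g -> in_deg b (pi g),
            range pi = trunc R k alpha
          & forall g : Fmod R k alpha 0, pi g = 0 <->
              exists h : Fmod R k alpha 1, Fd eps h = g]]
  /\
  (* (3) length at most dim X *)
  (forall i, (tdim X < i)%N -> forall g : Fmod R k alpha i, g = 0)
  /\
  (* (4) the sheafification of F(d) is the Fourier-Mukai transform of O(d) *)
  sheaf_complex_iso (Ftilde R k alpha eps alpha) (fourier_mukai R k eps alpha).

Proof.
have Heps' := incidence_transport alpha Heps.
split; last split; last split.
- split.
  + exact: labeled_cell_complex HX alpha.
  + exact: Heps'.
  + exact: Mpolytope_bounded HX alpha.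
  + by move=> e; exact: Mpolytope_monomials HX alpha k e.
- split.
  + by move=> i g; exact: Fd_Fd.
  + by move=> i b g; exact: Fd_deg.
  + by move=> i g; exact: Fd_exact.
  + exists (@augmentation R X k alpha); split.
    * by move=> b g; exact: augmentation_deg.
    * exact: range_augmentation Heps'.
    * by move=> g; exact: augmentation_ker.
- by move=> i lt g; exact: Fmod_length.
- exact: Ftilde_fourier_mukai.
Qed.
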